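(* Let $d\ge3$ and $g<\binom{d-2}{2}$ be integers, set $a:=\binom{d-1}{2}-g$, let $S=K[x,y,z,t]$ and $$I=(x^2,\;xy,\;y^d,\;y^{d-1}z^{a-d+2}+xt^a)\subset S.$$ Then $$\operatorname{hdeg} S/I=d+a(a-d+2)\quad\text{and}\quad \operatorname{hdeg} S/I^{lex}=d+ad.$$ For $d=3,\ a=2$ this gives $\operatorname{hdeg} S/I=5<9=\operatorname{hdeg} S/I^{lex}$, and for $d=3,\ a=5$ it gives $\operatorname{hdeg} S/I=23>18=\operatorname{hdeg} S/I^{lex}$. Hence neither the relation $\operatorname{hdeg} S/I\le\operatorname{hdeg} S/I^{lex}$ nor the relation $\operatorname{hdeg} S/I\ge\operatorname{hdeg} S/I^{lex}$ is true for all homogeneous ideals $I$, not even for two-dimensional rings $S/I$.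
   Context: $K$ is an infinite field and polynomial rings have the standard grading; for a polynomial ring $S$ in $n$ variables, $\omega_S=S(-n)$ (here $n=4$). Degree: for a finitely generated graded $S$-module $M$ with $\dim M=d>0$, $\deg M=e(M)$, where the Hilbert polynomial of $M$ is $\frac{e(M)}{(d-1)!}t^{d-1}+(\text{lower order terms})$; if $\dim M=0$, then $\deg M$ is the length of $M$; $\deg 0=0$. Homological degree: recursively on $\dim M$, $\operatorname{hdeg} M=\deg M+\sum_{i=0}^{\dim M-1}\binom{\dim M-1}{i}\operatorname{hdeg}\operatorname{Ext}_S^{n-i}(M,\omega_S)$. Lexicographic ideal: $I^{lex}$ is the monomial ideal such that for every $i$, $(I^{lex})_i$ is spanned by the $\dim_KI_i$ lexicographically largest monomials of degree $i$, where $x>y>z>t$ (i.e. $x^u>x^v$ if the first non-zero entry of $u-v$ is positive). *)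

(* Defs.v *)
From HB Require Import structures.
From mathcomp Require Import all_boot all_order all_algebra.
From mathcomp Require Export mpoly.

Set Implicit Arguments.
Unset Strict Implicit.
Unset Printing Implicit Defensive.

Import Order.TTheory GRing.Theory Num.Theory.
Local Open Scope ring_scope.

Definition infinite_field (K : fieldType) : Prop :=
  forall s : seq K, exists c : K, c \notin s.

(** * Ideals of S = K[X_0, ..., X_(n-1)] *)

Definition is_ideal (K : fieldType) (n : nat) (J : {mpoly K[n]} -> Prop) : Prop :=
  J 0 /\ (forall a p q, J p -> J q -> J (a * p + q)).

Definition is_prime (K : fieldType) (n : nat) (P : {mpoly K[n]} -> Prop) : Prop :=
  [/\ is_ideal P, ~ P 1 & forall p q, P (p * q) -> P p \/ P q].

Definition homogeneous_ideal (K : fieldType) (n : nat)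
    (J : {mpoly K[n]} -> Prop) : Prop :=
  is_ideal J /\ (forall p, J p -> forall i : nat, J (pihomog mdeg i p)).

Definition ideal_gen (K : fieldType) (n : nat) (s : seq {mpoly K[n]})
    (p : {mpoly K[n]}) : Prop :=
  exists c : 'I_(size s) -> {mpoly K[n]}, p = \sum_i c i * s`_i.

(* Chains P_0 < P_1 < ... < P_r of primes containing J; r is the Krull
   dimension of S/J when no such chain is longer.  For J = S there is no such
   r: the zero module has no dimension here. *)
Definition prime_chain (K : fieldType) (n : nat) (J : {mpoly K[n]} -> Prop)
    (r : nat) : Prop :=
  exists P : nat -> {mpoly K[n]} -> Prop,
    [/\ forall i, (i <= r)%N -> is_prime (P i),
        forall p, J p -> P 0%N p
      & forall i, (i < r)%N ->
          (forall p, P i p -> P i.+1 p) /\ (exists2 p, P i.+1 p & ~ P i p)].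

Definition ring_dim (K : fieldType) (n : nat) (J : {mpoly K[n]} -> Prop)
    (r : nat) : Prop :=
  prime_chain J r /\ (forall r', prime_chain J r' -> (r' <= r)%N).

(** * Finitely generated graded S-modules *)

(* Homogeneous of degree e, for an integer e; a negative e forces p = 0. *)
Definition homog_poly (K : fieldType) (n : nat) (e : int) (p : {mpoly K[n]}) : Prop :=
  forall m, m \in msupp p -> (mdeg m)%:Z = e.

(* The graded free module \bigoplus_k S(- s k) is the space of row vectors, its
   k-th basis vector having degree s k. *)
Definition homog_vec (K : fieldType) (n r : nat) (s : 'I_r -> int) (e : int)
    (v : 'rV[{mpoly K[n]}]_r) : Prop :=
  forall k, homog_poly (e - s k) (v 0 k).

Definition is_submod (K : fieldType) (n r : nat)
    (W : 'rV[{mpoly K[n]}]_r -> Prop) : Prop :=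
  W 0 /\ (forall (a : {mpoly K[n]}) u v, W u -> W v -> W (a *: u + v)).

Definition is_graded_submod (K : fieldType) (n r : nat) (s : 'I_r -> int)
    (W : 'rV[{mpoly K[n]}]_r -> Prop) : Prop :=
  is_submod W /\
  (forall w, W w -> exists (l : nat) (c : 'I_l -> 'rV[{mpoly K[n]}]_r)
                           (e : 'I_l -> int),
     (forall i, W (c i) /\ homog_vec s (e i) (c i)) /\ w = \sum_i c i).

(* S being noetherian, every finitely generated graded module is isomorphic to
   a subquotient num / den of some \bigoplus_k S(- shift k), and conversely. *)
Record gmod (K : fieldType) (n : nat) := Gmod {
  rk : nat;
  shift : 'I_rk -> int;
  num : 'rV[{mpoly K[n]}]_rk -> Prop;
  den : 'rV[{mpoly K[n]}]_rk -> Prop }.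

Arguments shift {K n} M _ : rename.
Arguments num {K n} M _ : rename.
Arguments den {K n} M _ : rename.

Definition is_gmod (K : fieldType) (n : nat) (M : gmod K n) : Prop :=
  [/\ is_graded_submod (shift M) (num M),
      is_graded_submod (shift M) (den M)
    & forall v, den M v -> num M v].

Definition is_zero_gmod (K : fieldType) (n : nat) (M : gmod K n) : Prop :=
  forall v, num M v -> den M v.

Definition quot_mod (K : fieldType) (n : nat) (J : {mpoly K[n]} -> Prop) : gmod K n :=
  @Gmod K n 1 (fun _ => 0) (fun _ => True) (fun v => J (v 0 0)).

Definition ideal_mod (K : fieldType) (n : nat) (J : {mpoly K[n]} -> Prop) : gmod K n :=
  @Gmod K n 1 (fun _ => 0) (fun v => J (v 0 0)) (fun v => v = 0).

Definition ann (K : fieldType) (n : nat) (M : gmod K n) (p : {mpoly K[n]}) : Prop :=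
  forall v, num M v -> den M (p *: v).

Definition mod_dim (K : fieldType) (n : nat) (M : gmod K n) (r : nat) : Prop :=
  ring_dim (ann M) r.

(* dim_K M_j = k: M_j has a K-basis of k elements. *)
Definition hilbert_fun (K : fieldType) (n : nat) (M : gmod K n) (j : int)
    (k : nat) : Prop :=
  exists b : 'I_k -> 'rV[{mpoly K[n]}]_(rk M),
    [/\ forall i, num M (b i) /\ homog_vec (shift M) j (b i),
        forall c : 'I_k -> K,
          den M (\sum_i (c i)%:MP *: b i) -> forall i, c i = 0
      & forall v, num M v -> homog_vec (shift M) j v ->
          exists c : 'I_k -> K, den M (v - \sum_i (c i)%:MP *: b i)].

Definition is_hilbert_poly (K : fieldType) (n : nat) (M : gmod K n)
    (p : {poly rat}) : Prop :=
  exists j0 : nat, forall j : nat, (j0 <= j)%N ->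
    exists2 k : nat, hilbert_fun M j%:Z k & p.[j%:R] = k%:R.

(* l is the number of factors of a composition series of M = num M / den. *)
Definition mod_length (K : fieldType) (n : nat) (M : gmod K n) (l : nat) : Prop :=
  exists N : nat -> 'rV[{mpoly K[n]}]_(rk M) -> Prop,
    [/\ forall i, (i <= l)%N -> is_submod (N i),
        forall v, N 0%N v <-> den M v,
        forall v, N l v <-> num M v
      & forall i, (i < l)%N ->
          [/\ forall v, N i v -> N i.+1 v,
              exists2 v, N i.+1 v & ~ N i v
            & forall W, is_submod W ->
                (forall v, N i v -> W v) -> (forall v, W v -> N i.+1 v) ->
                (forall v, W v <-> N i v) \/ (forall v, W v <-> N i.+1 v)]].

Inductive is_deg (K : fieldType) (n : nat) (M : gmod K n) : nat -> Prop :=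
| DegZero : is_zero_gmod M -> is_deg M 0%N
| DegLength (l : nat) : mod_dim M 0%N -> mod_length M l -> is_deg M l
| DegHilbert (r e : nat) (p : {poly rat}) :
    mod_dim M r.+1 -> is_hilbert_poly M p ->
    (size p <= r.+1)%N -> p`_r = e%:R / (r`!)%:R -> is_deg M e.

(** * Ext_S^i(M, omega_S) *)

(* Graded free modules F_i = \bigoplus_k S(- res_shift i k), with differentials
   F_(i+1) -> F_i given by v |-> v *m res_diff i and augmentation
   F_0 -> M = num M / den M given by v |-> v *m res_aug. *)
Record resolution_data (K : fieldType) (n m : nat) := ResolutionData {
  res_rk : nat -> nat;
  res_shift : forall i, 'I_(res_rk i) -> int;
  res_diff : forall i, 'M[{mpoly K[n]}]_(res_rk i.+1, res_rk i);
  res_aug : 'M[{mpoly K[n]}]_(res_rk 0%N, m) }.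

Arguments res_shift {K n m} F i _ : rename.

Definition homog_mx (K : fieldType) (n r r' : nat) (s : 'I_r -> int)
    (s' : 'I_r' -> int) (A : 'M[{mpoly K[n]}]_(r, r')) : Prop :=
  forall i j, homog_poly (s i - s' j) (A i j).

Definition is_free_resolution (K : fieldType) (n : nat) (M : gmod K n)
    (F : resolution_data K n (rk M)) : Prop :=
  (homog_mx (res_shift F 0%N) (shift M) (res_aug F) /\
   (forall i, homog_mx (res_shift F i.+1) (res_shift F i)
                       (res_diff F i))) /\
  [/\ forall v, num M (v *m res_aug F),
      forall u, num M u -> exists v, den M (u - v *m res_aug F),
      forall v, den M (v *m res_aug F) <-> exists w, v = w *m res_diff F 0%N
    & forall i (v : 'rV_(res_rk F i.+1)),
      v *m res_diff F i = 0 <-> exists w, v = w *m res_diff F i.+1].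

(* The i-th cohomology of Hom_S(F, S(-n)).  A homomorphism F_i -> S(-n) is
   recorded by the row of its values on the basis of F_i; the k-th element of
   the dual basis then has degree n - res_shift i k. *)
Definition ext_mod (K : fieldType) (n m : nat) (F : resolution_data K n m)
    (i : nat) : gmod K n :=
  @Gmod K n (res_rk F i) (fun k => n%:Z - res_shift F i k)
    (fun v => v *m (res_diff F i)^T = 0)
    (match i return 'rV[{mpoly K[n]}]_(res_rk F i) -> Prop with
     | 0%N => fun v => v = 0
     | i'.+1 => fun v => exists w, v = w *m (res_diff F i')^T
     end).

Definition is_ext_omega (K : fieldType) (n i : nat) (M E : gmod K n) : Prop :=
  exists2 F : resolution_data K n (rk M), is_free_resolution F & E = ext_mod F i.

(** * Homological degree *)

(* A relation rather than a function because the Ext modules depend on a choice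
   of resolution; another choice changes them by a graded isomorphism, under
   which the degree and the dimension are invariant, so that h is determined
   by M.  As dim Ext^(n-i)(M, omega_S) <= i < dim M, the recursion ends. *)
Inductive is_hdeg (K : fieldType) (n : nat) : gmod K n -> nat -> Prop :=
| HdegZero (M : gmod K n) : is_gmod M -> is_zero_gmod M -> is_hdeg M 0%N
| HdegRec (M : gmod K n) (r e : nat) (E : 'I_r -> gmod K n) (h : 'I_r -> nat) :
    is_gmod M -> mod_dim M r -> is_deg M e ->
    (forall i : 'I_r, is_ext_omega (n - i)%N M (E i)) ->
    (forall i : 'I_r, is_hdeg (E i) (h i)) ->
    is_hdeg M (e + \sum_(i < r) 'C(r.-1, i) * h i)%N.

(** * Lexicographic ideals *)

Definition lex_gt (n : nat) (u v : 'X_{1..n}) : bool :=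
  [exists i : 'I_n, [forall j : 'I_n, (j < i)%N ==> (u j == v j)] && (v i < u i)%N].

(* Number of monomials of the same degree as m that are larger than m. *)
Definition lex_rank (n : nat) (m : 'X_{1..n}) : nat :=
  #|[set u : 'X_{1..n < (mdeg m).+1} | (mdeg u == mdeg m) && lex_gt u m]|.

(* p lies in the span of the monomials which, in their degree i, are among the
   dim_K J_i lexicographically largest ones. *)
Definition lex_ideal (K : fieldType) (n : nat) (J : {mpoly K[n]} -> Prop)
    (p : {mpoly K[n]}) : Prop :=
  forall m, m \in msupp p ->
    exists2 k : nat, hilbert_fun (ideal_mod J) (mdeg m)%:Z k & (lex_rank m < k)%N.

(** * The ideals (x^2, xy, y^d, y^(d-1) z^(a-d+2) + x t^a) of K[x,y,z,t] *)

(* a - d + 2 is written a + 2 - d since subtraction is truncated and a = d - 1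
   is allowed. *)
Definition curve_ideal (K : fieldType) (d a : nat) : {mpoly K[4]} -> Prop :=
  let x : {mpoly K[4]} := 'X_(@Ordinal 4 0 isT) in
  let y : {mpoly K[4]} := 'X_(@Ordinal 4 1 isT) in
  let z : {mpoly K[4]} := 'X_(@Ordinal 4 2 isT) in
  let t : {mpoly K[4]} := 'X_(@Ordinal 4 3 isT) in
  ideal_gen [:: x ^+ 2; x * y; y ^+ d;
                y ^+ d.-1 * z ^+ (a + 2 - d) + x * t ^+ a].

Arguments curve_ideal : clear implicits.

(* Main.v *)
(* Put b = a - d + 2.  S/I has the free resolution 0 -> S -> S^4 -> S^4 -> S
   given by the matrices curve_gens, curve_syz, curve_syz2 below.  Hence
   Ext^4(S/I, omega) = 0, and Ext^3 is, up to a shift, S/(x, y, z^b, t^a), of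
   length ab.  The standard monomials of I are those with x = 0, y < d
   (exponents) and those with x = 1, y = 0, t < a, so that deg S/I = d and
   hdeg S/I = d + ab.

   The ideal I^lex is never described by generators: in degree j its standard
   monomials are the H(j) smallest ones, H being the Hilbert function of S/I.
   This suffices to see that it is an ideal and that it lies in its saturation
   (x, y^(d+1), y^d z^a), with a quotient of length a(d-1).  So S/I^lex has a
   filtration with factors S/(x, y^d), a shift of S/(x, y, z^a), and a(d-1)
   shifted copies of K.  The Koszul complexes of the factors have cohomology only
   in the degrees 2, 3, 4 respectively; splicing them by the horseshoe lemma gives a
   resolution of S/I^lex with Ext^3 a shift of S/(x, y, z^a), of hdeg a, and
   Ext^4 of length a(d-1).  Thus hdeg S/I^lex = d + a + a(d-1) = d + ad. *)
Require Import Defs.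
From mathcomp Require Import all_boot all_order all_algebra ring zify.
From Stdlib Require Import Classical ClassicalEpsilon FunctionalExtensionality PropExtensionality.

Set Implicit Arguments.
Unset Strict Implicit.
Unset Printing Implicit Defensive.

Import Order.TTheory GRing.Theory Num.Theory.
Local Open Scope ring_scope.

(** * Homogeneous components *)

(** [is_hdeg] accepts any free resolution, so one explicit resolution per module is enough, and
    every Ext module is found by chasing row vectors through the long exact sequence of a splice or
    of a mapping cone. These sequences degenerate because one of their outer terms has Ext in a
    single degree. Along the filtration of S/I^lex one further fact has to be carried: Ext^5 = 0,
    the target of the connecting map that starts at Ext^4 of a new factor K. Krull dimension is
    defined by chains of primes, so its upper bound comes from counting: a chain of length r gives
    q^r products of polynomials that are linearly independent modulo the smallest prime, while the
    monomials in s free variables available for them number only O(q^s). That I^lex is an ideal is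
    an instance of Macaulay's theorem. Here the Hilbert function is explicit, and t m is the
    smallest of the multiples X_i m, so comparing the numbers of monomials below m and below t m
    suffices. The bound on g enters as a >= d - 1, because binom(d-1,2) - binom(d-2,2) = d - 2. *)

Section HomogeneousComponents.
Variables (K : fieldType) (n : nat).
Implicit Types (p q : {mpoly K[n]}) (e d : int).

Definition hcomp e p : {mpoly K[n]} :=
  if e is Posz k then pihomog mdeg k p else 0.

Lemma mcoeff_hcomp e p m :
  (hcomp e p)@_m = if (mdeg m)%:Z == e then p@_m else 0.
Proof.
case: e => k; last by rewrite /hcomp raddf0.
rewrite /hcomp.
rewrite pihomogE raddf_sum /= big_mkcond /=.
have [mp|/memN_msupp_eq0 mp] := boolP (m \in msupp p); last first.
  rewrite mp if_same big1_seq // => m' /andP[_ m'p]; case: ifP => // _.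
  rewrite mcoeffZ mcoeffX; case: eqP => [E|_]; last by rewrite mulr0.
  by rewrite E mp mul0r.
rewrite (bigD1_seq m) ?msupp_uniq //= big1 => [|m' nm]; last first.
  by case: ifP => // _; rewrite mcoeffZ mcoeffX (negbTE nm) mulr0.
rewrite addr0 eqz_nat; case: ifP => _ //.
by rewrite mcoeffZ mcoeffX eqxx mulr1.
Qed.

Lemma homog_polyP e p :
  homog_poly e p <-> forall m, p@_m != 0 -> (mdeg m)%:Z = e.
Proof. by split=> h m; move: (h m); rewrite mcoeff_msupp. Qed.

Lemma hcomp_id e p : homog_poly e p -> hcomp e p = p.
Proof.
move=> /homog_polyP h; apply/mpolyP => m; rewrite mcoeff_hcomp.
case: eqP => // ne; have [->//|/h] := eqVneq p@_m 0; by move/ne.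
Qed.

Lemma hcomp_homog e p : homog_poly e (hcomp e p).
Proof.
by apply/homog_polyP => m; rewrite mcoeff_hcomp; case: ifP => [/eqP //|_]; rewrite eqxx.
Qed.

Lemma hcompD e p q : hcomp e (p + q) = hcomp e p + hcomp e q.
Proof.
apply/mpolyP => m; rewrite mcoeffD !mcoeff_hcomp mcoeffD.
by case: ifP; rewrite ?addr0.
Qed.

Lemma hcomp0 e : hcomp e 0 = 0.
Proof. by apply/mpolyP => m; rewrite mcoeff_hcomp mcoeff0 if_same. Qed.

Lemma hcomp_sum e (I : Type) (r : seq I) (P : pred I) (F : I -> {mpoly K[n]}) :
  hcomp e (\sum_(i <- r | P i) F i) = \sum_(i <- r | P i) hcomp e (F i).
Proof. exact: (big_morph _ (hcompD e) (hcomp0 e)). Qed.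

Lemma hcompM d e p q : homog_poly e q -> hcomp (d + e) (p * q) = hcomp d p * q.
Proof.
move=> /homog_polyP hq; apply/mpolyP => m; rewrite mcoeff_hcomp.
rewrite !(mcoeffMr _ _ m).
case: eqP => hm.
  apply: eq_bigr => -[k1 k2] /= /eqP E; rewrite mcoeff_hcomp.
  have [->|/hq h2] := eqVneq q@_k1 0; first by rewrite !mulr0.
  case: eqP => // ne; case: ne; have := congr1 (@mdeg n) E; rewrite mdegD; lia.
rewrite big1 // => -[k1 k2] /= /eqP E; rewrite mcoeff_hcomp.
have [->|/hq h2] := eqVneq q@_k1 0; first by rewrite mulr0.
case: eqP => [h|_]; last by rewrite mul0r.
by case: hm; have := congr1 (@mdeg n) E; rewrite mdegD; lia.
Qed.

Lemma homog_poly0 e : homog_poly e (0 : {mpoly K[n]}).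
Proof. by apply/homog_polyP => m; rewrite mcoeff0 eqxx. Qed.

Lemma homog_polyX (m : 'X_{1..n}) e : (mdeg m)%:Z = e -> homog_poly e ('X_[m] : {mpoly K[n]}).
Proof.
move=> <-; apply/homog_polyP => k; rewrite mcoeffX.
by case: (m =P k) => [->|_] //; rewrite eqxx.
Qed.

Lemma homog_polyC e c : e = 0 -> homog_poly e (c%:MP : {mpoly K[n]}).
Proof.
move=> ->; apply/homog_polyP => m; rewrite mcoeffC.
by case: (m =P 0%MM) => [->|_]; rewrite ?mdeg0 // mulr0 eqxx.
Qed.

Lemma homog_polyN e p : homog_poly e p -> homog_poly e (- p).
Proof. by move=> /homog_polyP h; apply/homog_polyP=> m; rewrite mcoeffN oppr_eq0; apply: h. Qed.

Lemma homog_polyD e p q : homog_poly e p -> homog_poly e q -> homog_poly e (p + q).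
Proof. by move=> hp hq; rewrite -[p](hcomp_id hp) -[q](hcomp_id hq) -hcompD; apply: hcomp_homog. Qed.

Lemma homog_polyM d e p q :
  homog_poly d p -> homog_poly e q -> homog_poly (d + e) (p * q).
Proof. by move=> hp hq; rewrite -[p](hcomp_id hp) -(hcompM _ _ hq); apply: hcomp_homog. Qed.

End HomogeneousComponents.

Section HomogeneousVectors.
Variables (K : fieldType) (n : nat).
Local Notation S := {mpoly K[n]}.

Definition vcomp r (s : 'I_r -> int) (e : int) (v : 'rV[S]_r) : 'rV[S]_r :=
  \row_k hcomp (e - s k) (v 0 k).

Lemma vcomp_homog r (s : 'I_r -> int) e v : homog_vec s e (vcomp s e v).
Proof. by move=> k; rewrite mxE; apply: hcomp_homog. Qed.

Lemma vcomp_id r (s : 'I_r -> int) e v : homog_vec s e v -> vcomp s e v = v.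
Proof. by move=> h; apply/rowP => k; rewrite mxE hcomp_id. Qed.

Lemma vcomp0 r (s : 'I_r -> int) e : vcomp s e 0 = 0.
Proof. by apply/rowP => k; rewrite !mxE hcomp0. Qed.

Lemma vcompD r (s : 'I_r -> int) e u v :
  vcomp s e (u + v) = vcomp s e u + vcomp s e v.
Proof. by apply/rowP => k; rewrite !mxE hcompD. Qed.

Lemma vcompN r (s : 'I_r -> int) e v : vcomp s e (- v) = - vcomp s e v.
Proof.
by apply/eqP; rewrite -addr_eq0 -vcompD addNr vcomp0.
Qed.

Lemma vcompB r (s : 'I_r -> int) e u v :
  vcomp s e (u - v) = vcomp s e u - vcomp s e v.
Proof. by rewrite vcompD vcompN. Qed.

Lemma vcompZ r (s : 'I_r -> int) d e p (v : 'rV[S]_r) :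
  homog_vec s e v -> vcomp s (d + e) (p *: v) = hcomp d p *: v.
Proof.
move=> h; apply/rowP => k; rewrite !mxE -addrA; exact: hcompM.
Qed.

Lemma vcomp_mul r r' (s : 'I_r -> int) (s' : 'I_r' -> int) (A : 'M[S]_(r, r')) e v :
  homog_mx s s' A -> vcomp s' e (v *m A) = vcomp s e v *m A.
Proof.
move=> hA; apply/rowP => k; rewrite !mxE hcomp_sum; apply: eq_bigr => i _.
rewrite mxE -(hcompM (e - s i) _ (hA i k)); congr hcomp; lia.
Qed.

Lemma vcomp_sum_all r (s : 'I_r -> int) (v : 'rV[S]_r) :
  exists l (e : 'I_l -> int), v = \sum_i vcomp s (e i) v.
Proof.
(* A monomial [m] of the entry [k] has total degree [s k + mdeg m], which lies strictly between - N
   and N; hence 2N degrees starting at - N exhaust [v]. *)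
pose N := (\sum_k (absz (s k) + msize (v ord0 k)%R))%N.
exists (N + N)%N, (fun i => i%:Z - N%:Z); apply/rowP => k; rewrite summxE.
apply/mpolyP => m; rewrite raddf_sum /=.
have [vm|nz] := eqVneq (v 0 k)@_m 0.
  by rewrite big1 // => i _; rewrite mxE mcoeff_hcomp vm if_same.
have lm : (mdeg m < msize (v ord0 k))%N by apply: msize_mdeg_lt; rewrite mcoeff_msupp.
have lN : (absz (s k) + msize (v ord0 k) <= N)%N.
  by rewrite /N (bigD1 k) //= leq_addr.
have l0 : (absz (N%:Z + s k + (mdeg m)%:Z)%R < N + N)%N by lia.
rewrite (bigD1 (Ordinal l0)) //= mxE mcoeff_hcomp.
have -> : (mdeg m)%:Z == (absz (N%:Z + s k + (mdeg m)%:Z))%:Z - N%:Z - s k by apply/eqP; lia.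
rewrite big1 ?addr0 // => i ne; rewrite mxE mcoeff_hcomp; case: eqP => // h.
by case/eqP: ne; apply: val_inj => /=; lia.
Qed.

Lemma graded_submod_vcomp r (s : 'I_r -> int) (W : 'rV[S]_r -> Prop) :
  is_submod W -> (forall e w, W w -> W (vcomp s e w)) -> is_graded_submod s W.
Proof.
move=> sW hW; split=> // w Ww; have [l [e E]] := vcomp_sum_all s w.
exists l, (fun i => vcomp s (e i) w), e; split=> // i; split; first exact: hW.
exact: vcomp_homog.
Qed.

Lemma submodD r (W : 'rV[S]_r -> Prop) u v : is_submod W -> W u -> W v -> W (u + v).
Proof. by case=> _ h Wu Wv; rewrite -[u]scale1r; apply: h. Qed.

Lemma submodZ r (W : 'rV[S]_r -> Prop) a u : is_submod W -> W u -> W (a *: u).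
Proof. by case=> h0 h Wu; rewrite -[_ *: _]addr0; apply: h. Qed.

Lemma submodN r (W : 'rV[S]_r -> Prop) u : is_submod W -> W u -> W (- u).
Proof. by move=> sW Wu; rewrite -scaleN1r; apply: submodZ. Qed.

Lemma submodB r (W : 'rV[S]_r -> Prop) u v : is_submod W -> W u -> W v -> W (u - v).
Proof. by move=> sW Wu Wv; apply: submodD => //; apply: submodN. Qed.

Lemma submod_subr r (W : 'rV[S]_r -> Prop) u v : is_submod W -> W (u - v) -> W v -> W u.
Proof. by move=> sW h Wv; rewrite -(subrK v u); apply: submodD. Qed.

Lemma submod_sum r (W : 'rV[S]_r -> Prop) (I : Type) (t : seq I) (P : pred I) F :
  is_submod W -> (forall i, P i -> W (F i)) -> W (\sum_(i <- t | P i) F i).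
Proof.
move=> sW h; apply: big_ind => //; first by case: sW.
by move=> u v; apply: submodD.
Qed.

Lemma submod_mul r r' (A : 'M[S]_(r, r')) : is_submod (fun v => exists w, v = w *m A).
Proof.
split; first by exists 0; rewrite mul0mx.
by move=> a u v [w ->] [w' ->]; exists (a *: w + w'); rewrite mulmxDl scalemxAl.
Qed.

Lemma submod_ker r r' (A : 'M[S]_(r, r')) : is_submod (fun v : 'rV_r => v *m A = 0).
Proof.
split; first by rewrite mul0mx.
by move=> a u v Eu Ev; rewrite mulmxDl -scalemxAl Eu Ev scaler0 addr0.
Qed.

Lemma submod0 r : is_submod (fun v : 'rV[S]_r => v = 0).
Proof. by split=> // a u v -> ->; rewrite scaler0 addr0. Qed.

Lemma is_gmod_intro (M : gmod K n) : is_submod (@num K n M) -> is_submod (@den K n M) ->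
  (forall e w, num M w -> num M (vcomp (shift M) e w)) ->
  (forall e w, den M w -> den M (vcomp (shift M) e w)) ->
  (forall v, den M v -> num M v) -> is_gmod M.
Proof. by move=> *; split=> //; apply: graded_submod_vcomp. Qed.

End HomogeneousVectors.

(** * Krull dimension *)

(** More unknowns than equations: a nonzero row of the left kernel. Arbitrary finite index types are
    allowed because the lemma is applied both to bases and to words against exponent functions. *)
Lemma linear_dependence (K : fieldType) (W T : finType) (A : W -> T -> K) :
  (#|T| < #|W|)%N ->
  exists c : W -> K, (exists w, c w != 0) /\ forall t, \sum_w c w * A w t = 0.
Proof.
move=> lt; pose M := \matrix_(i < #|W|, j < #|T|) A (enum_val i) (enum_val j).
have : kermx M != 0.
  rewrite kermx_eq0; apply/negP => /eqP rM.
  by have := rank_leq_col M; rewrite rM leqNgt lt.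
case/rowV0Pn => v /sub_kermxP vM nv; exists (fun w => v 0 (enum_rank w)); split.
  case/rV0Pn: nv => i vi.
  by exists (enum_val i); rewrite enum_valK.
move=> t; have := congr1 (fun z : 'rV_ _ => z 0 (enum_rank t)) vM.
rewrite !mxE => E; rewrite -[RHS]E (reindex (@enum_val W predT)) /=; last first.
  exact/onW_bij/enum_val_bij.
by apply: eq_bigr => i _; rewrite mxE enum_valK enum_rankK.
Qed.

Section Ideals.
Variables (K : fieldType) (n : nat).
Local Notation S := {mpoly K[n]}.
Implicit Types (J : S -> Prop) (p q : S).

Lemma idealM J a p : is_ideal J -> J p -> J (a * p).
Proof. by case=> h0 h Jp; rewrite -[_ * _]addr0; apply: h. Qed.

Lemma idealD J p q : is_ideal J -> J p -> J q -> J (p + q).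
Proof. by case=> h0 h Jp Jq; rewrite -[p]mul1r; apply: h. Qed.

Lemma idealB J p q : is_ideal J -> J p -> J q -> J (p - q).
Proof. by move=> iJ Jp Jq; apply: idealD => //; rewrite -mulN1r; apply: idealM. Qed.

Lemma ideal_sum J (I : Type) (r : seq I) (P : pred I) F :
  is_ideal J -> (forall i, P i -> J (F i)) -> J (\sum_(i <- r | P i) F i).
Proof.
move=> iJ h; apply: big_ind => //; first by case: iJ.
by move=> u v; apply: idealD.
Qed.

Lemma prime_expr J p k : is_prime J -> J (p ^+ k) -> J p.
Proof.
case=> iJ J1 Jm; elim: k => [|k IH]; first by rewrite expr0 => /J1.
by rewrite exprS => /Jm[].
Qed.

(** The kernel is the ideal generated by the variables in [A]; written as the kernel of a ring
    morphism, it is prime because S is a domain. *)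
Definition kill_vars (A : {set 'I_n}) p : S :=
  p \mPo [tuple if i \in A then 0 else 'X_i | i < n].

Lemma kill_varsX A m :
  kill_vars A 'X_[m] = if [forall i in A, m i == 0%N] then 'X_[m] else 0.
Proof.
rewrite /kill_vars comp_mpolyX.
case: ifP => [/forall_inP h|/negbT /forall_inPn [i iA mi]].
  rewrite [RHS]mpolyXE_id; apply: eq_bigr => i _; rewrite tnth_mktuple.
  by case: ifP => // /h /eqP ->; rewrite !expr0.
by rewrite (bigD1 i) //= tnth_mktuple iA expr0n (negbTE mi) mul0r.
Qed.

Lemma mcoeff_kill_vars A p m :
  (kill_vars A p)@_m = if [forall i in A, m i == 0%N] then p@_m else 0.
Proof.
rewrite /kill_vars comp_mpolyEX raddf_sum /= [in RHS](mpolyE p) raddf_sum /=.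
case: ifP => h.
  apply: eq_bigr => k _; rewrite !mcoeffZ -/(kill_vars A _) kill_varsX.
  congr (_ * _); case: ifP => // hk; rewrite mcoeff0 mcoeffX; case: (k =P m) => // E.
  by rewrite E h in hk.
rewrite big1 // => k _; rewrite mcoeffZ -/(kill_vars A _) kill_varsX.
case: ifP => hk; last by rewrite mcoeff0 mulr0.
rewrite mcoeffX; case: eqP => [E|]; last by rewrite mulr0.
by rewrite E h in hk.
Qed.

Lemma kill_vars0 A : kill_vars A 0 = 0. Proof. exact: raddf0. Qed.
Lemma kill_varsD A p q : kill_vars A (p + q) = kill_vars A p + kill_vars A q.
Proof. exact: raddfD. Qed.
Lemma kill_varsM A p q : kill_vars A (p * q) = kill_vars A p * kill_vars A q.
Proof. exact: rmorphM. Qed.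
Lemma kill_varsXn A p k : kill_vars A (p ^+ k) = kill_vars A p ^+ k.
Proof. exact: rmorphXn. Qed.

Lemma kill_vars_idem A p : kill_vars A (kill_vars A p) = kill_vars A p.
Proof. by apply/mpolyP => m; rewrite !mcoeff_kill_vars; case: (boolP [forall _ in _, _]). Qed.

Lemma kill_vars_eq0 A p :
  kill_vars A p = 0 <-> forall m, m \in msupp p -> exists2 i, i \in A & m i != 0%N.
Proof.
split=> [h m|h].
  rewrite mcoeff_msupp => pm; have := congr1 (mcoeff m) h.
  rewrite mcoeff_kill_vars mcoeff0; case: ifP => [_ E|/negbT /forall_inPn [i iA mi] _].
    by rewrite E eqxx in pm.
  by exists i.
apply/mpolyP => m; rewrite mcoeff_kill_vars mcoeff0; case: ifP => // /forall_inP hm.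
apply/eqP; apply: contraT; rewrite -mcoeff_msupp => /h [i /hm /eqP ->].
by rewrite eqxx.
Qed.

Lemma kill_vars_subset (A B : {set 'I_n}) p :
  A \subset B -> kill_vars A p = 0 -> kill_vars B p = 0.
Proof.
move=> sAB /kill_vars_eq0 h; apply/kill_vars_eq0 => m /h [i iA mi].
by exists i => //; apply: (subsetP sAB).
Qed.

Lemma kill_vars_prime A : is_prime (fun p => kill_vars A p = 0).
Proof.
split.
- split; first exact: kill_vars0.
  by move=> a p q hp hq; rewrite kill_varsD kill_varsM hp hq mulr0 addr0.
- by rewrite /kill_vars rmorph1 => /eqP; rewrite oner_eq0.
- move=> p q; rewrite kill_varsM => /eqP; rewrite mulf_eq0.
  by case/orP => /eqP; [left|right].
Qed.

End Ideals.

Section KrullDimension.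
Variables (K : fieldType) (n : nat).
Local Notation S := {mpoly K[n]}.

(** Exponent vectors of length [r] with entries below [q], nested as pairs so that [word_prod] and
    [chain_independent] can peel off the first factor. *)
Fixpoint words (q r : nat) : finType :=
  if r is r'.+1 then ('I_q * words q r')%type else unit.

Lemma card_words q r : #|words q r| = (q ^ r)%N.
Proof. by elim: r => [|r IH]; rewrite ?card_unit //= card_prod card_ord IH expnS. Qed.

Fixpoint word_prod (h : nat -> S) (q k r : nat) : words q r -> S :=
  match r with
  | 0 => fun _ => 1
  | r'.+1 => fun w => h k ^+ w.1 * word_prod h k.+1 w.2
  end.

Lemma word_prod_deg h q D k r (w : words q r) :
  (forall i m, m \in msupp (h i) -> (mdeg m <= D)%N) ->
  forall m, m \in msupp (word_prod h k w) -> (mdeg m <= r * (q * D))%N.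
Proof.
move=> hD; elim: r k w => [|r IH] k w m /=.
  by rewrite msupp1 inE => /eqP ->; rewrite mdeg0.
case/msuppM_le/allpairsP => -[m1 m2] /= [h1 h2 ->]; rewrite mdegD mulSn.
apply: leq_add; last exact: IH h2.
have {h2}: (mdeg m1 <= w.1 * D)%N; last first.
  by move/leq_trans; apply; rewrite leq_mul2r ltnW ?orbT.
elim: (nat_of_ord w.1) m1 h1 => [|j IHj] m1.
  by rewrite expr0 msupp1 inE => /eqP ->; rewrite mdeg0.
rewrite exprS => /msuppM_le/allpairsP [[a b] /= [/hD ha /IHj hb ->]].
by rewrite mdegD mulSn leq_add.
Qed.

(* Peeling off h k: a relation is divisible by the power h k ^+ i of its lowest
   nonzero coefficient; dividing by it (P k is prime, h k is not in P k) and
   reducing modulo P k.+1, which contains h k, leaves a relation one step up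
   the chain. *)
Lemma chain_independent (P : nat -> S -> Prop) (h : nat -> S) q r k :
  (forall i, (k <= i <= k + r)%N -> is_prime (P i)) ->
  (forall i, (k <= i < k + r)%N ->
     [/\ forall p, P i p -> P i.+1 p, P i.+1 (h i) & ~ P i (h i)]) ->
  forall c : words q r -> K,
  P k (\sum_w (c w)%:MP * word_prod h k w) -> forall w, c w = 0.
Proof.
elim: r k => [|r IH] k pP cP c.
  rewrite (big_pred1 tt) => [|[] //]; rewrite mulr1 => hc [].
  apply/eqP; apply: contraT => nc.
  have [|iJ J1 _] := pP k; first by lia.
  case: J1; have := idealM (c tt)^-1%:MP iJ hc.
  by rewrite -mpolyCM mulVf // mpolyC1.
have pk : is_prime (P k) by apply: pP; rewrite leqnn leq_addr.
have pk1 : is_prime (P k.+1) by apply: pP; lia.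
have [|sub hk nhk] := cP k; first by lia.
move=> hc.
have IH' : forall c' : words q r -> K,
    P k.+1 (\sum_w (c' w)%:MP * word_prod h k.+1 w) -> forall w, c' w = 0.
  apply: IH => i hi; first by apply: pP; lia.
  by apply: cP; lia.
pose F (i : 'I_q) : S := \sum_w (c (i, w))%:MP * word_prod h k.+1 w.
have E : \sum_w (c w)%:MP * word_prod h k w = \sum_(i < q) h k ^+ i * F i.
  rewrite /F; under [RHS]eq_bigr do rewrite big_distrr /=.
  rewrite pair_bigA /=; apply: eq_bigr => -[i w] _ /=; ring.
rewrite {}E in hc.
suff H : forall j, (j <= q)%N -> forall i : 'I_q, (i < j)%N -> forall w, c (i, w) = 0.
  by case=> i w; apply: (H q).
elim=> // j IHj ltj i; rewrite ltnS leq_eqVlt => /orP[/eqP ij|]; last exact/IHj/ltnW.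
apply: (IH' (fun w => c (i, w))); rewrite -/(F i).
have F0 (l : 'I_q) : (l < j)%N -> F l = 0.
  move=> lj; rewrite /F big1 // => w _.
  by rewrite (IHj (ltnW ltj) l lj) mpolyC0 mul0r.
have E : \sum_(i < q) h k ^+ i * F i = h k ^+ j *
   (F i + h k * \sum_(l < q | (j < l)%N) h k ^+ (l - j.+1) * F l).
  rewrite (bigID (fun l : 'I_q => (l < j)%N)) /= big1 ?add0r; last first.
    by move=> l /F0 ->; rewrite mulr0.
  rewrite (bigD1 i) /=; last by rewrite ij ltnn.
  rewrite ij mulrDr; congr (_ + _); rewrite mulrA -exprSr big_distrr /=.
  apply: eq_big => [l|l /andP[h1 h2]].
    rewrite -leqNgt; apply/andP/idP => [[jl li]|jl]; last first.
      by split; [exact: ltnW | apply/eqP => li; rewrite li ij ltnn in jl].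
    rewrite ltn_neqAle jl andbT; apply/eqP => jl'; case/eqP: li.
    by apply: val_inj; rewrite /= -jl' ij.
  rewrite mulrA -exprD subnKC // ltn_neqAle leqNgt h1 andbT.
  by apply/eqP => jl'; case/eqP: h2; apply: val_inj; rewrite /= -jl' ij.
rewrite {}E in hc.
have [iP P1 mP] := pk; have [iP' _ _] := pk1.
case/mP: hc => [/(prime_expr pk) /nhk //|/sub hc].
have := idealB iP' hc (idealM (\sum_(l < q | (j < l)%N) h k ^+ (l - j.+1) * F l) iP' hk).
by rewrite [X in _ - X]mulrC addrK.
Qed.

(** If r exceeded the number s of variables outside [A], choose h_i in P_(i+1) but not in P_i. The
    products of the h_i with exponents below q are independent modulo P_0 by [chain_independent].
    But P_0 contains the variables of [A], so modulo P_0 only monomials in s variables count, and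
    for large q there are too few of them. *)
Lemma prime_chain_le (J : S -> Prop) (A : {set 'I_n}) r :
  (forall i, i \in A -> exists k, J ('X_i ^+ k)) ->
  prime_chain J r -> (r <= #|~: A|)%N.
Proof.
move=> hA [P [pP JP cP]].
have hX i : i \in A -> P 0%N 'X_i.
  by case/hA => k /JP; apply: prime_expr; apply: pP.
have [h hh] : exists h : nat -> S, forall i, (i < r)%N -> P i.+1 (h i) /\ ~ P i (h i).
  have C i : exists p, (i < r)%N -> P i.+1 p /\ ~ P i p.
    have [ir|] := boolP (i < r)%N; last by exists 0.
    by have [_ [p p1 p2]] := cP i ir; exists p.
  exists (fun i => proj1_sig (constructive_indefinite_description _ (C i))).
  by move=> i; case: constructive_indefinite_description.
rewrite leqNgt; apply/negP => lt.
pose s := #|~: A|.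
(* Cutting [h] off at [r] provides one degree bound [D] valid for all indices, as [word_prod_deg]
   requires. *)
pose h' i : S := if (i < r)%N then h i else 0.
have [D hD] : exists D, forall i m, m \in msupp (h' i) -> (mdeg m <= D)%N.
  exists (\sum_(i < r) msize (h i))%N => i m; rewrite /h'; case: ltnP => [ir|_]; last first.
    by rewrite msupp0.
  move/msize_mdeg_lt/ltnW/leq_trans; apply.
  by rewrite (bigD1 (Ordinal ir)) //= leq_addr.
(* The products have degree at most r q D, so at most N^s <= q^s (r D + 1)^s monomials in the free
   variables occur; this [q] makes the last factor smaller than [q], whence N^s < q^(s+1) <= q^r. *)
pose q := ((r * D).+1 ^ s).+1.
pose N := (r * (q * D)).+1.
pose mon (f : {ffun {i | i \in ~: A} -> 'I_N}) : 'X_{1..n} :=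
  [multinom (if insub i is Some u then f u : nat else 0%N) | i < n].
have cardlt : (#|{ffun {i | i \in ~: A} -> 'I_N}| < #|words q r|)%N.
  rewrite card_words card_ffun card_ord card_sig.
  have -> : #|[pred x | x \in ~: A]| = s by apply: eq_card.
  have le1 : (N <= q * (r * D).+1)%N by rewrite /N mulnS mulnCA -add1n leq_add2r.
  have le2 : (N ^ s <= (q * (r * D).+1) ^ s)%N.
    by case: (posnP s) => [->|s0]; rewrite ?expn0 // leq_exp2r.
  apply: leq_ltn_trans le2 _.
  rewrite expnMn; apply: leq_trans (_ : q ^ s.+1 <= _)%N; last by rewrite leq_exp2l // /q ltnS expn_gt0.
  by rewrite expnSr ltn_pmul2l ?expn_gt0.
have [c [[w cw] hc]] := linear_dependence
  (fun w f => (@word_prod h' q 0 r w)@_(mon f)) cardlt.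
case/eqP: cw; apply: (@chain_independent P h' q r 0) => [i|i|] //; first by rewrite add0n; apply: pP.
  rewrite add0n => /= ir; have [sub _] := cP i ir; have := hh i ir.
  by rewrite /h' ir => -[].
have iP : is_ideal (P 0%N) by have [] := pP 0%N isT.
set p := \sum_w _.
rewrite (mpolyE p) big_seq; apply: ideal_sum => // m mp.
have mN : (mdeg m < N)%N.
  rewrite ltnS; case/msupp_sum_le/flattenP: (mp) => ? /mapP [w' _ ->].
  by rewrite mul_mpolyC => /msuppZ_le; apply: word_prod_deg.
(* A monomial involving a variable of [A] already lies in P_0; the coefficient of any other one
   vanishes by the choice of [c]. *)
have [/existsP [i /andP[iA mi]]|] := boolP [exists i, (i \in A) && (m i != 0%N)].
  rewrite -mul_mpolyC; apply: idealM => //.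
  have -> : m = ((m - U_(i)) + U_(i))%MM by rewrite submK // lep1mP.
  by rewrite mpolyXD; apply: idealM => //; apply: hX.
rewrite negb_exists => /forallP mA.
have mi i : (m i < N)%N.
  by apply: leq_ltn_trans mN; rewrite mdegE (bigD1 i) //= leq_addr.
pose f := [ffun u : {i | i \in ~: A} => (inord (m (val u)) : 'I_N)].
have mf : mon f = m.
  apply/mnmP => i; rewrite mnmE; case: insubP => [u _ <-|]; first by rewrite ffunE inordK.
  rewrite inE negbK => iA; have := mA i; rewrite iA negbK => /eqP //.
move: mp; rewrite mcoeff_msupp => /eqP[].
rewrite -mf -[RHS](hc f) /p raddf_sum; apply: eq_bigr => w' _.
exact: mcoeffCM.
Qed.

(** The hypotheses say that, up to radical, [J] is generated by the variables in [A]. Every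
    dimension computed below is of this kind. *)
Lemma ring_dim_vars (J : S -> Prop) (A : {set 'I_n}) :
  (forall p, J p -> kill_vars A p = 0) ->
  (forall i, i \in A -> exists k, J ('X_i ^+ k)) ->
  ring_dim J #|~: A|.
Proof.
move=> hJ hA; split; last by move=> r; apply: prime_chain_le.
(* The chain of length [#|~: A|] adds the remaining variables one at a time, in the order of
   [enum]. *)
pose B j := A :|: [set i in take j (enum (~: A))].
exists (fun j p => kill_vars (B j) p = 0); split.
- by move=> i _; apply: kill_vars_prime.
- by move=> p /hJ; apply: kill_vars_subset; apply: subsetUl.
move=> j jr; have je : (j < size (enum (~: A)))%N by rewrite -cardE.
split.
  move=> p; apply: kill_vars_subset; apply: setUS; apply/subsetP => i; rewrite !inE.
  by rewrite [take j.+1 _](take_nth i) // mem_rcons in_cons => ->; rewrite orbT.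
have [i0 _] : exists i : 'I_n, i \in ~: A by apply/card_gt0P/(leq_ltn_trans _ jr).
pose x := nth i0 (enum (~: A)) j.
have xA : x \in ~: A by rewrite -mem_enum mem_nth.
exists 'X_x.
  apply/kill_vars_eq0 => m; rewrite msuppX inE => /eqP ->; exists x; last by rewrite mnm1E eqxx.
  by rewrite !inE (take_nth i0) // mem_rcons inE eqxx orbT.
move=> /kill_vars_eq0 /(_ U_(x)%MM); rewrite msuppX inE eqxx => /(_ isT) [i iB].
rewrite mnm1E; case: (x =P i) => // E; move: iB; rewrite -E !inE in xA *.
rewrite (negbTE xA) /=.
by rewrite in_take ?mem_enum ?inE // index_uniq ?enum_uniq // ltnn.
Qed.

Lemma eq_ring_dim (J J' : S -> Prop) r :
  (forall p, J p <-> J' p) -> ring_dim J r -> ring_dim J' r.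
Proof.
move=> E; have E' r' : prime_chain J r' <-> prime_chain J' r'.
  by split=> -[P [h1 h2 h3]]; exists P; split=> // p /E /h2.
by case=> h1 h2; split; [exact/E' | move=> r' /E'/h2].
Qed.

End KrullDimension.

(** * Hilbert functions *)

Section HilbertFunctions.
Variables (K : fieldType) (n : nat).
Local Notation S := {mpoly K[n]}.
Implicit Types (M : gmod K n) (J : S -> Prop).

Lemma hilbert_fun_le M j k k' : is_submod (@den K n M) ->
  hilbert_fun M j k -> hilbert_fun M j k' -> (k <= k')%N.
Proof.
move=> sD [b [hb ib _]] [b' [_ _ gb']]; rewrite leqNgt; apply/negP => lt.
have [A hA] : exists A : 'I_k -> 'I_k' -> K,
    forall i, den M (b i - \sum_l (A i l)%:MP *: b' l).
  have C i := constructive_indefinite_description _ (gb' _ (hb i).1 (hb i).2).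
  by exists (fun i => sval (C i)) => i; case: (C i).
have [|c [[i ci] hc]] := linear_dependence A; first by rewrite !card_ord.
case/eqP: ci; apply: ib.
have -> : \sum_i (c i)%:MP *: b i =
    \sum_i (c i)%:MP *: (b i - \sum_l (A i l)%:MP *: b' l)
    + \sum_l (\sum_i c i * A i l)%:MP *: b' l.
  under [in RHS]eq_bigr do rewrite scalerBr scaler_sumr.
  rewrite sumrB exchange_big /= -addrA -[LHS]addr0; congr (_ + _).
  rewrite -sumrN -big_split big1 //= => l _.
  rewrite [(\sum_(_ < _) _)%:MP]raddf_sum /= scaler_suml addrC; apply/eqP; rewrite subr_eq0; apply/eqP.
  by apply: eq_bigr => i' _; rewrite scalerA mpolyCM.
apply: submodD => //; last by apply: submod_sum => // l _; rewrite hc mpolyC0 scale0r; case: sD.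
by apply: submod_sum => // l _; apply: submodZ.
Qed.

(** [lex_ideal] speaks of some value of the Hilbert function; uniqueness turns membership in it into
    a numerical condition on the rank. *)
Lemma hilbert_fun_inj M j k k' : is_submod (@den K n M) ->
  hilbert_fun M j k -> hilbert_fun M j k' -> k = k'.
Proof. by move=> sD h h'; apply/eqP; rewrite eqn_leq !(@hilbert_fun_le M j). Qed.

Definition monos (j : nat) : seq 'X_{1..n} :=
  map val [seq m <- enum {: 'X_{1..n < j.+1}} | mdeg (val m) == j].

Lemma mem_monos j m : (m \in monos j) = (mdeg m == j).
Proof.
apply/mapP/idP => [[u] /[!mem_filter] /andP[h _] -> //|h].
have lt : (mdeg m < j.+1)%N by rewrite (eqP h).
by exists (BMultinom lt) => //; rewrite mem_filter h mem_enum.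
Qed.

Lemma monos_uniq j : uniq (monos j).
Proof.
by rewrite map_inj_uniq ?filter_uniq -?enumT ?enum_uniq // => x y; apply: val_inj.
Qed.

Lemma mcoeff_sum_nth (s : seq 'X_{1..n}) (c : 'I_(size s) -> K) (g : 'X_{1..n} -> S)
    (i : 'I_(size s)) : uniq s ->
  (forall l : 'I_(size s), (g (nth 0%MM s l))@_(nth 0%MM s i) = (l == i)%:R) ->
  (\sum_l (c l)%:MP * g (nth 0%MM s l))@_(nth 0%MM s i) = c i.
Proof.
move=> us h; rewrite raddf_sum /= (bigD1 i) //= mcoeffCM h eqxx mulr1.
rewrite big1 ?addr0 // => l li; by rewrite mcoeffCM h (negbTE li) mulr0.
Qed.

Lemma is_ideal_submod J : is_ideal J -> is_submod (fun v : 'rV[S]_1 => J (v 0 0)).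
Proof. by case=> h0 h; split=> [|a u v]; rewrite !mxE //; apply: h. Qed.

Lemma sum_const_mx k (c : 'I_k -> K) (b : 'I_k -> S) :
  (\sum_i (c i)%:MP *: (const_mx (b i) : 'rV[S]_1)) 0 0 = \sum_i (c i)%:MP * b i.
Proof. by rewrite summxE; apply: eq_bigr => i _; rewrite !mxE. Qed.

(* The hypotheses say that the g m form a reduced Groebner basis, up to
   redundancy, whose standard monomials are those in [std]. *)
Section StandardMonomials.
Variables (J : S -> Prop) (std : pred 'X_{1..n}) (g : 'X_{1..n} -> S).
Hypothesis iJ : is_ideal J.
Hypothesis std_free : forall p, J p -> (forall m, ~~ std m -> p@_m = 0) -> p = 0.
Hypothesis gJ : forall m, ~~ std m -> J (g m).
Hypothesis g_homog : forall m, ~~ std m -> homog_poly (mdeg m) (g m).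
Hypothesis g_coeff : forall m m', ~~ std m -> ~~ std m' -> (g m)@_m' = (m == m')%:R.

(** By [g_coeff] the [g m] do not disturb each other's nonstandard coefficients, so a single
    subtraction clears them all at once. *)
Lemma std_reduce j p : homog_poly j%:Z p ->
  exists r, [/\ J (p - r), homog_poly j%:Z r & forall m, ~~ std m -> r@_m = 0].
Proof.
move=> hp; pose t := [seq m <- monos j | ~~ std m].
have ut : uniq t by rewrite filter_uniq ?monos_uniq.
have tP m : m \in t -> ~~ std m /\ mdeg m = j.
  by rewrite mem_filter mem_monos => /andP[? /eqP].
exists (p - \sum_(m <- t) (p@_m)%:MP * g m); split.
- rewrite opprB addrC subrK; rewrite big_seq; apply: ideal_sum => // m /tP[ms _].
  by apply: idealM => //; apply: gJ.
- apply: homog_polyD => //; apply: homog_polyN; rewrite big_seq.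
  apply: (big_ind (homog_poly j%:Z)) => [|u v|m /tP[ms mj]]; first exact: homog_poly0.
    exact: homog_polyD.
  rewrite -[j%:Z]add0r; apply: homog_polyM; first exact: homog_polyC.
  by rewrite -mj; apply: g_homog.
move=> m ms; rewrite mcoeffB raddf_sum /=.
have [mt|mt] := boolP (m \in t).
  rewrite (bigD1_seq m) //= mcoeffCM g_coeff // eqxx mulr1 big1_seq ?addr0 ?subrr //.
  by move=> m' /andP[m'm /tP[m's _]]; rewrite mcoeffCM g_coeff // (negbTE m'm) mulr0.
rewrite big1_seq ?subr0 => [|m' /andP[_ m't]]; last first.
  have [m's _] := tP _ m't; rewrite mcoeffCM g_coeff //.
  by case: (m' =P m) => [E|_]; rewrite ?mulr0 //; rewrite -E m't in mt.
apply/eqP; apply: contraT => /((homog_polyP _ _).1 hp) [mj].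
by rewrite mem_filter ms mem_monos mj eqxx in mt.
Qed.

Lemma hilbert_quot_std j :
  hilbert_fun (quot_mod J) j%:Z (count std (monos j)).
Proof.
rewrite -size_filter; set s := filter _ _.
have us : uniq s by rewrite filter_uniq ?monos_uniq.
have sP m : m \in s -> std m /\ mdeg m = j.
  by rewrite mem_filter mem_monos => /andP[? /eqP].
have nP (i : 'I_(size s)) : nth 0%MM s i \in s by rewrite mem_nth.
have cX c (i : 'I_(size s)) : (\sum_(l < size s) (c l)%:MP * 'X_[nth 0%MM s l])@_(nth 0%MM s i) = c i :> K.
  apply: (@mcoeff_sum_nth s c (fun m => 'X_[m]) i) => // l.
  by rewrite mcoeffX nth_uniq.
exists (fun i => const_mx 'X_[nth 0%MM s i]); split.
- move=> i; split=> // k; rewrite mxE subr0; apply: homog_polyX.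
  by have [_ ->] := sP _ (nP i).
- move=> c /= hc i; rewrite -(cX c i) -sum_const_mx.
  rewrite [X in X@_ _](std_free hc) ?mcoeff0 // => m ms.
  rewrite sum_const_mx raddf_sum /= big1 // => l _; rewrite mcoeffCM mcoeffX.
  case: (_ =P m) => [E|_]; rewrite ?mulr0 //.
  by have [] := sP _ (nP l); rewrite E (negbTE ms).
move=> v _ /= hv; have hv0 : homog_poly j%:Z (v 0 0) by have := hv 0; rewrite subr0.
have [r [Jr hr rs]] := std_reduce hv0.
exists (fun i => r@_(nth 0%MM s i)); rewrite !mxE -[v 0 0](subrK r) -addrA.
apply: idealD => //; set q := r + _; suff -> : q = 0 by case: iJ.
rewrite /q sum_const_mx; apply/mpolyP => m; rewrite mcoeffB mcoeff0.
have [ms|ms] := boolP (m \in s).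
  have lt : (index m s < size s)%N by rewrite index_mem.
  have := cX (fun i => r@_(nth 0%MM s i)) (Ordinal lt).
  by rewrite /= nth_index // => ->; rewrite subrr.
rewrite raddf_sum /= big1 ?subr0 => [|l _]; last first.
  rewrite mcoeffCM mcoeffX; case: (_ =P m) => [E|_]; rewrite ?mulr0 //.
  by rewrite -E nP in ms.
apply/eqP; apply: contraT => nr.
have [mj] := (homog_polyP _ _).1 hr m nr.
have st : std m by apply: contraNT nr => /rs ->.
by rewrite mem_filter st mem_monos mj eqxx in ms.
Qed.

(** The [g m] with [m] nonstandard form a basis: independence is read off at nonstandard
    coefficients, and an element of [J] is recovered from these because [std_free] kills the
    difference. *)
Lemma hilbert_ideal_std j :
  hilbert_fun (ideal_mod J) j%:Z (count (predC std) (monos j)).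
Proof.
rewrite -size_filter; set t := filter _ _.
have ut : uniq t by rewrite filter_uniq ?monos_uniq.
have tP m : m \in t -> ~~ std m /\ mdeg m = j.
  by rewrite mem_filter mem_monos => /andP[? /eqP].
have nP (i : 'I_(size t)) : nth 0%MM t i \in t by rewrite mem_nth.
have cX c (i : 'I_(size t)) : (\sum_(l < size t) (c l)%:MP * g (nth 0%MM t l))@_(nth 0%MM t i) = c i :> K.
  apply: mcoeff_sum_nth => // l; have [h1 _] := tP _ (nP l); have [h2 _] := tP _ (nP i).
  by rewrite g_coeff // nth_uniq.
exists (fun i => const_mx (g (nth 0%MM t i))); split.
- move=> i; have [h1 h2] := tP _ (nP i); split=> /=; first by rewrite mxE; apply: gJ.
  by move=> k; rewrite mxE subr0 -h2; apply: g_homog.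
- move=> c /= hc i; rewrite -(cX c i) -sum_const_mx hc mxE mcoeff0 //.
move=> v /= Jv hv; have hv0 : homog_poly j%:Z (v 0 0) by have := hv 0; rewrite subr0.
exists (fun i => (v 0 0)@_(nth 0%MM t i)); apply/rowP => k; rewrite ord1 !mxE.
rewrite sum_const_mx; apply: std_free => [|m ms].
  apply: idealB => //; apply: ideal_sum => // l _; apply: idealM => //; apply: gJ.
  by have [] := tP _ (nP l).
rewrite mcoeffB; have [mt|mt] := boolP (m \in t).
  have lt : (index m t < size t)%N by rewrite index_mem.
  have := cX (fun i => (v 0 0)@_(nth 0%MM t i)) (Ordinal lt).
  by rewrite /= nth_index // => ->; rewrite subrr.
rewrite raddf_sum /= big1 ?subr0 => [|l _]; last first.
  have [h1 _] := tP _ (nP l); rewrite mcoeffCM g_coeff //.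
  by case: (_ =P m) => [E|_]; rewrite ?mulr0 //; rewrite -E nP in mt.
apply/eqP; apply: contraT => nr.
have [mj] := (homog_polyP _ _).1 hv0 m nr.
by rewrite mem_filter /= ms mem_monos mj eqxx in mt.
Qed.

End StandardMonomials.
End HilbertFunctions.

(** * Monomial ideals, length and cyclic modules *)

Section MonomialIdeals.
Variables (K : fieldType) (n : nat).
Local Notation S := {mpoly K[n]}.
Implicit Types (J : S -> Prop) (p q : S) (Q : pred 'X_{1..n}).

Definition upclosed Q := forall m k, Q m -> Q (m + k)%MM.

Definition monid Q p : Prop := forall m, m \in msupp p -> Q m.

Lemma monidP Q p : monid Q p <-> forall m, p@_m != 0 -> Q m.
Proof. by split=> h m; move: (h m); rewrite mcoeff_msupp. Qed.

Lemma monid_ideal Q : upclosed Q -> is_ideal (monid Q).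
Proof.
move=> uQ; split; first by move=> m; rewrite msupp0.
move=> a p q hp hq m /msuppD_le; rewrite mem_cat => /orP[|/hq //].
by case/msuppM_le/allpairsP => -[m1 m2] /= [_ /hp h ->]; rewrite addmC; apply: uQ.
Qed.

Lemma monidX Q m : monid Q 'X_[m] <-> Q m.
Proof.
split=> [h|h m']; first by apply: h; rewrite msuppX inE.
by rewrite msuppX inE => /eqP ->.
Qed.

Lemma monid_hcomp Q e p : monid Q p -> monid Q (hcomp e p).
Proof.
move=> /monidP h; apply/monidP => m; rewrite mcoeff_hcomp.
by case: ifP => _; [apply: h | rewrite eqxx].
Qed.

Lemma hilbert_monid Q j : upclosed Q ->
  hilbert_fun (quot_mod (monid Q)) j%:Z (count (predC Q) (monos n j)).
Proof.
move=> uQ; apply: (@hilbert_quot_std K n (monid Q) (predC Q) (fun m => 'X_[m])).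
- exact: monid_ideal.
- move=> p /monidP hp h; apply/mpolyP => m; rewrite mcoeff0.
  have [//|/hp Qm] := eqVneq p@_m 0.
  by apply: h; rewrite /= negbK.
- by move=> k /negbNE Qk; apply/monidX.
- by move=> k _; apply: homog_polyX.
- by move=> k k' _ _; rewrite mcoeffX.
Qed.

Definition adjoin Q (s : seq 'X_{1..n}) : pred 'X_{1..n} := fun m => Q m || (m \in s).

(** If a multiple [v + k] of some [v] in [s] were [m], minimality of the degree of [m] would force
    [k = 0], so [m] would be in [s]. This is why monomials are always listed by increasing
    degree. *)
Lemma upclosed_behead Q m s :
  upclosed (adjoin Q (m :: s)) -> upclosed Q -> ~~ Q m ->
  m \notin s -> (forall u, u \in s -> mdeg m <= mdeg u)%N ->
  upclosed (adjoin Q s).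
Proof.
move=> uQs uQ Qm ms le v k; case/orP => [Qv|vs]; first by rewrite /adjoin uQ.
have := uQs v k; rewrite /adjoin !inE vs !orbT => /(_ isT) /or3P[->//|/eqP E|->]; last first.
  by rewrite orbT.
have := le _ vs; rewrite -E mdegD -[X in (_ <= X)%N]addn0 leq_add2l leqn0 mdeg_eq0 => /eqP k0.
by move: E ms; rewrite k0 addm0 => <-; rewrite vs.
Qed.

End MonomialIdeals.

Section Length.
Variables (K : fieldType) (n : nat).
Local Notation S := {mpoly K[n]}.

Section Span.
Variables (r : nat) (D : 'rV[S]_r -> Prop).
Implicit Types (u v : 'rV[S]_r) (s : seq 'rV[S]_r).

Fixpoint spanD s v : Prop :=
  if s is u :: s' then exists c : S, spanD s' (v - c *: u) else D v.

(* The filtration of spanD s by the tails of s has all its factors isomorphic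
   to K, the last element of s generating the bottom one. *)
Fixpoint socle_chain s : Prop :=
  if s is u :: s' then
    [/\ socle_chain s', ~ spanD s' u & forall i, spanD s' ('X_i *: u)]
  else True.

Hypothesis sD : is_submod D.

Lemma spanD_submod s : is_submod (spanD s).
Proof.
elim: s => [//|u s IH]; split=> /=.
  by exists 0; rewrite scale0r subr0; case: IH.
move=> a v w [c hc] [d hd]; exists (a * c + d).
have -> : a *: v + w - (a * c + d) *: u = a *: (v - c *: u) + (w - d *: u).
  by rewrite scalerBr scalerDl scalerA opprD addrACA.
by case: IH => _; apply.
Qed.

Lemma spanDS u s v : spanD s v -> spanD (u :: s) v.
Proof. by move=> h; exists 0; rewrite scale0r subr0. Qed.

Lemma spanD_head u s : spanD (u :: s) u.
Proof. by exists 1; rewrite scale1r subrr; case: (spanD_submod s). Qed.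

Lemma spanD_den s v : D v -> spanD s v.
Proof. by move=> Dv; elim: s => // u s; apply: spanDS. Qed.

Lemma spanD_sub (N : 'rV[S]_r -> Prop) s v : is_submod N ->
  (forall w, D w -> N w) -> (forall w, w \in s -> N w) -> spanD s v -> N v.
Proof.
move=> sN DN; elim: s v => [|u s IH] v hs /=; first exact: DN.
case=> c hc; rewrite -(subrK (c *: u) v); apply: submodD => //.
  by apply: IH => // w ws; apply: hs; rewrite in_cons ws orbT.
by apply: submodZ => //; apply: hs; rewrite mem_head.
Qed.

(** When the variables send [u] into [W], S acts on the class of [u] through S/(X) = K. *)
Lemma scale_const_term (W : 'rV[S]_r -> Prop) u p : is_submod W ->
  (forall i, W ('X_i *: u)) -> W (p *: u - (p@_0)%:MP *: u).
Proof.
move=> sW hu; rewrite -scalerBl; set q := p - _.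
have q0 : q@_0 = 0 by rewrite mcoeffB mcoeffC eqxx mulr1 subrr.
rewrite (mpolyE q) scaler_suml big_seq; apply: submod_sum => // m mq.
rewrite -mul_mpolyC -scalerA; apply: submodZ => //.
have nm : m != 0%MM by apply: contraTneq mq => ->; rewrite mcoeff_msupp q0 eqxx.
have [i mi] : exists i, m i != 0%N.
  apply/existsP; apply: contraNT nm; rewrite negb_exists => /forallP h.
  by apply/eqP/mnmP => i; rewrite mnm0E; apply/eqP; have := h i; rewrite negbK.
have -> : m = ((m - U_(i)) + U_(i))%MM by rewrite submK // lep1mP.
by rewrite mpolyXD -scalerA; apply: submodZ.
Qed.

Lemma socle_chain_drop s k : socle_chain s -> socle_chain (drop k s).
Proof. by elim: s k => [|u s IH] [|k] //= [h _ _]; apply: IH. Qed.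

Lemma socle_chain_var_expr s i : socle_chain s ->
  forall v, spanD s v -> D ('X_i ^+ size s *: v).
Proof.
elim: s => [_ v /= Dv|u s IH [gs _ hu] v [c hc]] /=; first by rewrite expr0 scale1r.
rewrite exprSr -scalerA; apply: IH => //.
have -> : 'X_i *: v = 'X_i *: (v - c *: u) + c *: ('X_i *: u).
  by rewrite scalerBr !scalerA mulrC subrK.
by apply: submodD; [exact: spanD_submod | |]; apply: submodZ => //; exact: spanD_submod.
Qed.

End Span.

Variable M : gmod K n.
Variable s : seq 'rV[S]_(rk M).
Hypothesis sD : is_submod (@den K n M).
Hypothesis Ms : forall v, num M v <-> spanD (@den K n M) s v.
Hypothesis gs : socle_chain (@den K n M) s.

(** The steps of the filtration by the tails of [s] are simple: each is spanned by the class of one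
    [u] on which S acts through K. *)
Lemma mod_length_socle_chain : mod_length M (size s).
Proof.
exists (fun i => spanD (@den K n M) (drop (size s - i) s)); split.
- by move=> i _; apply: spanD_submod.
- by move=> v; rewrite subn0 drop_size.
- by move=> v; rewrite subnn drop0; split=> /Ms.
move=> i il; have lt : (size s - i.+1 < size s)%N by lia.
have E : drop (size s - i.+1) s = nth 0 s (size s - i.+1) :: drop (size s - i) s.
  by rewrite (drop_nth 0) // -subSn ?subSS.
have := socle_chain_drop (size s - i.+1) gs; rewrite E.
set u := nth _ _ _; set s' := drop _ _ => -[gs' nu hu].
have sS := spanD_submod sD s'.
split=> [v||W sW sub sup]; first exact: spanDS.
  by exists u => //; apply: spanD_head.
have [h|h] := classic (forall v, W v -> spanD (@den K n M) s' v).
  by left=> v; split; [apply: h | apply: sub].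
right=> v; split; first exact: sup.
have [w Ww nw] : exists2 w, W w & ~ spanD (@den K n M) s' w.
  apply: NNPP => hn; apply: h => w Ww; apply: NNPP => nw; apply: hn; by exists w.
have [c hc] := sup w Ww.
have cu : spanD (@den K n M) s' (w - (c@_0)%:MP *: u).
  have := submodD sS hc (scale_const_term c sS hu); by rewrite addrA subrK.
(* Modulo the lower step [w] is the scalar [c@_0] times [u]; as [w] is not in the lower step, the
   scalar is invertible and [u] lies in [W]. *)
have c0 : c@_0 != 0.
  by apply: contra_notN nw => /eqP c0; move: cu; rewrite c0 mpolyC0 scale0r subr0.
have Wu : W u.
  have : W ((c@_0)%:MP *: u).
    have := submodB sW Ww (sub _ cu); by rewrite opprB addrC subrK.
  move/(submodZ (c@_0)^-1%:MP sW); by rewrite scalerA -mpolyCM mulVf // mpolyC1 scale1r.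
by case=> d /sub hd; apply: submod_subr hd _ => //; apply: submodZ.
Qed.

(** Up to radical the annihilator is the maximal ideal: powers of the variables kill the module, and
    an annihilator with nonzero constant term would put the head of [s] into the span of the
    tail. *)
Lemma mod_dim_socle_chain : (0 < size s)%N -> mod_dim M 0.
Proof.
move=> s0; rewrite /mod_dim.
have -> : 0%N = #|~: [set: 'I_n]| by rewrite setCT cards0.
apply: ring_dim_vars => [p hp|i _]; last first.
  by exists (size s) => v /Ms; apply: socle_chain_var_expr.
apply/kill_vars_eq0 => m; rewrite mcoeff_msupp => pm.
have nm : m != 0%MM.
  apply: contraNneq pm => ->.
  case: s Ms gs s0 => // u s' Ms' [_ nu hu] _.
  have sS := spanD_submod sD s'.
  apply/eqP; apply: NNPP => /eqP c0; apply: nu.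
  have hpu : spanD (@den K n M) s' (p *: u).
    by apply: spanD_den; apply: hp; apply/Ms'; apply: spanD_head.
  have := submodB sS hpu (scale_const_term p sS hu); rewrite opprB addrC subrK.
  move/(submodZ (p@_0)^-1%:MP sS).
  by rewrite scalerA -mpolyCM mulVf // mpolyC1 scale1r.
have /existsP [i mi] : [exists i, m i != 0%N].
  apply: contraNT nm; rewrite negb_exists => /forallP h.
  by apply/eqP/mnmP => i; rewrite mnm0E; apply/eqP; have := h i; rewrite negbK.
by exists i.
Qed.

(** In dimension 0 the sum over Ext modules is empty, so hdeg is the length; the families of Ext
    modules and values passed to [HdegRec] are indexed by an empty type. *)
Lemma hdeg_socle_chain : is_gmod M -> (0 < size s)%N -> is_hdeg M (size s).
Proof.
move=> gM s0; have /(HdegRec gM) := mod_dim_socle_chain s0.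
move=> /(_ (size s) (fun=> M) (fun=> 0%N)); rewrite big_ord0 addn0; apply.
- by apply: DegLength; [exact: mod_dim_socle_chain | exact: mod_length_socle_chain].
- by case.
- by case.
Qed.

End Length.

Section CyclicModules.
Variables (K : fieldType) (n : nat).
Local Notation S := {mpoly K[n]}.
Implicit Types (M E : gmod K n) (J : S -> Prop).

(* E is isomorphic to (S / J)(- e), with generator u. *)
Definition cyclic_gmod E J (e : int) (u : 'rV[S]_(rk E)) : Prop :=
  [/\ num E u, homog_vec (shift E) e u,
      forall v, num E v -> exists p, den E (v - p *: u)
    & forall p, den E (p *: u) <-> J p].

Variables (E : gmod K n) (J : S -> Prop) (e : int) (u : 'rV[S]_(rk E)).
Hypotheses (sN : is_submod (@num K n E)) (sD : is_submod (@den K n E)).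
Hypothesis hD : forall e w, den E w -> den E (vcomp (shift E) e w).
Hypothesis iJ : is_ideal J.
Hypothesis cE : cyclic_gmod J e u.

Lemma ann_cyclic p : ann E p <-> J p.
Proof.
case: cE => nu _ gu ku; split=> [h|Jp v nv]; first by apply/ku/h.
have [q hq] := gu v nv; apply: (@submod_subr _ _ _ _ _ (p *: (q *: u))) => //.
  by rewrite -scalerBr; apply: submodZ.
by rewrite scalerA; apply/ku; rewrite mulrC; apply: idealM.
Qed.

Lemma mod_dim_cyclic r : ring_dim J r -> mod_dim E r.
Proof. by apply: eq_ring_dim => p; split=> /ann_cyclic. Qed.

Lemma hilbert_cyclic i k :
  hilbert_fun (quot_mod J) i k -> hilbert_fun E (i + e) k.
Proof.
case: cE => nu hu gu ku [b [hb ib gb]].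
have sumE (c : 'I_k -> K) :
    \sum_i (c i)%:MP *: ((b i) 0 0 *: u) = (\sum_i (c i)%:MP *: b i) 0 0 *: u.
  rewrite summxE scaler_suml; apply: eq_bigr => l _.
  by rewrite mxE scalerA.
exists (fun l => (b l) 0 0 *: u); split=> [l|c|v nv hv].
- split; first exact: submodZ.
  have <- : vcomp (shift E) (i + e) ((b l) 0 0 *: u) = (b l) 0 0 *: u.
    by rewrite vcompZ // hcomp_id //; have [_ /(_ 0)] := hb l; rewrite subr0.
  exact: vcomp_homog.
- rewrite sumE => /ku; exact: ib.
have [p hp] := gu v nv.
(* As [u] is homogeneous of degree [e], only the component of [p] of degree [i] contributes to
   [v]. *)
have [|c hc] := gb (const_mx (hcomp i p)) I; first by move=> l; rewrite mxE subr0; apply: hcomp_homog.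
exists c; rewrite sumE.
apply: (@submod_subr _ _ _ _ _ (hcomp i p *: u - (\sum_i (c i)%:MP *: b i) 0 0 *: u)) => //.
  rewrite opprB addrA subrK.
  by have := hD (i + e) hp; rewrite vcompB vcomp_id // vcompZ.
rewrite -scalerBl; apply/ku; move: hc; by rewrite /= !mxE.
Qed.

End CyclicModules.

Section CyclicMonomial.
Variables (K : fieldType) (n : nat) (E : gmod K n) (Q : pred 'X_{1..n}).
Variables (e : int) (u : 'rV[{mpoly K[n]}]_(rk E)).
Hypotheses (sN : is_submod (@num K n E)) (sD : is_submod (@den K n E)).
Hypothesis uQ : upclosed Q.
Hypothesis cE : cyclic_gmod (monid Q) e u.

Let uX (m : 'X_{1..n}) : 'rV[{mpoly K[n]}]_(rk E) := 'X_[m] *: u.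

(** Monomials correspond to multiples of [u], and the spans of the tails of [s] to the monomial
    ideals [adjoin Q s]. For the head [m], each X_i m lies in the larger ideal and differs from [m],
    hence lies in the smaller one. *)
Lemma cyclic_monomial_chain (s : seq 'X_{1..n}) :
  uniq s -> sorted (fun m m' => mdeg m <= mdeg m')%N s ->
  (forall m, m \in s -> ~~ Q m) -> upclosed (adjoin Q s) ->
  (forall p, spanD (@den K n E) (map uX s) (p *: u) <-> monid (adjoin Q s) p)
  /\ socle_chain (@den K n E) (map uX s).
Proof.
case: cE => nu hu gu ku.
elim: s => [|m s IH] /=.
  move=> _ _ _ _; split=> // p; rewrite ku.
  by split=> h m /h; rewrite /adjoin /= ?orbF.
case/andP=> ms us; rewrite (path_sortedE (leT := fun m m' => mdeg m <= mdeg m')%N); last first.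
  by move=> x y z; apply: leq_trans.
case/andP=> /allP lem ss hQ uQs.
have Qm : ~~ Q m by apply: hQ; rewrite mem_head.
have uQs' : upclosed (adjoin Q s) by apply: upclosed_behead uQs uQ Qm ms lem.
have [|IH1 IH2] := IH us ss _ uQs'.
  by move=> k ks; apply: hQ; rewrite in_cons ks orbT.
have iQs := @monid_ideal K n _ uQs.
split.
  move=> p; split=> [[c hc]|hp].
    move: hc; rewrite scalerA -scalerBl => /IH1 hc.
    rewrite -(subrK (c * 'X_[m]) p); apply: (idealD iQs).
      by move=> k /hc; rewrite /adjoin !inE => /orP[->//|->]; rewrite !orbT.
    by apply: (idealM _ iQs); apply/monidX; rewrite /adjoin mem_head orbT.
  exists (p@_m)%:MP; rewrite scalerA -scalerBl; apply/IH1/monidP => k.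
  rewrite mcoeffB mcoeffCM mcoeffX; case: (m =P k) => [<-|nk].
    by rewrite mulr1 subrr eqxx.
  rewrite mulr0 subr0 => /((monidP _ _).1 hp); rewrite /adjoin !inE.
  by case: (k =P m) => [E0|//]; case: nk.
split=> // [/IH1/monidX|i].
  by rewrite /adjoin (negbTE Qm) (negbTE ms).
rewrite /uX scalerA -mpolyXD; apply/IH1/monidX.
have := uQs m U_(i)%MM; rewrite /adjoin mem_head orbT addmC => /(_ isT).
rewrite in_cons; case: ((U_(i) + m)%MM =P m) => [E0|//].
by have := congr1 (@mdeg n) E0; rewrite mdegD mdeg1; lia.
Qed.

Lemma hdeg_cyclic_monomial (s : seq 'X_{1..n}) :
  is_gmod E -> uniq s -> (forall m, m \in s = ~~ Q m) -> (0 < size s)%N ->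
  is_hdeg E (size s).
Proof.
move=> gE us hs s0; pose t := sort (fun m m' => mdeg m <= mdeg m')%N s.
have ut : uniq t by rewrite sort_uniq.
have ht m : m \in t = ~~ Q m by rewrite mem_sort hs.
have st : sorted (fun m m' => mdeg m <= mdeg m')%N t.
  by apply: sort_sorted => x y; apply: leq_total.
have aT m : adjoin Q t m by rewrite /adjoin ht orbN.
have [||h1 h2] := cyclic_monomial_chain ut st; first by move=> m; rewrite ht.
  by move=> m k _; apply: aT.
have := @hdeg_socle_chain K n E (map uX t) sD _ h2 gE.
rewrite size_map size_sort; apply=> // v.
case: (cE) => nu hu gu ku; split=> [/gu [p hp]|].
  apply: (@submod_subr _ _ _ _ _ (p *: u)); first exact: spanD_submod.
    exact: spanD_den.
  by apply/h1 => m _; apply: aT.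
apply: spanD_sub => //; first by have [] := gE.
by move=> w /mapP [m _ ->]; apply: submodZ.
Qed.

End CyclicMonomial.

(** * Free resolutions of extensions *)

Section ExtModules.
Variables (K : fieldType) (n : nat).
Local Notation S := {mpoly K[n]}.

(** The part of a free resolution that makes [ext_mod] a graded module; it passes to splices without
    reference to augmentations. *)
Definition is_complex_data m (F : resolution_data K n m) :=
  (forall i, homog_mx (res_shift F i.+1) (res_shift F i) (res_diff F i)) /\
  (forall i, res_diff F i.+1 *m res_diff F i = 0).

Lemma mulmx_all_rows0 a b (A : 'M[S]_(a, b)) : (forall w : 'rV_a, w *m A = 0) -> A = 0.
Proof. by move=> h; apply/row_matrixP => i; rewrite rowE h row0. Qed.

Lemma free_resolution_complex (M : gmod K n) F :
  is_free_resolution (M := M) F -> is_complex_data F.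
Proof.
case=> -[_ hF] [_ _ _ ex]; split=> // i; apply: mulmx_all_rows0 => w.
by rewrite mulmxA; apply/ex; exists w.
Qed.

Variables (m : nat) (F : resolution_data K n m).
Local Notation Z i := (@num K n (ext_mod F i)).
Local Notation B i := (@den K n (ext_mod F i)).

Lemma ext_num_submod i : is_submod (Z i). Proof. exact: submod_ker. Qed.

Lemma ext_den_submod i : is_submod (B i).
Proof. case: i => [|i]; [exact: submod0 | exact: submod_mul]. Qed.

Lemma ext_den_trmx i w : B i.+1 (w *m (res_diff F i)^T).
Proof. by exists w. Qed.

Hypothesis cF : is_complex_data F.

Lemma ext_diff_homog i :
  homog_mx (shift (ext_mod F i)) (shift (ext_mod F i.+1)) (res_diff F i)^T.
Proof.
move=> a b; rewrite mxE /=.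
have -> : n%:Z - res_shift F i a - (n%:Z - res_shift F i.+1 b)
  = res_shift F i.+1 b - res_shift F i a by lia.
exact: cF.1.
Qed.

Lemma ext_num_vcomp i e w : Z i w -> Z i (vcomp (shift (ext_mod F i)) e w).
Proof.
move=> /= hw; rewrite -(vcomp_mul _ _ (@ext_diff_homog i)) [_ *m _]hw.
exact: vcomp0.
Qed.

Lemma ext_den_vcomp i e w : B i w -> B i (vcomp (shift (ext_mod F i)) e w).
Proof.
case: i w => [|i] w /=; first by move=> ->; exact: vcomp0.
case=> w' ->; exists (vcomp (shift (ext_mod F i)) e w').
exact: (vcomp_mul _ _ (@ext_diff_homog i)).
Qed.

Lemma trmx_diff0 i : (res_diff F i)^T *m (res_diff F i.+1)^T = 0.
Proof. by rewrite -trmx_mul cF.2 trmx0. Qed.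

Lemma ext_den_num i w : B i w -> Z i w.
Proof.
case: i w => [|i] w /=; first by move=> ->; rewrite mul0mx.
by case=> w' ->; rewrite -mulmxA trmx_diff0 mulmx0.
Qed.

Lemma is_gmod_ext i : is_gmod (ext_mod F i).
Proof.
apply: is_gmod_intro.
- exact: ext_num_submod.
- exact: ext_den_submod.
- exact: ext_num_vcomp.
- exact: ext_den_vcomp.
- exact: ext_den_num.
Qed.

End ExtModules.

(** * The horseshoe lemma for graded free resolutions *)

Section Horseshoe.
Variables (K : fieldType) (n m : nat).
Local Notation S := {mpoly K[n]}.
Implicit Types F G : resolution_data K n m.

Definition sum_shift a b (s : 'I_a -> int) (t : 'I_b -> int) (k : 'I_(a + b)) : int :=
  match split k with inl i => s i | inr j => t j end.

Lemma sum_shiftl a b (s : 'I_a -> int) (t : 'I_b -> int) i :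
  sum_shift s t (lshift b i) = s i.
Proof. by rewrite /sum_shift (unsplitK (inl i)). Qed.

Lemma sum_shiftr a b (s : 'I_a -> int) (t : 'I_b -> int) j :
  sum_shift s t (rshift a j) = t j.
Proof. by rewrite /sum_shift (unsplitK (inr j)). Qed.

(** [F] will resolve a quotient N/D and [G] the submodule D/D' of N/D'. As row vectors are
    multiplied from the left, the zero block makes [G] a subcomplex with quotient [F]. *)
Definition splice F G (theta : forall i, 'M[S]_(res_rk F i.+1, res_rk G i)) :=
  @ResolutionData K n m (fun i => res_rk F i + res_rk G i)%N
    (fun i => sum_shift (res_shift F i) (res_shift G i))
    (fun i => block_mx (res_diff F i) (theta i) 0 (res_diff G i))
    (col_mx (res_aug F) (res_aug G)).

Definition is_splice F G (theta : forall i, 'M[S]_(res_rk F i.+1, res_rk G i)) :=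
  forall i, res_diff F i.+1 *m theta i + theta i.+1 *m res_diff G i = 0.

(** Lift row by row, then replace each lift by its component of degree [s i]; the product with the
    homogeneous [B] is unchanged. *)
Lemma homog_lift a b c (s : 'I_a -> int) (t : 'I_b -> int) (u : 'I_c -> int)
    (A : 'M[S]_(a, c)) (B : 'M[S]_(b, c)) :
  homog_mx s u A -> homog_mx t u B -> (forall i, exists w, row i A = w *m B) ->
  exists2 X, homog_mx s t X & A = X *m B.
Proof.
move=> hA hB h; pose w i := sval (constructive_indefinite_description _ (h i)).
have hw i : row i A = w i *m B by rewrite /w; case: constructive_indefinite_description.
exists (\matrix_i vcomp t (s i) (w i)).
  by move=> i j; rewrite mxE; apply: vcomp_homog.
apply/row_matrixP => i; rewrite row_mul rowK -(vcomp_mul _ _ hB) -hw vcomp_id //.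
by move=> k; rewrite mxE; apply: hA.
Qed.

Lemma homog_mxM a b c (s : 'I_a -> int) (t : 'I_b -> int) (u : 'I_c -> int)
    (A : 'M[S]_(a, b)) (B : 'M[S]_(b, c)) :
  homog_mx s t A -> homog_mx t u B -> homog_mx s u (A *m B).
Proof.
move=> hA hB i j; rewrite mxE; apply: (big_ind (homog_poly (s i - u j))).
- exact: homog_poly0.
- by move=> p q; apply: homog_polyD.
- move=> k _; have -> : s i - u j = (s i - t k) + (t k - u j) by lia.
  exact: homog_polyM.
Qed.

Lemma homog_mxN a b (s : 'I_a -> int) (t : 'I_b -> int) (A : 'M[S]_(a, b)) :
  homog_mx s t A -> homog_mx s t (- A).
Proof. by move=> hA i j; rewrite mxE; apply: homog_polyN. Qed.

Lemma homog_block_mx a b c d (s : 'I_a -> int) (t : 'I_b -> int) (u : 'I_c -> int)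
    (v : 'I_d -> int) (A : 'M[S]_(a, c)) (B : 'M[S]_(a, d)) (C : 'M[S]_(b, c)) (D : 'M[S]_(b, d)) :
  homog_mx s u A -> homog_mx s v B -> homog_mx t u C -> homog_mx t v D ->
  homog_mx (sum_shift s t) (sum_shift u v) (block_mx A B C D).
Proof.
move=> hA hB hC hD i j; case: (split_ordP i) => k ->; case: (split_ordP j) => l ->.
- by rewrite block_mxEul sum_shiftl sum_shiftl; apply: hA.
- by rewrite block_mxEur sum_shiftl sum_shiftr; apply: hB.
- by rewrite block_mxEdl sum_shiftr sum_shiftl; apply: hC.
- by rewrite block_mxEdr sum_shiftr sum_shiftr; apply: hD.
Qed.

Lemma homog_col_mx a b c (s : 'I_a -> int) (t : 'I_b -> int) (u : 'I_c -> int)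
    (A : 'M[S]_(a, c)) (B : 'M[S]_(b, c)) :
  homog_mx s u A -> homog_mx t u B -> homog_mx (sum_shift s t) u (col_mx A B).
Proof.
move=> hA hB i j; case: (split_ordP i) => k ->.
- by rewrite col_mxEu sum_shiftl; apply: hA.
- by rewrite col_mxEd sum_shiftr; apply: hB.
Qed.

Lemma homog_mx0 a b (s : 'I_a -> int) (t : 'I_b -> int) : homog_mx s t (0 : 'M[S]_(a, b)).
Proof. by move=> i j; rewrite mxE; apply: homog_poly0. Qed.

Lemma homog_scalar_mx a (s t : 'I_a -> int) (f : S) :
  (forall i, homog_poly (s i - t i) f) -> homog_mx s t (f%:M).
Proof.
move=> hf i j; rewrite mxE; case: (i =P j) => [<-|_]; first exact: hf.
exact: homog_poly0.
Qed.

Section HorseshoeLemma.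
Variables (sh : 'I_m -> int) (N D D' : 'rV[S]_m -> Prop) (F G : resolution_data K n m).
Hypotheses (sN : is_submod N) (sD : is_submod D) (sD' : is_submod D').
Hypotheses (DN : forall v, D v -> N v) (D'D : forall v, D' v -> D v).
Hypothesis hD' : forall e w, D' w -> D' (vcomp sh e w).
Hypothesis rF : is_free_resolution (M := Gmod sh N D) F.
Hypothesis rG : is_free_resolution (M := Gmod sh D D') G.

Lemma horseshoe_theta0 : exists2 theta : 'M[S]_(res_rk F 1, res_rk G 0),
  homog_mx (res_shift F 1%N) (res_shift G 0%N) theta &
  forall w, D' (w *m (res_diff F 0 *m res_aug F + theta *m res_aug G)).
Proof.
have [[/= haF hdF] [/= _ _ kF _]] := rF.
have [[/= haG hdG] [/= _ gG _ _]] := rG.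
pose A := res_diff F 0 *m res_aug F.
have hA : homog_mx (res_shift F 1%N) sh A by apply: homog_mxM haF.
have AD i : D (row i A).
  by rewrite rowE mulmxA; apply/kF; exists (delta_mx 0 i).
pose v i := sval (constructive_indefinite_description _ (gG _ (AD i))).
have hv i : D' (row i A - v i *m res_aug G).
  by rewrite /v; case: constructive_indefinite_description.
exists (- \matrix_i vcomp (res_shift G 0%N) (res_shift F 1%N i) (v i)).
  by apply: homog_mxN => i j; rewrite mxE; apply: vcomp_homog.
move=> w; rewrite mulNmx -/A; set X := \matrix_i _.
have -> : w *m (A - X *m res_aug G) = \sum_i w 0 i *: row i (A - X *m res_aug G).
  by rewrite mulmx_sum_row.
apply: submod_sum => // i _; apply: submodZ => //.
rewrite raddfB /= [row i (_ *m res_aug G)]row_mul rowK -(vcomp_mul _ _ haG).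
have := hD' (res_shift F 1%N i) (hv i); rewrite vcompB [vcomp sh _ (row i A)]vcomp_id //.
by move=> k; rewrite mxE; apply: hA.
Qed.

Lemma horseshoe_theta : exists theta : forall i, 'M[S]_(res_rk F i.+1, res_rk G i),
  [/\ forall i, homog_mx (res_shift F i.+1) (res_shift G i) (theta i),
      forall w, D' (w *m (res_diff F 0 *m res_aug F + theta 0%N *m res_aug G))
    & is_splice theta].
Proof.
have [_ cF] := free_resolution_complex rF.
have [[/= haF hdF] [/= nF _ kF _]] := rF.
have [[/= haG hdG] [/= nG gG kG eG]] := rG.
have [t0 ht0 Dt0] := horseshoe_theta0.
(* The invariant of the recursion: besides being homogeneous, [t] must leave an error in the image
   of the differential of [G], so that the next correction exists. *)
pose ok i (t : 'M[S]_(res_rk F i.+1, res_rk G i)) :=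
  homog_mx (res_shift F i.+1) (res_shift G i) t /\
  forall j, exists w, row j (res_diff F i.+1 *m t) = w *m res_diff G i.
have ok0 : ok 0%N t0.
  split=> // j; apply/kG.
  have := Dt0 (row j (res_diff F 1)).
  by rewrite mulmxDr !mulmxA -!row_mul cF mul0mx row0 add0r.
have step i (t : {t | ok i t}) : {t' | ok i.+1 t' /\
    res_diff F i.+1 *m sval t + t' *m res_diff G i = 0}.
  apply: constructive_indefinite_description; case: t => t [ht it] /=.
  have [X hX EX] := homog_lift (homog_mxM (hdF i.+1) ht) (hdG i) it.
  exists (- X); rewrite mulNmx -EX subrr; split=> //; split; first exact: homog_mxN.
  move=> j; apply/eG; rewrite -row_mul mulmxN mulNmx -mulmxA -EX mulmxA cF.
  by rewrite mul0mx oppr0 row0.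
pose th := fix th i : {t | ok i t} :=
  match i with
  | 0 => exist _ t0 ok0
  | i'.+1 => exist _ (sval (step i' (th i'))) (proj1 (svalP (step i' (th i'))))
  end.
exists (fun i => sval (th i)); split=> [i|//|i]; first by have [] := svalP (th i).
by have [_] := svalP (step i (th i)).
Qed.

Lemma splice_resolution (theta : forall i, 'M[S]_(res_rk F i.+1, res_rk G i)) :
  (forall i, homog_mx (res_shift F i.+1) (res_shift G i) (theta i)) ->
  (forall w, D' (w *m (res_diff F 0 *m res_aug F + theta 0%N *m res_aug G))) ->
  is_splice theta -> is_free_resolution (M := Gmod sh N D') (splice theta).
Proof.
move=> hth Dth sth.
have [[/= haF hdF] [/= nF gF kF eF]] := rF.
have [[/= haG hdG] [/= nG gG kG eG]] := rG.
split; first split=> [|i] /=.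
- exact: homog_col_mx.
- by apply: homog_block_mx => //; apply: homog_mx0.
have E0 (w1 : 'rV_(res_rk F 1)) : w1 *m res_diff F 0 *m res_aug F + w1 *m theta 0%N *m res_aug G
     = w1 *m (res_diff F 0 *m res_aug F + theta 0%N *m res_aug G).
  by rewrite mulmxDr !mulmxA.
split=> /=.
- move=> v; rewrite -[v]hsubmxK mul_row_col; apply: submodD => //; exact/DN.
- move=> u /gF [v1 /gG [v2 h]]; exists (row_mx v1 v2).
  by rewrite mul_row_col opprD addrA.
- move=> v; rewrite -[v]hsubmxK mul_row_col.
  set v1 := lsubmx _; set v2 := rsubmx _; split=> [h|[w]].
    have /kF [w1 E1] : D (v1 *m res_aug F).
      by rewrite -(addrK (v2 *m res_aug G) (v1 *m _)); apply: submodB => //; apply: D'D.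
    have /kG [w2 E2] : D' ((v2 - w1 *m theta 0%N) *m res_aug G).
      have := submodB sD' h (Dth w1); rewrite -E0 -E1 mulmxBl.
      by rewrite opprD addrACA subrr add0r.
    exists (row_mx w1 w2); rewrite mul_row_block mulmx0 addr0 -E1 -E2 addrC subrK //.
  rewrite -[w]hsubmxK mul_row_block mulmx0 addr0 => /eq_row_mx [-> ->].
  rewrite mulmxDl addrA E0; apply: submodD => //.
  by apply/kG; exists (rsubmx w).
move=> i v; rewrite -[v]hsubmxK mul_row_block mulmx0 addr0.
set v1 := lsubmx _; set v2 := rsubmx _; split=> [|[w]].
  rewrite -[0]row_mx0 => /eq_row_mx [/eF [w1 E1] h].
  have /eG [w2 E2] : (v2 - w1 *m theta i.+1) *m res_diff G i = 0.
    rewrite mulmxBl -mulmxA -[theta i.+1 *m _](addKr (res_diff F i.+1 *m theta i)) sth.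
    by rewrite addr0 mulmxN opprK mulmxA -E1 addrC.
  exists (row_mx w1 w2); rewrite mul_row_block mulmx0 addr0 -E1 -E2 addrC subrK //.
rewrite -[w]hsubmxK mul_row_block mulmx0 addr0 => /eq_row_mx [-> ->].
have -> : lsubmx w *m res_diff F i.+1 *m res_diff F i = 0 by apply/eF; exists (lsubmx w).
rewrite mulmxDl addrA -!mulmxA -mulmxDr sth mulmx0 add0r.
have -> : rsubmx w *m (res_diff G i.+1 *m res_diff G i) = 0.
  by rewrite mulmxA; apply/eG; exists (rsubmx w).
by rewrite row_mx0.
Qed.

End HorseshoeLemma.
End Horseshoe.

(** * The long exact Ext sequence of a splice, on cocycles and coboundaries *)

Section SpliceExt.
Variables (K : fieldType) (n m : nat).
Local Notation S := {mpoly K[n]}.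
Variables (F G : resolution_data K n m).
Variable theta : forall i, 'M[S]_(res_rk F i.+1, res_rk G i).
Hypotheses (cF : is_complex_data F) (cG : is_complex_data G).
Hypothesis hth : forall i, homog_mx (res_shift F i.+1) (res_shift G i) (theta i).
Hypothesis sth : is_splice theta.
Local Notation H := (splice theta).
Local Notation Z F i := (@num K n (ext_mod F i)).
Local Notation B F i := (@den K n (ext_mod F i)).
Implicit Types (i : nat).

Lemma splice_complex : is_complex_data H.
Proof.
split=> i /=; first by apply: homog_block_mx; [exact: cF.1 | exact: hth | exact: homog_mx0 | exact: cG.1].
by rewrite mulmx_block !mulmx0 !mul0mx !addr0 add0r cF.2 cG.2 sth block_mx_const.
Qed.

Lemma splice_theta_tr i :
  (theta i)^T *m (res_diff F i.+1)^T = - ((res_diff G i)^T *m (theta i.+1)^T).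
Proof. by apply/eqP; rewrite -addr_eq0 -!trmx_mul -raddfD sth raddf0. Qed.

Lemma splice_num i v w : Z H i (row_mx v w) <->
  v *m (res_diff F i)^T + w *m (theta i)^T = 0 /\ Z G i w.
Proof.
rewrite /= tr_block_mx trmx0 mul_row_block mulmx0 add0r -[0]row_mx0.
by split=> [/eq_row_mx //|[-> ->]].
Qed.

Lemma splice_den0 v w : B H 0 (row_mx v w) <-> v = 0 /\ w = 0.
Proof. by rewrite /= -[0]row_mx0; split=> [/eq_row_mx //|[-> ->]]. Qed.

Lemma splice_denS i v w : B H i.+1 (row_mx v w) <->
  exists v' w', v = v' *m (res_diff F i)^T + w' *m (theta i)^T /\ w = w' *m (res_diff G i)^T.
Proof.
rewrite /= tr_block_mx trmx0; split=> [[x]|[v' [w' [-> ->]]]].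
  rewrite -[x]hsubmxK mul_row_block mulmx0 add0r => /eq_row_mx [-> ->].
  by exists (lsubmx x), (rsubmx x).
by exists (row_mx v' w'); rewrite mul_row_block mulmx0 add0r.
Qed.

Lemma splice_num_l i v : Z F i v -> Z H i (row_mx v 0).
Proof. by move=> /= h; apply/splice_num; split; rewrite /= ?h !mul0mx ?addr0. Qed.

Lemma splice_den_l i v : B F i v -> B H i (row_mx v 0).
Proof.
case: i v => [|i] v; first by move=> -> ; apply/splice_den0.
by case=> w ->; apply/splice_denS; exists w, 0; rewrite !mul0mx addr0.
Qed.

Lemma splice_den_r i v w : B H i (row_mx v w) -> B G i w.
Proof.
case: i v w => [|i] v w; first by move/splice_den0 => -[].
by move/splice_denS => [v' [w' [_ ->]]]; exists w'.
Qed.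

(** The connecting map Ext^i(G) -> Ext^(i+1)(F) is multiplication by the transpose of [theta i];
    when its target vanishes, every cocycle of [G] extends to one of the splice. *)
Lemma splice_lift i w : is_zero_gmod (ext_mod F i.+1) -> Z G i w ->
  exists v, Z H i (row_mx v w).
Proof.
move=> zF /= hw; have [|v hv] := zF (w *m (theta i)^T).
  rewrite /= -mulmxA splice_theta_tr mulmxN mulmxA hw mul0mx oppr0 //.
by exists (- v); apply/splice_num; rewrite mulNmx -hv addNr.
Qed.

(** Exactness in the middle: a cocycle whose part in [G] is a coboundary comes from [F], up to a
    coboundary. *)
Lemma splice_exact i v w : Z H i (row_mx v w) -> B G i w ->
  exists2 v', Z F i v' & B H i (row_mx v w - row_mx v' 0).
Proof.
move=> /splice_num [hv hw]; case: i v w hv hw => [|i] v w hv hw.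
  move=> /= w0; exists v; first by move: hv; rewrite /= w0 mul0mx addr0.
  by rewrite w0 subrr.
case=> w' E; exists (v - w' *m (theta i)^T).
  rewrite /= mulmxBl -mulmxA splice_theta_tr mulmxN opprK mulmxA -E.
  exact: hv.
rewrite opp_row_mx add_row_mx oppr0 addr0 opprB addrC subrK.
by apply/splice_denS; exists 0, w'; rewrite mul0mx add0r.
Qed.

(** Ext^(i+1)(F) -> Ext^(i+1)(H) is injective because the connecting map from Ext^i(G) = 0 is the
    only source of a kernel. *)
Lemma splice_inj i v : is_zero_gmod (ext_mod G i) ->
  B H i.+1 (row_mx v 0) -> B F i.+1 v.
Proof.
move=> zG /splice_denS [v' [w' [-> /esym hw']]].
apply: submodD; first exact: ext_den_submod; first exact: ext_den_trmx.
have := zG w' hw'; case: (i) w' {hw'} => [|j] w'.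
  by move=> ->; rewrite mul0mx; exact: (ext_den_submod _ _).1.
case=> x ->; exists (- (x *m (theta j)^T)).
by rewrite mulNmx -!mulmxA splice_theta_tr mulmxN opprK.
Qed.

Lemma splice_ext_zero i : is_zero_gmod (ext_mod F i) -> is_zero_gmod (ext_mod G i) ->
  is_zero_gmod (ext_mod H i).
Proof.
move=> zF zG u; have -> : u = row_mx (lsubmx u) (rsubmx u) by rewrite hsubmxK.
move=> hu; have [_ /zG hw] := (splice_num _ _).1 hu.
have [v' /zF/splice_den_l hv' hB] := splice_exact hu hw.
exact: submod_subr (ext_den_submod H i) hB hv'.
Qed.

Lemma splice_ext_cyclic_l i J e u : is_zero_gmod (ext_mod G i) ->
  is_zero_gmod (ext_mod G i.+1) -> cyclic_gmod (E := ext_mod F i.+1) J e u ->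
  cyclic_gmod (E := ext_mod H i.+1) J e (row_mx u 0).
Proof.
move=> zG zG' [nu hu gu ku]; split.
- exact: splice_num_l.
- move=> k; case: (split_ordP k) => l ->.
    by rewrite row_mxEl /= sum_shiftl; apply: hu.
  by rewrite row_mxEr mxE; apply: homog_poly0.
- move=> x; have -> : x = row_mx (lsubmx x) (rsubmx x) by rewrite hsubmxK.
  move=> hx; have [_ /zG' hw] := (splice_num _ _).1 hx.
  have [v' /gu [p /splice_den_l hp] hB] := splice_exact hx hw.
  exists p; rewrite scale_row_mx scaler0.
  have := submodD (ext_den_submod H i.+1) hB hp.
  have -> : row_mx (v' - p *: u) 0 = row_mx v' 0 - row_mx (p *: u) 0 :> 'rV[S]_(_ + res_rk G i.+1).
    by rewrite opp_row_mx add_row_mx oppr0 addr0.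
  by rewrite addrA subrK.
move=> p; rewrite scale_row_mx scaler0; split=> [/splice_inj h|/ku /splice_den_l //].
by apply/ku/h.
Qed.

Lemma splice_ext_cyclic_r i J e w : is_zero_gmod (ext_mod F i) ->
  is_zero_gmod (ext_mod F i.+1) -> cyclic_gmod (E := ext_mod G i) J e w ->
  exists v, cyclic_gmod (E := ext_mod H i) J e (row_mx v w).
Proof.
move=> zF zF' [nw hw gw kw]; have [v0 hv0] := splice_lift zF' nw.
(* The lift [v0] need not be homogeneous. Taking the component of degree [e] of the whole row keeps
   it a cocycle and leaves the block [w], already homogeneous, as it is. *)
have [v [hv hve]] : exists v, Z H i (row_mx v w) /\ homog_vec (shift (ext_mod H i)) e (row_mx v w).
  exists (lsubmx (vcomp (shift (ext_mod H i)) e (row_mx v0 w : 'rV_(res_rk F i + res_rk G i)))).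
  have E : row_mx (lsubmx (vcomp (shift (ext_mod H i)) e (row_mx v0 w : 'rV_(res_rk F i + res_rk G i)))) w
    = vcomp (shift (ext_mod H i)) e (row_mx v0 w).
    apply/rowP => k; case: (split_ordP k) => l ->.
      by rewrite row_mxEl mxE.
    by rewrite row_mxEr [RHS]mxE row_mxEr /= sum_shiftr hcomp_id //; apply: hw.
  rewrite E; split; last exact: vcomp_homog.
  by apply: ext_num_vcomp hv0; exact: splice_complex.
exists v; split=> // [x|p].
  have -> : x = row_mx (lsubmx x) (rsubmx x) by rewrite hsubmxK.
  move=> hx; have [_ /gw [p hp]] := (splice_num _ _).1 hx.
  exists p; rewrite scale_row_mx opp_row_mx add_row_mx.
  have hx' : Z H i (row_mx (lsubmx x - p *: v) (rsubmx x - p *: w)).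
    rewrite -add_row_mx -opp_row_mx -scale_row_mx.
    by apply: submodB (ext_num_submod H i) hx _; apply: submodZ => //; exact: ext_num_submod.
  have [v' /zF/splice_den_l hv' hB] := splice_exact hx' hp.
  exact: submod_subr (ext_den_submod H i) hB hv'.
rewrite scale_row_mx; split=> [/splice_den_r/kw //|/kw hp].
have hx' : Z H i (row_mx (p *: v) (p *: w)).
  by rewrite -scale_row_mx; apply: submodZ hv; exact: ext_num_submod.
have [v' /zF/splice_den_l hv' hB] := splice_exact hx' hp.
exact: submod_subr (ext_den_submod H i) hB hv'.
Qed.

Let inl i (v : 'rV[S]_(res_rk F i)) : 'rV[S]_(res_rk H i) := row_mx v 0.

Lemma splice_spanD i s v : is_zero_gmod (ext_mod G i) ->
  spanD (B H i.+1) (map (@inl i.+1) s) (row_mx v 0) <-> spanD (B F i.+1) s v.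
Proof.
move=> zG; elim: s v => [|u s IH] v.
  by split=> [/splice_inj h|h]; [exact: h | exact: splice_den_l].
split=> -[c hc]; exists c; first apply/IH; last move/IH: hc => hc.
all: move: hc; rewrite /inl scale_row_mx opp_row_mx add_row_mx scaler0 subr0 //.
Qed.

Lemma splice_spanD_r i s v w :
  spanD (B H i.+1) (map (@inl i.+1) s) (row_mx v w) -> B G i.+1 w.
Proof.
elim: s v w => [|u s IH] v w; first exact: splice_den_r.
case=> c; rewrite /inl scale_row_mx opp_row_mx add_row_mx scaler0 subr0; exact: IH.
Qed.

(** The sequence reduces to 0 -> Ext(F) -> Ext(H) -> K -> 0. Injectivity carries the filtration of
    Ext(F) over, and a lift of the generator of K becomes its new top element. *)
Lemma splice_ext_chain i s e w : is_zero_gmod (ext_mod G i) ->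
  is_zero_gmod (ext_mod F i.+2) ->
  cyclic_gmod (E := ext_mod G i.+1) (monid (fun m => m != 0%MM)) e w ->
  (forall v, Z F i.+1 v <-> spanD (B F i.+1) s v) -> socle_chain (B F i.+1) s ->
  exists s' : seq 'rV[S]_(res_rk H i.+1), [/\ size s' = (size s).+1,
    forall v, Z H i.+1 v <-> spanD (B H i.+1) s' v & socle_chain (B H i.+1) s'].
Proof.
move=> zG zF [nw hw gw kw] Zs gs; have [v hv] := splice_lift zF nw.
have sZ := ext_num_submod H i.+1; have sB := ext_den_submod H i.+1.
have sS t := spanD_submod sB t.
have key x y : Z H i.+1 (row_mx x y) -> B G i.+1 y ->
    spanD (B H i.+1) (map (@inl i.+1) s) (row_mx x y).
  move=> hx hy; have [v' /Zs/(splice_spanD _ _ zG) hv' hB] := splice_exact hx hy.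
  by apply: submod_subr hv' => //; apply: spanD_den.
exists (row_mx v w :: map (@inl i.+1) s); split; first by rewrite /= size_map.
- move=> x; split.
    have -> : x = row_mx (lsubmx x) (rsubmx x) by rewrite hsubmxK.
    move=> hx; have [_ /gw [p hp]] := (splice_num _ _).1 hx.
    exists p; rewrite scale_row_mx opp_row_mx add_row_mx; apply: key => //.
    rewrite -add_row_mx -opp_row_mx -scale_row_mx.
    by apply: submodB hx _ => //; apply: submodZ.
  apply: spanD_sub => //; first exact: (ext_den_num splice_complex).
  move=> y; rewrite inE => /orP[/eqP -> //|/mapP [z zs ->]].
  apply: splice_num_l; apply/Zs.
  elim: s zs {Zs gs key} => // a s IH; rewrite inE => /orP[/eqP ->|/IH h].
    by apply: spanD_head; exact: ext_den_submod.
  exact: spanDS.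
split.
- elim: s gs {Zs key} => //= u s IH [/IH h1 h2 h3]; split=> //.
    by move/(splice_spanD _ _ zG).
  by move=> j; rewrite /inl scale_row_mx scaler0; apply/splice_spanD.
- move/splice_spanD_r; rewrite -[w]scale1r => /kw /(_ 0%MM).
  by rewrite msupp1 inE eqxx => /(_ isT).
move=> j; rewrite scale_row_mx; apply: key.
  by rewrite -scale_row_mx; apply: submodZ.
by apply/kw/monidX; rewrite mnm1_eq0.
Qed.

End SpliceExt.

(** * Koszul resolutions *)

Section MappingCone.
Variables (K : fieldType) (n m : nat).
Local Notation S := {mpoly K[n]}.
Variables (F : resolution_data K n m) (f : S) (c : int).

(** The cone of multiplication by [f], of degree [c], on [F]: its term of index i is F_i plus
    F_(i-1)(- c). *)
Definition cone_rk i := if i is i'.+1 then (res_rk F i'.+1 + res_rk F i')%N else res_rk F 0.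

Definition cone_shift i : 'I_(cone_rk i) -> int :=
  match i with
  | 0 => res_shift F 0
  | i'.+1 => sum_shift (res_shift F i'.+1) (fun k => res_shift F i' k + c)
  end.

Definition cone_diff i : 'M[S]_(cone_rk i.+1, cone_rk i) :=
  match i with
  | 0 => col_mx (res_diff F 0) f%:M
  | i'.+1 => block_mx (res_diff F i'.+1) 0 f%:M (- res_diff F i')
  end.

Definition cone := @ResolutionData K n m cone_rk cone_shift cone_diff (res_aug F).

Hypothesis hf : homog_poly c f.

Lemma cone_diff_homog i :
  (forall i, homog_mx (res_shift F i.+1) (res_shift F i) (res_diff F i)) ->
  homog_mx (cone_shift (i := i.+1)) (cone_shift (i := i)) (cone_diff i).
Proof.
move=> hF; case: i => [|i] /=.
  apply: homog_col_mx => //; apply: homog_scalar_mx => k.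
  by rewrite [X in homog_poly X](_ : _ = c) //; lia.
apply: homog_block_mx => //; first exact: homog_mx0.
  apply: homog_scalar_mx => k.
  by rewrite [X in homog_poly X](_ : _ = c) //; lia.
apply: homog_mxN => a b.
have := hF i a b; congr homog_poly => /=; lia.
Qed.

(** The third hypothesis makes [f] a nonzerodivisor on N/D, and the fourth says D' = D + f N; the
    homology of the cone above degree 0 is the kernel of [f] on N/D, hence 0. *)
Lemma cone_resolution (sh : 'I_m -> int) (N D D' : 'rV[S]_m -> Prop) :
  is_submod N -> is_submod D ->
  (forall v, N v -> D (f *: v) -> D v) ->
  (forall v, D' v <-> exists2 w, N w & D (v - f *: w)) ->
  is_free_resolution (M := Gmod sh N D) F ->
  is_free_resolution (M := Gmod sh N D') cone.
Proof.
move=> sN sD reg D'E rF; have [_ cF] := free_resolution_complex rF.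
have [[/= haF hdF] [/= nF gF kF eF]] := rF.
split; first by split=> // i; apply: cone_diff_homog.
split=> [//|u /gF [v hv]|v|i v] /=.
- by exists v; apply/D'E; exists 0; [case: sN | rewrite scaler0 subr0].
- split=> [/D'E [w /gF [x hx] hw]|[w ->]].
    have /kF [y E] : D ((v - f *: x) *m res_aug F).
      have := submodD sD hw (submodZ f sD hx).
      by rewrite scalerBr addrA subrK mulmxBl -scalemxAl.
    by exists (row_mx y x); rewrite mul_row_col mul_mx_scalar -E subrK.
  rewrite -[w]hsubmxK mul_row_col mul_mx_scalar mulmxDl -scalemxAl.
  apply/D'E; exists (rsubmx w *m res_aug F) => //; rewrite addrK.
  by apply/kF; exists (lsubmx w).
case: i v => [|i] v /=.
  rewrite -[v]hsubmxK mul_row_col mul_mx_scalar.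
  set v1 := lsubmx _; set v2 := rsubmx _; split=> [h|[w]].
    have /kF [w2 E2] : D (v2 *m res_aug F).
      apply: reg => //; rewrite scalemxAl -(addKr (v1 *m res_diff F 0) (f *: _)) h addr0.
      by rewrite mulNmx; apply: submodN => //; apply/kF; exists v1.
    have /eF [w1 E1] : (v1 + f *: w2) *m res_diff F 0 = 0.
      by rewrite mulmxDl -scalemxAl -E2.
    exists (row_mx w1 (- w2)); rewrite mul_row_block mulmx0 add0r mul_mx_scalar.
    by rewrite -E1 scalerN addrK mulmxN mulNmx opprK E2.
  rewrite -[w]hsubmxK mul_row_block mulmx0 add0r mul_mx_scalar mulmxN => /eq_row_mx [-> ->].
  rewrite mulmxDl -scalemxAl scalerN addrK; apply/eF; by exists (lsubmx w).
rewrite -[v]hsubmxK mul_row_block mulmx0 add0r mul_mx_scalar mulmxN.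
set v1 := lsubmx _; set v2 := rsubmx _; split=> [|[w]].
  rewrite -[0]row_mx0 => /eq_row_mx [h /eqP]; rewrite oppr_eq0 => /eqP/eF [w2 E2].
  have /eF [w1 E1] : (v1 + f *: w2) *m res_diff F i.+1 = 0.
    by rewrite mulmxDl -scalemxAl -E2.
  exists (row_mx w1 (- w2)); rewrite mul_row_block mulmx0 add0r mul_mx_scalar.
  by rewrite -E1 scalerN addrK mulmxN mulNmx opprK E2.
rewrite -[w]hsubmxK mul_row_block mulmx0 add0r mul_mx_scalar mulmxN => /eq_row_mx [-> ->].
rewrite mulmxDl -scalemxAl scalerN addrK mulNmx opprK.
by rewrite -!mulmxA !cF !mulmx0 row_mx0.
Qed.

Local Notation Z F i := (@num K n (ext_mod F i)).
Local Notation B F i := (@den K n (ext_mod F i)).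

Lemma cone_num i v w : Z cone i.+1 (row_mx v w) <->
  Z F i.+1 v /\ f *: v = w *m (res_diff F i)^T.
Proof.
rewrite /= tr_block_mx trmx0 mul_row_block mulmx0 addr0 tr_scalar_mx mul_mx_scalar.
rewrite [(- _)^T]raddfN /= mulmxN -[0]row_mx0.
split=> [/eq_row_mx [-> /eqP]|[-> ->]]; last by rewrite subrr.
by rewrite subr_eq0 => /eqP.
Qed.

Lemma cone_den i v w : B cone i.+1 (row_mx v w) <->
  exists v' x, [/\ B F i x, v = v' *m (res_diff F i)^T & w = f *: v' + x].
Proof.
case: i v w => [|i] v w /=.
  rewrite tr_col_mx tr_scalar_mx; split=> [[x]|[v' [x [-> -> ->]]]].
    rewrite mul_mx_row mul_mx_scalar => /eq_row_mx [-> ->].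
    by exists x, 0; rewrite addr0.
  by exists v'; rewrite mul_mx_row mul_mx_scalar addr0.
rewrite tr_block_mx trmx0 tr_scalar_mx [(- _)^T]raddfN /=.
split=> [[x]|[v' [x [[y ->] -> ->]]]].
  rewrite -[x]hsubmxK mul_row_block mulmx0 addr0 mul_mx_scalar mulmxN => /eq_row_mx [-> ->].
  exists (lsubmx x), (- rsubmx x *m (res_diff F i)^T); split=> //; last by rewrite mulNmx.
  by exists (- rsubmx x).
by exists (row_mx v' (- y)); rewrite mul_row_block mulmx0 addr0 mul_mx_scalar mulmxN mulNmx opprK.
Qed.

Lemma cone_ext_zero0 : f != 0 -> is_zero_gmod (ext_mod cone 0).
Proof.
move=> f0 v /=; rewrite tr_col_mx tr_scalar_mx mul_mx_row mul_mx_scalar -[0]row_mx0.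
move=> /eq_row_mx [_ E]; apply/rowP => k; have := congr1 (fun z : 'rV_ _ => z 0 k) E.
by rewrite !mxE => /eqP; rewrite mulf_eq0 (negbTE f0) => /eqP.
Qed.

Lemma cone_reduce i v w : Z cone i.+1 (row_mx v w) -> B F i.+1 v ->
  exists2 y, Z F i y & B cone i.+1 (row_mx v w - row_mx 0 y).
Proof.
move=> /cone_num [_ hw] /= [v' E]; exists (w - f *: v').
  by rewrite /= mulmxBl -hw -scalemxAl E subrr.
rewrite opp_row_mx add_row_mx oppr0 addr0 opprB addrC subrK; apply/cone_den.
by exists v', 0; rewrite addr0; split=> //; apply: (ext_den_submod F i).1.
Qed.

Lemma cone_den_r i y : B F i y -> B cone i.+1 (row_mx 0 y).
Proof. by move=> hy; apply/cone_den; exists 0, y; rewrite mul0mx scaler0 add0r. Qed.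

Lemma cone_ext_zero i : is_zero_gmod (ext_mod F i) -> is_zero_gmod (ext_mod F i.+1) ->
  is_zero_gmod (ext_mod cone i.+1).
Proof.
move=> zF zF' u; have -> : u = row_mx (lsubmx u) (rsubmx u) by rewrite hsubmxK.
move=> hu; have [/zF' hv _] := (cone_num _ _).1 hu.
have [y /zF/cone_den_r hy hB] := cone_reduce hu hv.
exact: submod_subr (ext_den_submod cone i.+1) hB hy.
Qed.

Variables (r : nat) (J J' : S -> Prop) (e : int) (u : 'rV[S]_(res_rk F r)).
Hypothesis cJ : cyclic_gmod (E := ext_mod F r) J e u.
Hypothesis regJ : forall p, J (f * p) -> J p.
Hypothesis J'E : forall p, J' p <-> exists q, J (p - f * q).

(** Ext^r of the cone lies between Ext^(r-1)(F) = 0 and the kernel of [f] on Ext^r(F) = S/J, where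
    [f] is injective. *)
Lemma cone_ext_regular : is_zero_gmod (ext_mod F r.-1) -> (0 < r)%N ->
  is_zero_gmod (ext_mod cone r).
Proof.
case: r u cJ => // r' u' [nu hu gu ku] zF _ x.
have -> : x = row_mx (lsubmx x) (rsubmx x) by rewrite hsubmxK.
set v := lsubmx x; set w := rsubmx x => hx.
have [nv hw] := (cone_num _ _).1 hx.
have [p hp] := gu _ nv.
have sB := ext_den_submod F r'.+1.
have Jp : J p.
  apply/regJ/ku; rewrite -scalerA.
  have := submodB sB (ext_den_trmx w) (submodZ f sB hp).
  by rewrite -hw scalerBr opprB addrC subrK.
have Bv : B F r'.+1 v by apply: submod_subr hp _ => //; apply/ku.
have [y /zF/cone_den_r hy hB] := cone_reduce hx Bv.
exact: submod_subr (ext_den_submod cone r'.+1) hB hy.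
Qed.

(** Ext^(r+1) of the cone is the cokernel of [f] on Ext^r(F) = S/J, because Ext^(r+1)(F) vanishes;
    so the generator passes to the new block and J grows to J + (f). *)
Lemma cone_ext_cyclic : is_zero_gmod (ext_mod F r.+1) ->
  cyclic_gmod (E := ext_mod cone r.+1) J' (e - c) (row_mx 0 u).
Proof.
case: cJ => nu hu gu ku zF; split.
- by apply/cone_num; rewrite scaler0 [RHS]nu; split=> //; exact: (ext_num_submod _ _).1.
- move=> k; case: (split_ordP k) => l ->.
    by rewrite row_mxEl mxE; apply: homog_poly0.
  rewrite row_mxEr /= sum_shiftr; have := hu l.
  by congr homog_poly => /=; lia.
- move=> x; have -> : x = row_mx (lsubmx x) (rsubmx x) by rewrite hsubmxK.
  move=> hx; have [/zF hv _] := (cone_num _ _).1 hx.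
  have [y /gu [p /cone_den_r hp] hB] := cone_reduce hx hv.
  exists p; rewrite scale_row_mx scaler0.
  have := submodD (ext_den_submod cone r.+1) hB hp.
  have -> : row_mx 0 (y - p *: u) = row_mx 0 y - row_mx 0 (p *: u) :> 'rV[S]_(res_rk F r.+1 + _).
    by rewrite opp_row_mx add_row_mx oppr0 addr0.
  by rewrite addrA subrK.
move=> p; rewrite scale_row_mx scaler0; have sB := ext_den_submod F r; split.
  move/cone_den => [v' [x [hx /esym hv E]]]; apply/J'E.
  have [q hq] := gu v' hv; exists q; apply/ku.
  have := submodD sB (submodZ f sB hq) hx.
  by rewrite scalerBr scalerBl E scalerA addrAC.
move/J'E => [q /ku hq]; apply/cone_den; exists (q *: u), ((p - f * q) *: u).
split=> //; first by rewrite -scalemxAl [_ *m _]nu scaler0.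
by rewrite scalerBl scalerA addrC subrK.
Qed.

End MappingCone.

Section CyclicResolution.
Variables (K : fieldType) (n : nat) (E : gmod K n) (J : {mpoly K[n]} -> Prop).
Variables (e : int) (u : 'rV[{mpoly K[n]}]_(rk E)) (G : resolution_data K n 1).
Hypotheses (sN : is_submod (@num K n E)) (sD : is_submod (@den K n E)).
Hypothesis cE : cyclic_gmod (E := E) J e u.

(** Shifting all degrees by [e] and sending the generator to [u] lets a Koszul resolution of S/J
    serve for any shifted copy: a subquotient of S, or an Ext module. *)
Definition push_resolution := @ResolutionData K n (rk E) (res_rk G)
  (fun i k => res_shift G i k + e) (res_diff G) (res_aug G *m u).

Lemma push_free_resolution : is_free_resolution (M := quot_mod J) G ->
  is_free_resolution (M := E) push_resolution.
Proof.
case: cE => nu hu gu ku [[/= haG hdG] [/= nG gG kG eG]].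
have augE (v : 'rV_(res_rk G 0)) : v *m (res_aug G *m u) = (v *m res_aug G) 0 0 *: u.
  by rewrite mulmxA [v *m _ in LHS]mx11_scalar mul_scalar_mx.
split; first split=> [|i] a b /=.
- rewrite mxE big_ord1.
  have -> : res_shift G 0%N a + e - shift E b = (res_shift G 0%N a - 0) + (e - shift E b) by lia.
  by apply: homog_polyM; [exact: haG | exact: hu].
- have -> : res_shift G i.+1 a + e - (res_shift G i b + e) = res_shift G i.+1 a - res_shift G i b by lia.
  exact: hdG.
split=> [v|w /gu [p hp]|v|//] /=.
- by rewrite augE; apply: submodZ.
- have [v] := gG (const_mx p) I.
  have -> : (const_mx p - v *m res_aug G : 'rV_1) 0 0 = p - (v *m res_aug G) 0 0.
    by rewrite !(@mxE _ 1 1).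
  move/ku => hv; exists v; rewrite augE.
  apply: (@submod_subr _ _ _ _ _ ((p - (v *m res_aug G) 0 0) *: u)) => //.
  by rewrite scalerBl opprB addrA subrK.
- by rewrite augE ku; apply: kG.
Qed.

Lemma push_ext_cyclic i J1 e1 u1 : cyclic_gmod (E := ext_mod G i) J1 e1 u1 ->
  cyclic_gmod (E := ext_mod push_resolution i) J1 (e1 - e) u1.
Proof.
case=> nu hu gu ku; split=> // k; have := hu k.
by congr homog_poly => /=; lia.
Qed.

End CyclicResolution.

Section Koszul.
Variables (K : fieldType) (n : nat) (alpha : nat -> nat).
Local Notation S := {mpoly K[n]}.

Lemma mpoly_divX (k : 'X_{1..n}) (p : S) :
  exists q, forall m, (p - 'X_[k] * q)@_m = if (k <= m)%MM then 0 else p@_m.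
Proof.
elim/mpolyind: p => [|c m p _ _ [q hq]].
  by exists 0 => m; rewrite mulr0 subrr mcoeff0 if_same.
exists ((if (k <= m)%MM then c *: 'X_[m - k] else 0) + q) => m'.
rewrite mulrDr opprD addrACA mcoeffD hq mcoeffB mcoeffD mcoeffZ mcoeffX.
have [km|km] := boolP (k <= m)%MM.
  rewrite -scalerAr -mpolyXD addmC submK // mcoeffZ mcoeffX subrr add0r.
  case: (m =P m') => [<-|_]; last by rewrite mulr0 add0r.
  by rewrite km.
rewrite mulr0 mcoeff0 subr0.
case: (m =P m') => [<-|_]; last by rewrite mulr0 !add0r.
by rewrite (negbTE km).
Qed.

(** The monomials of the complete intersection generated by the powers X_i ^ alpha_i with i < r. *)
Definition powQ r : pred 'X_{1..n} :=
  fun m => [exists i : 'I_n, (i < r)%N && (alpha i <= m i)%N].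

Lemma powQ_upclosed r : upclosed (powQ r).
Proof.
move=> m k /existsP [i /andP[ir h]]; apply/existsP; exists i.
by rewrite ir mnmDE (leq_trans h) ?leq_addr.
Qed.

Lemma lem_pow (i : 'I_n) a (m : 'X_{1..n}) : (U_(i) *+ a <= m)%MM = (a <= m i)%N.
Proof.
apply/mnm_lepP/idP => [/(_ i)|h j]; rewrite mulmnE mnm1E.
  by rewrite eqxx mul1n.
by case: (i =P j) => [<-|]; rewrite ?mul1n.
Qed.

Definition free_complex : resolution_data K n 1 :=
  @ResolutionData K n 1 (fun i => if i is 0 then 1 else 0)%N (fun _ _ => 0) (fun _ => 0) 1%:M.

Lemma free_complex_resolution : is_free_resolution (M := quot_mod (monid (powQ 0))) free_complex.
Proof.
have Z0 (p : S) : monid (powQ 0) p <-> p = 0.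
  split=> [/monidP h|->]; last by move=> m; rewrite msupp0.
  apply/mpolyP => m; rewrite mcoeff0; apply/eqP; apply: contraT => /h /existsP [i].
  by rewrite ltn0.
split; first split=> [i j|i j] /=.
- by rewrite !ord1 mxE; apply: homog_polyC.
- by case: j => // j; rewrite mxE; apply: homog_poly0.
split=> [//|u _|v|i v] /=.
- exists u; rewrite mulmx1 subrr mxE; exact/Z0.
- rewrite mulmx1; split=> [/Z0 h|[w ->]].
    by exists 0; rewrite mul0mx; apply/rowP => k; rewrite ord1 h mxE.
  by rewrite mulmx0 mxE; apply/Z0.
split=> [_|_]; last by rewrite mulmx0.
by exists 0; rewrite mulmx0 [v]thinmx0.
Qed.

(* The mapping cone of multiplication by X_r ^+ alpha r, iterated. *)
Lemma koszul_resolution r : (r <= n)%N -> exists F : resolution_data K n 1,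
  [/\ is_free_resolution (M := quot_mod (monid (powQ r))) F,
      forall i, i != r -> is_zero_gmod (ext_mod F i)
    & exists e u, cyclic_gmod (E := ext_mod F r) (monid (powQ r)) e u].
Proof.
elim: r => [_|r IH lt].
  exists free_complex; split; first exact: free_complex_resolution.
    case=> // i _ v _ /=; rewrite [v]thinmx0; exists 0; by rewrite mul0mx.
  exists n%:Z, 1%:M; split=> /=.
  - by rewrite raddf0 mulmx0.
  - by move=> k; rewrite !ord1 mxE; apply: homog_polyC; lia.
  - move=> v _; exists (v 0 0); apply/rowP => k; rewrite ord1 !mxE mulr1 subrr //.
  have [_ [_ _ /= h _]] := free_complex_resolution.
  move=> p; split=> [E|].
    by move=> m; have := congr1 (fun z : 'rV_1 => z 0 0) E; rewrite !mxE mulr1 => ->; rewrite msupp0.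
  move=> hp.
  have := h (p *: 1%:M : 'rV[S]_1).
  rewrite mulmx1.
  rewrite !mxE mulr1 => -[/(_ hp) [w ->] _]; exact: mulmx0.
have [F [rF zF [e [u cu]]]] := IH (ltnW lt).
pose i0 := Ordinal lt; pose k := (U_(i0) *+ alpha r)%MM; pose f : S := 'X_[k].
pose Q := powQ r; pose Q' := powQ r.+1.
have iQ := @monid_ideal K n _ (@powQ_upclosed r).
have iQ' := @monid_ideal K n _ (@powQ_upclosed r.+1).
have QQ' m : Q' m = Q m || (k <= m)%MM.
  rewrite lem_pow; apply/existsP/orP => [[i /andP[]]|[/existsP [i /andP[ir h]]|h]].
  - rewrite ltnS leq_eqVlt => /orP[/eqP ir h|ir h].
      by right; rewrite -ir in h *; rewrite (_ : i0 = i) //; apply: val_inj.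
    by left; apply/existsP; exists i; rewrite ir.
  - by exists i; rewrite ltnS ltnW.
  - by exists i0; rewrite ltnS leqnn.
(* The power of X_r is regular modulo powers of earlier variables: its exponent at every index i < r
   is 0, so it does not help to reach alpha_i. *)
have reg p : monid Q (f * p) -> monid Q p.
  move=> /monidP h; apply/monidP => m pm; have := h (k + m)%MM.
  rewrite mulrC mcoeffMX => /(_ pm) /existsP [i /andP[ir hi]]; apply/existsP; exists i.
  rewrite ir; move: hi; rewrite mnmDE mulmnE mnm1E.
  by case: (i0 =P i) => [E|_]; [rewrite -E ltnn in ir | rewrite mul0n].
have J'E p : monid Q' p <-> exists q, monid Q (p - f * q).
  split=> [/monidP h|[q hq]].
    have [q hq] := mpoly_divX k p; exists q; apply/monidP => m; rewrite hq.
    case: ifP => [_|km /h]; first by rewrite eqxx.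
    by rewrite QQ' km orbF.
  rewrite -(subrK (f * q) p); apply: (idealD iQ').
    by move=> m /hq; rewrite -/(Q' m) QQ' -/(Q m) => ->.
  rewrite mulrC; apply: (idealM _ iQ'); apply/monidX; by rewrite -/(Q' k) QQ' lepm_refl orbT.
have hf : homog_poly (mdeg k)%:Z f by apply: homog_polyX.
exists (cone F f (mdeg k)%:Z); split.
- apply: (cone_resolution hf) rF; rewrite /=.
  + by split.
  + exact: is_ideal_submod.
  + by move=> v _; rewrite mxE; apply: reg.
  move=> v; split=> [/J'E [q hq]|[w _]].
    by exists (const_mx q) => //; rewrite !mxE.
  by rewrite !mxE => hw; apply/J'E; exists (w 0 0).
- move=> [_|i ir]; first by apply: cone_ext_zero0; rewrite // -msupp_eq0 msuppX.
  have [E|nr] := eqVneq i.+1 r.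
    rewrite E; apply: (cone_ext_regular cu reg) => //; last by rewrite -E.
    by apply: zF; rewrite -E /= neq_ltn ltnSn.
  by apply: cone_ext_zero => //; apply: zF.
exists (e - (mdeg k)%:Z), (row_mx 0 u).
by apply: (cone_ext_cyclic _ cu J'E); apply: zF; rewrite neq_ltn ltnSn orbT.
Qed.

End Koszul.

(** * Quotients by monomial ideals in four variables *)

Section MonomialExtension.
Variables (K : fieldType) (n : nat).
Local Notation S := {mpoly K[n]}.
Variables (Q1 Q2 Q' : pred 'X_{1..n}) (m : 'X_{1..n}).
Hypotheses (u1 : upclosed Q1) (u2 : upclosed Q2).
Hypothesis Q2E : forall k, Q2 k = Q1 k || (m <= k)%MM.
Hypothesis colonE : forall k, Q1 (m + k)%MM = Q' k.

(** With Q2 = Q1 + (m) and Q' = Q1 : m this is (Q1 + (m))/Q1, a copy of S/(Q1 : m) shifted by the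
    degree of m. *)
Definition monomial_subquotient : gmod K n :=
  @Gmod K n 1 (fun _ => 0) (fun v => monid Q2 (v 0 0)) (fun v => monid Q1 (v 0 0)).

Lemma monomial_subquotient_cyclic :
  cyclic_gmod (E := monomial_subquotient) (monid Q') (mdeg m)%:Z (const_mx 'X_[m]).
Proof.
split=> /=.
- by rewrite mxE; apply/monidX; rewrite Q2E lepm_refl orbT.
- by move=> k; rewrite mxE subr0; apply: homog_polyX.
- move=> v /monidP hv; have [q hq] := mpoly_divX m (v 0 0); exists q.
  rewrite !mxE mulrC; apply/monidP => k; rewrite hq.
  by case: ifP => [_|mk /hv]; [rewrite eqxx | rewrite Q2E mk orbF].
move=> p; rewrite !mxE; split=> [/monidP h|/monidP h].
  apply/monidP => k pk; rewrite -colonE; apply: h; by rewrite mcoeffMX.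
move=> k; rewrite (perm_mem (msuppMX p m)) => /mapP [k' kp ->].
by rewrite colonE; apply: h; rewrite -mcoeff_msupp.
Qed.

Lemma monomial_extension (F G : resolution_data K n 1) :
  is_free_resolution (M := quot_mod (monid Q2)) F ->
  is_free_resolution (M := quot_mod (monid Q')) G ->
  let H := push_resolution (E := monomial_subquotient) (mdeg m)%:Z (const_mx 'X_[m]) G in
  exists theta : forall i, 'M[S]_(res_rk F i.+1, res_rk H i),
  [/\ forall i, homog_mx (res_shift F i.+1) (res_shift H i) (theta i), is_splice theta,
      is_complex_data H
    & is_free_resolution (M := quot_mod (monid Q1)) (splice theta)].
Proof.
move=> rF rG H.
have s1 := is_ideal_submod (@monid_ideal K n _ u1).
have s2 := is_ideal_submod (@monid_ideal K n _ u2).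
have sT : is_submod (fun _ : 'rV[S]_1 => True) by [].
have rH : is_free_resolution (M := monomial_subquotient) H.
  exact: push_free_resolution monomial_subquotient_cyclic rG.
have Q12 (v : 'rV[S]_1) : monid Q1 (v 0 0) -> monid Q2 (v 0 0).
  by move=> h k /h; rewrite Q2E => ->.
have hD e (w : 'rV[S]_1) : monid Q1 (w 0 0) -> monid Q1 ((vcomp (fun _ => 0) e w) 0 0).
  by move=> h; rewrite mxE; apply: monid_hcomp.
have [theta [h1 h2 h3]] := horseshoe_theta s1 hD rF rH.
exists theta; split=> //; first exact: free_resolution_complex rH.
exact: (splice_resolution sT s2 s1 (fun _ _ => I) Q12 rF rH h1 h2 h3).
Qed.

End MonomialExtension.

Lemma eq_cyclic_gmod (K : fieldType) n (E : gmod K n) J J' e u :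
  (forall p, J p <-> J' p) -> cyclic_gmod (E := E) J e u -> cyclic_gmod (E := E) J' e u.
Proof.
by move=> JJ' [h1 h2 h3 h4]; split=> // p; split=> [/h4/JJ'|/JJ'/h4].
Qed.

Local Notation i0 := (@Ordinal 4 0 isT).
Local Notation i1 := (@Ordinal 4 1 isT).
Local Notation i2 := (@Ordinal 4 2 isT).
Local Notation i3 := (@Ordinal 4 3 isT).

Section FourVariables.

Lemma ord4P (P : 'I_4 -> Prop) : P i0 -> P i1 -> P i2 -> P i3 -> forall i, P i.
Proof.
move=> h0 h1 h2 h3 [[|[|[|[|//]]]] lt].
- by rewrite (_ : Ordinal lt = i0) //; apply: val_inj.
- by rewrite (_ : Ordinal lt = i1) //; apply: val_inj.
- by rewrite (_ : Ordinal lt = i2) //; apply: val_inj.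
- by rewrite (_ : Ordinal lt = i3) //; apply: val_inj.
Qed.

Lemma big_ord4 (R : nmodType) (F : 'I_4 -> R) :
  \sum_i F i = F i0 + F i1 + F i2 + F i3.
Proof.
rewrite !big_ord_recr big_ord0 /= add0r.
by congr (F _ + F _ + F _ + F _); apply: val_inj.
Qed.

Lemma mdeg4 (m : 'X_{1..4}) : mdeg m = (m i0 + m i1 + m i2 + m i3)%N.
Proof. by rewrite mdegE (big_ord4 (fun i => m i)). Qed.

Definition mono4 x y z t : 'X_{1..4} := [multinom tnth [tuple x; y; z; t] i | i < 4].

Lemma mono4E x y z t : [/\ mono4 x y z t i0 = x, mono4 x y z t i1 = y,
  mono4 x y z t i2 = z & mono4 x y z t i3 = t].
Proof. by split; rewrite mnmE. Qed.

Lemma mnm4P (m m' : 'X_{1..4}) :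
  m i0 = m' i0 -> m i1 = m' i1 -> m i2 = m' i2 -> m i3 = m' i3 -> m = m'.
Proof. by move=> *; apply/mnmP; apply: ord4P. Qed.

Lemma count_monos j (P : pred 'X_{1..4}) k (f : nat -> 'X_{1..4}) :
  (forall i, (i < k)%N -> mdeg (f i) = j /\ P (f i)) ->
  (forall i i', (i < k)%N -> (i' < k)%N -> f i = f i' -> i = i') ->
  (forall m, mdeg m = j -> P m -> exists2 i, (i < k)%N & m = f i) ->
  count P (monos 4 j) = k.
Proof.
move=> h1 h2 h3; rewrite -size_filter -[RHS](size_iota 0) -(size_map f).
apply: perm_size; apply: uniq_perm.
- by rewrite filter_uniq ?monos_uniq.
- rewrite map_inj_in_uniq ?iota_uniq // => i i'; rewrite !mem_iota !add0n /=; exact: h2.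
move=> m; rewrite mem_filter mem_monos; apply/andP/mapP => [[Pm /eqP mj]|[i]].
  by have [i ik ->] := h3 m mj Pm; exists i => //; rewrite mem_iota.
by rewrite mem_iota add0n /= => /h1 [<- ?] ->; rewrite eqxx.
Qed.

Lemma count_xyz j x y a :
  count (fun m : 'X_{1..4} => [&& m i0 == x, m i1 == y & m i2 < a]%N) (monos 4 j)
  = minn a (j.+1 - (x + y)).
Proof.
apply: (@count_monos _ _ _ (fun i => mono4 x y i (j - (x + y) - i))).
- move=> i lt; have [E0 E1 E2 E3] := mono4E x y i (j - (x + y) - i).
  rewrite mdeg4 E0 E1 E2 E3 !eqxx /=; split; lia.
- move=> i i' _ _ E; have [_ _ <- _] := mono4E x y i (j - (x + y) - i).
  by rewrite E; have [_ _ -> _] := mono4E x y i' (j - (x + y) - i').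
move=> m; rewrite mdeg4 => mj /and3P [/eqP h0 /eqP h1 h2].
exists (m i2); first by lia.
have [E0 E1 E2 E3] := mono4E x y (m i2) (j - (x + y) - m i2).
by apply: mnm4P; rewrite ?E0 ?E1 ?E2 ?E3 //; lia.
Qed.

Lemma count_xyt j x y a :
  count (fun m : 'X_{1..4} => [&& m i0 == x, m i1 == y & m i3 < a]%N) (monos 4 j)
  = minn a (j.+1 - (x + y)).
Proof.
apply: (@count_monos _ _ _ (fun i => mono4 x y (j - (x + y) - i) i)).
- move=> i lt; have [E0 E1 E2 E3] := mono4E x y (j - (x + y) - i) i.
  rewrite mdeg4 E0 E1 E2 E3 !eqxx /=; split; lia.
- move=> i i' _ _ E; have [_ _ _ <-] := mono4E x y (j - (x + y) - i) i.
  by rewrite E; have [_ _ _ ->] := mono4E x y (j - (x + y) - i') i'.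
move=> m; rewrite mdeg4 => mj /and3P [/eqP h0 /eqP h1 h2].
exists (m i3); first by lia.
have [E0 E1 E2 E3] := mono4E x y (j - (x + y) - m i3) (m i3).
by apply: mnm4P; rewrite ?E0 ?E1 ?E2 ?E3 //; lia.
Qed.

Lemma count_or j (P P1 P2 : pred 'X_{1..4}) :
  (forall m, mdeg m = j -> P m = P1 m || P2 m) ->
  (forall m, mdeg m = j -> ~~ (P1 m && P2 m)) ->
  count P (monos 4 j) = (count P1 (monos 4 j) + count P2 (monos 4 j))%N.
Proof.
move=> hP hd; rewrite -count_predUI.
rewrite [X in (_ + X)%N](_ : _ = 0%N) ?addn0; last first.
  apply/eqP; rewrite -leqn0 leqNgt -has_count; apply/hasPn => m.
  by rewrite mem_monos => /eqP /hd.
by apply: eq_in_count => m; rewrite mem_monos => /eqP /hP.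
Qed.

Definition plane_std d : pred 'X_{1..4} := fun m => (m i0 == 0%N) && (m i1 < d)%N.

Lemma count_plane j d :
  count (plane_std d) (monos 4 j) = (\sum_(i < d) (j.+1 - i))%N.
Proof.
elim: d => [|d IH].
  by rewrite big_ord0; apply/eqP; rewrite -leqn0 leqNgt -has_count; apply/hasPn => m _; rewrite /plane_std ltn0 andbF.
rewrite big_ord_recr /= -IH.
(* The bound [m i2 < j.+1] always holds in degree j; it brings the slice y = d into the form of
   [count_xyz]. *)
rewrite (@count_or j _ (plane_std d) (fun m => [&& m i0 == 0%N, m i1 == d & m i2 < j.+1]%N)).
- by rewrite count_xyz add0n; congr (_ + _)%N; lia.
- by move=> m; rewrite mdeg4 /plane_std; lia.
by move=> m _; rewrite /plane_std; lia.
Qed.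

End FourVariables.

(** * Degrees from Hilbert functions, and hdeg in dimension two *)

Section Degrees.
Variables (K : fieldType) (n : nat) (M : gmod K n).

(** Each of the [d] summands is eventually linear in j with slope 1, and [a] only changes the
    constant term. *)
Lemma is_deg_dim2 (d a j0 : nat) : mod_dim M 2 ->
  (forall j, (j0 <= j)%N -> hilbert_fun M j%:Z (\sum_(i < d) (j.+1 - i) + a)%N) ->
  is_deg M d.
Proof.
move=> dM hM; pose p : {poly rat} := \sum_(i < d) ('X + (1 - i%:R)%:P) + a%:R%:P.
have sz (c : rat) : (size ('X + c%:P)%R <= 2)%N.
  by rewrite (leq_trans (size_polyD _ _)) // size_polyX geq_max /= (leq_trans (size_polyC_leq1 _)).
apply: (@DegHilbert _ _ M 1 d p) => //.
(* From [d] on, the truncated differences [j.+1 - i] are true ones. *)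
- exists (maxn j0 d) => j; rewrite geq_max => /andP[j0j dj].
  exists (\sum_(i < d) (j.+1 - i) + a)%N; first exact: hM.
  rewrite hornerD hornerC horner_sum natrD natr_sum; congr (_ + _); apply: eq_bigr => i _.
  rewrite natrB; last by have := ltn_ord i; lia.
  by rewrite hornerD hornerX hornerC -natr1 addrA.
- rewrite (leq_trans (size_polyD _ _)) // geq_max (leq_trans (size_polyC_leq1 _)) // andbT.
  by apply: (leq_trans (size_sum _ _ _)); apply/bigmax_leqP => i _.
rewrite divr1 coefD coefC addr0 coef_sum.
under eq_bigr do rewrite coefD coefX coefC addr0.
by rewrite sumr_const card_ord.
Qed.

Lemma is_deg_dim1 (a j0 : nat) : mod_dim M 1 ->
  (forall j, (j0 <= j)%N -> hilbert_fun M j%:Z a) -> is_deg M a.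
Proof.
move=> dM hM; apply: (@DegHilbert _ _ M 0 a a%:R%:P) => //.
- by exists j0 => j /hM h; exists a; rewrite ?hornerE.
- by rewrite size_polyC_leq1.
by rewrite coefC divr1.
Qed.

(** In dimension 2 both binomial weights, binom(1,0) and binom(1,1), are 1. *)
Lemma hdeg_dim2 e h0 h1 F : is_gmod M -> mod_dim M 2 -> is_deg M e ->
  is_free_resolution (M := M) F -> is_hdeg (ext_mod F n) h0 -> is_hdeg (ext_mod F (n - 1)) h1 ->
  is_hdeg M (e + (h0 + h1))%N.
Proof.
move=> gM dM eM rF H0 H1.
have := HdegRec (E := fun i : 'I_2 => ext_mod F (n - i)) (h := fun i : 'I_2 => if i == ord0 then h0 else h1) gM dM eM.
rewrite big_ord_recl big_ord1 /= bin0 bin1 !mul1n; apply.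
  by move=> i; exists F.
by case=> [[|[|//]] lt] /=; rewrite ?subn0.
Qed.

End Degrees.

(** * Ext modules along the filtration of S/I^lex *)

Section LexFiltration.
Variables (K : fieldType) (d a : nat).
Local Notation S := {mpoly K[4]}.

Lemma powQ4 alpha r (m : 'X_{1..4}) : powQ alpha r m =
  [|| (0 < r)%N && (alpha 0%N <= m i0)%N, (1 < r)%N && (alpha 1%N <= m i1)%N,
      (2 < r)%N && (alpha 2%N <= m i2)%N | (3 < r)%N && (alpha 3%N <= m i3)%N].
Proof.
apply/existsP/idP => [[i]|].
  by move: i; apply: ord4P => /= ->; rewrite ?orbT.
by case/or4P => h; [exists i0 | exists i1 | exists i2 | exists i3].
Qed.

Lemma lem4 (m m' : 'X_{1..4}) : (m <= m')%MM =
  [&& m i0 <= m' i0, m i1 <= m' i1, m i2 <= m' i2 & m i3 <= m' i3]%N.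
Proof.
apply/mnm_lepP/idP => [h|/and4P [h0 h1 h2 h3]]; first by rewrite !h.
exact: ord4P.
Qed.

Definition line_exp k := nth 0%N [:: 1; 1; a]%N k.
Definition plane_exp k := nth 0%N [:: 1; d]%N k.

(* The standard monomials of (x, y^(d+1), y^d z^a), the saturation of the
   lexicographic ideal. *)
Definition sat_std : pred 'X_{1..4} :=
  fun m => (m i0 == 0%N) && ((m i1 < d)%N || ((m i1 == d) && (m i2 < a)%N)).

Lemma sat_upclosed : upclosed (predC sat_std).
Proof. by move=> m k; rewrite /= /sat_std !mnmDE; lia. Qed.

(* The invariant of the filtration of S / I^lex: a further factor K(-j)
   lengthens Ext^4 by one and does not change Ext^3. *)
Definition lex_like (Q : pred 'X_{1..4}) (l : nat) : Prop :=
  exists F : resolution_data K 4 1,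
  [/\ is_free_resolution (M := quot_mod (monid Q)) F,
      is_zero_gmod (ext_mod F 5),
      exists e u, cyclic_gmod (E := ext_mod F 3) (monid (powQ line_exp 3)) e u
    & exists s, [/\ size s = l,
        forall v, @num K 4 (ext_mod F 4) v <-> spanD (@den K 4 (ext_mod F 4)) s v
      & socle_chain (@den K 4 (ext_mod F 4)) s]].

Lemma lex_like_sat : lex_like (predC sat_std) 0.
Proof.
have [F [rF zF _]] := @koszul_resolution K 4 plane_exp 2 isT.
have [G [rG zG [e [u cu]]]] := @koszul_resolution K 4 line_exp 3 isT.
(* The splitting monomial is y^d: adding it to the saturation gives (x, y^d), and the colon ideal is
   (x, y, z^a). *)
have q2 k : powQ plane_exp 2 k = predC sat_std k || (U_(i1) *+ d <= k)%MM.
  by rewrite powQ4 lem_pow /= /sat_std /plane_exp /=; lia.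
have q1 k : predC sat_std (U_(i1) *+ d + k)%MM = powQ line_exp 3 k.
  by rewrite powQ4 /= /sat_std /line_exp !mnmDE !mulmnE !mnm1E /=; lia.
have := monomial_extension sat_upclosed (@powQ_upclosed 4 plane_exp 2) q2 q1 rF rG.
set H := push_resolution _ _ _; case=> theta [h1 h2 cH rH].
have cF := free_resolution_complex rF.
have zH i : i != 3 -> is_zero_gmod (ext_mod H i) by exact: zG.
exists (splice theta); split=> //.
- by apply: splice_ext_zero => //; [exact: zF | exact: zH].
- have [||v hv] := splice_ext_cyclic_r cF cH h1 h2 _ _ (push_ext_cyclic _ _ cu).
  + exact: zF.
  + exact: zF.
  by exists (e - (mdeg (U_(i1) *+ d)%MM)%:Z), (row_mx v u).
exists [::]; split=> // v; split=> [hv|].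
  by apply: (splice_ext_zero h2) hv; [exact: zF | exact: zH].
exact: (ext_den_num (free_resolution_complex rH)).
Qed.

(** Each multiple of [m] by a variable already lies in the smaller ideal, so the new factor is a
    shift of K, with Ext^4 only. Vanishing of its Ext^2 and Ext^3 preserves Ext^3 and embeds the old
    Ext^4; vanishing of the old Ext^5 lets Ext^4(K) lift. *)
Lemma lex_like_step Q m s l : upclosed (adjoin Q (m :: s)) -> upclosed (adjoin Q s) ->
  ~~ Q m -> m \notin s -> lex_like (adjoin Q (m :: s)) l -> lex_like (adjoin Q s) l.+1.
Proof.
move=> u2 u1 Qm ms [F [rF zF [e [u cu]] [t [st Zt gt]]]].
have [G [rG zG [e' [u' cu']]]] := @koszul_resolution K 4 (fun=> 1%N) 4 isT.
have memE k : adjoin Q (m :: s) k = adjoin Q s k || (k == m).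
  by rewrite /adjoin inE orbCA orbC.
have q2 k : adjoin Q (m :: s) k = adjoin Q s k || (m <= k)%MM.
  apply/idP/idP => [|/orP[h|mk]]; rewrite ?memE.
  - by case/orP => [->//|/eqP ->]; rewrite lepm_refl orbT.
  - by rewrite h.
  by rewrite -memE -(submK mk) addmC; apply: u2; rewrite memE eqxx orbT.
have q1 k : adjoin Q s (m + k)%MM = powQ (fun=> 1%N) 4 k.
  rewrite powQ4 /=.
  have [->|nk] := eqVneq k 0%MM.
    by rewrite addm0 !mnm0E /= /adjoin (negbTE Qm) (negbTE ms).
  have : adjoin Q (m :: s) (m + k)%MM by apply: u2; rewrite memE eqxx orbT.
  rewrite memE => /orP[->|/eqP E].
    by apply/esym; move: nk; rewrite -mdeg_eq0 mdeg4; lia.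
  by case/eqP: nk; apply: (@addmI _ m); rewrite addm0.
have := monomial_extension u1 u2 q2 q1 rF rG.
set H := push_resolution _ _ _; case=> theta [h1 h2 cH rH].
have cF := free_resolution_complex rF.
have zH i : i != 4 -> is_zero_gmod (ext_mod H i) by exact: zG.
exists (splice theta); split=> //.
- by apply: splice_ext_zero => //; exact: zH.
- exists e, (row_mx u 0); apply: (splice_ext_cyclic_l h2) cu; exact: zH.
have cu1 : cyclic_gmod (E := ext_mod H 4) (monid (fun m => m != 0%MM)) (e' - (mdeg m)%:Z) u'.
  apply: eq_cyclic_gmod (push_ext_cyclic _ _ cu') => p.
  by split=> h k /h; rewrite powQ4 /= -mdeg_eq0 mdeg4; lia.
have [||s' [E1 E2 E3]] := splice_ext_chain cF cH h1 h2 _ _ cu1 Zt gt => //.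
  exact: zH.
by exists s'; rewrite E1 st.
Qed.

(** Monomials leave the ideal from the lowest degree upwards, so that it stays closed under
    multiplication at each step. *)
Lemma lex_like_adjoin Q s l : upclosed Q -> uniq s ->
  sorted (fun m m' => mdeg m <= mdeg m')%N s -> (forall m, m \in s -> ~~ Q m) ->
  upclosed (adjoin Q s) -> lex_like (adjoin Q s) l -> lex_like Q (l + size s).
Proof.
move=> uQ; elim: s l => [|m s IH] l /=.
  move=> _ _ _ _; rewrite addn0; congr lex_like.
  by apply: functional_extensionality => m; rewrite /adjoin orbF.
case/andP=> ms us; rewrite (path_sortedE (leT := fun m m' => mdeg m <= mdeg m')%N); last first.
  by move=> x y z; apply: leq_trans.
case/andP=> /allP lem ss hQ uQs.
have Qm : ~~ Q m by apply: hQ; rewrite mem_head.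
have uQs' : upclosed (adjoin Q s) by apply: upclosed_behead uQs uQ Qm ms lem.
move=> h; rewrite addnS -addSn; apply: IH => //.
  by move=> k ks; apply: hQ; rewrite in_cons ks orbT.
exact: lex_like_step h.
Qed.

(** The module is a shift of S/(x, y, z^a): dimension 1, degree [a], and the Koszul resolution of
    three elements has no Ext^4. *)
Lemma hdeg_line (F : resolution_data K 4 1) i e u : is_complex_data F -> (0 < a)%N ->
  cyclic_gmod (E := ext_mod F i) (monid (powQ line_exp 3)) e u ->
  is_hdeg (ext_mod F i) a.
Proof.
move=> cF a0 cE; set E := ext_mod F i.
have sN : is_submod (@num K 4 E) := ext_num_submod F i.
have sD : is_submod (@den K 4 E) := ext_den_submod F i.
have uQ := @powQ_upclosed 4 line_exp 3.
have dE : mod_dim E 1.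
  apply: (mod_dim_cyclic sD (@monid_ideal K 4 _ uQ) cE).
  pose A := [set i0; i1; i2].
  have cA : #|~: A| = 1%N by rewrite cardsCs setCK card_ord /A -setUA !cardsU1 cards1 !inE.
  rewrite -[X in ring_dim _ X]cA.
  apply: ring_dim_vars => [p hp|k].
    apply/kill_vars_eq0 => m /hp; rewrite powQ4 /= /line_exp /= orbF.
    by case/or3P => h; [exists i0 | exists i1 | exists i2]; rewrite ?inE ?eqxx ?orbT //; lia.
  rewrite !inE => kA; exists (maxn 1 a); rewrite mpolyXn; apply/monidX.
  rewrite powQ4 /= /line_exp /= !mulmnE !mnm1E.
  by case/orP: kA => [/orP[]|] /eqP ->; rewrite /= !mul1n; lia.
have [G [rG zG _]] := @koszul_resolution K 4 line_exp 3 isT.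
have rH : is_free_resolution (M := E) (push_resolution e u G).
  exact: push_free_resolution sN sD cE rG.
have degE : is_deg E a.
  (* From [a + absz e] on, j - e is at least [a], so that the minimum in [count_xyz] is [a]. *)
  apply: (@is_deg_dim1 K 4 E a (a + absz e)) => // j le.
  have -> : j%:Z = (absz (j%:Z - e)%R)%:Z + e by lia.
  apply: (hilbert_cyclic sN sD _ cE); first by move=> e' w; apply: ext_den_vcomp.
  have := @hilbert_monid K 4 (powQ line_exp 3) (absz (j%:Z - e)%R) uQ.
  rewrite (eq_count (a2 := fun m : 'X_{1..4} => [&& m i0 == 0, m i1 == 0 & m i2 < a]%N)).
    by rewrite count_xyz (minn_idPl _) //; lia.
  by move=> m; rewrite /= powQ4 /= /line_exp /=; lia.
have := HdegRec (E := fun _ : 'I_1 => ext_mod (push_resolution e u G) 4) (h := fun=> 0%N)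
  (is_gmod_ext cF i) dE degE.
rewrite big1 ?addn0 => [|k _]; last by rewrite muln0.
apply=> [k|k]; first by exists (push_resolution e u G) => //; rewrite ord1.
by apply: HdegZero; [exact: is_gmod_ext (free_resolution_complex rH) _ | exact: zG].
Qed.

Lemma mod_dim_quot n (J : {mpoly K[n]} -> Prop) r :
  is_ideal J -> ring_dim J r -> mod_dim (quot_mod J) r.
Proof.
move=> iJ; apply: eq_ring_dim => p; split=> [Jp v _|/(_ (const_mx 1) I)] /=.
  by rewrite mxE mulrC; apply: idealM.
by rewrite !mxE mulr1.
Qed.

Lemma ring_dim_plane (J : S -> Prop) N :
  (forall p, J p -> forall m, m \in msupp p -> (m i0 != 0%N) || (m i1 != 0%N)) ->
  J ('X_i0 ^+ N) -> J ('X_i1 ^+ N) -> ring_dim J 2.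
Proof.
move=> hJ J0 J1; pose A := [set i0; i1].
have cA : #|~: A| = 2%N by rewrite cardsCs setCK card_ord /A cards2.
rewrite -[X in ring_dim _ X]cA.
apply: ring_dim_vars => [p /hJ hp|k].
  apply/kill_vars_eq0 => m /hp /orP[h|h]; [exists i0|exists i1] => //.
    by rewrite !inE.
  by rewrite !inE.
by rewrite !inE => /orP[] /eqP ->; exists N.
Qed.

Lemma is_gmod_quot n (J : {mpoly K[n]} -> Prop) : is_ideal J ->
  (forall e p, J p -> J (hcomp e p)) -> is_gmod (quot_mod J).
Proof.
move=> iJ hJ; apply: is_gmod_intro => //=; first exact: is_ideal_submod.
by move=> e w Jw; rewrite mxE; apply: hJ.
Qed.

Lemma hdeg_lex_like Q l N j0 : upclosed Q -> (0 < a)%N -> (0 < l)%N -> lex_like Q l ->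
  (forall m, Q m -> (m i0 != 0%N) || (m i1 != 0%N)) ->
  Q (U_(i0) *+ N)%MM -> Q (U_(i1) *+ N)%MM ->
  (forall j, (j0 <= j)%N ->
     count (predC Q) (monos 4 j) = (\sum_(i < d) (j.+1 - i) + a)%N) ->
  is_hdeg (quot_mod (@monid K 4 Q)) (d + (l + a))%N.
Proof.
move=> uQ a0 l0 [F [rF zF [e [u cu]] [s [sl Zs gs]]]] hQ Q0 Q1 cQ.
have iQ := @monid_ideal K 4 _ uQ.
have dM : mod_dim (quot_mod (@monid K 4 Q)) 2.
  apply: mod_dim_quot => //; apply: (@ring_dim_plane _ N).
  - by move=> p hp m /hp /hQ.
  - by rewrite mpolyXn; apply/monidX.
  - by rewrite mpolyXn; apply/monidX.
have gM : is_gmod (quot_mod (@monid K 4 Q)).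
  by apply: is_gmod_quot => // e' p; apply: monid_hcomp.
have cF := free_resolution_complex rF.
apply: (hdeg_dim2 gM dM _ rF).
- apply: (is_deg_dim2 (a := a) (j0 := j0) dM) => j /cQ <-; exact: hilbert_monid.
- rewrite -sl; apply: hdeg_socle_chain => //; rewrite ?sl //.
    exact: ext_den_submod.
  exact: is_gmod_ext.
- exact: hdeg_line cF a0 cu.
Qed.

End LexFiltration.

(** * Lexicographic segments *)

Section LexCombinatorics.
Variables (d a : nat).
Implicit Types (m u v : 'X_{1..4}).

(** [u] is lexicographically smaller than [v]; the exponent of t is omitted because it is determined
    in a fixed degree. *)
Definition lex4 u v : bool :=
  (u i0 < v i0)%N || (u i0 == v i0) && ((u i1 < v i1)%N || (u i1 == v i1) && (u i2 < v i2)%N).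

Lemma lex4_irr m : lex4 m m = false. Proof. rewrite /lex4; lia. Qed.

Lemma lex4_total u v : mdeg u = mdeg v -> u != v -> lex4 u v = ~~ lex4 v u.
Proof.
move=> E ne; have : ~~ [&& u i0 == v i0, u i1 == v i1 & u i2 == v i2].
  apply: contraNN ne => /and3P [/eqP h0 /eqP h1 /eqP h2]; apply/eqP/mnm4P => //.
  by move: E; rewrite !mdeg4; lia.
by rewrite /lex4; lia.
Qed.

Lemma ltm_lex4 u v : mdeg u = mdeg v -> (u < v)%O = lex4 u v.
Proof.
move=> E; apply/(ltmcP E)/idP => [[i hi]|].
  move: i hi; apply: ord4P => h lt; rewrite /lex4.
  - by rewrite lt.
  - by rewrite (h i0) // eqxx lt orbT.
  - by rewrite (h i0) // (h i1) // !eqxx lt !orbT.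
  - have := h i0 isT; have := h i1 isT; have := h i2 isT.
    by move: E; rewrite !mdeg4; lia.
rewrite /lex4; case/orP => [lt|/andP[/eqP e0 /orP[lt|/andP[/eqP e1 lt]]]].
- by exists i0.
- exists i1 => //; apply: ord4P => //.
- exists i2 => //; apply: ord4P => //.
Qed.

Lemma lex_gt_lex4 u v : mdeg u = mdeg v -> lex_gt u v = lex4 v u.
Proof.
move=> E; rewrite -ltm_lex4 //; apply/existsP/(ltmcP (esym E)) => [[i /andP[/forallP h lt]]|[i h lt]].
  by exists i => // j ji; have := h j; rewrite ji => /eqP.
by exists i; rewrite lt andbT; apply/forallP => j; apply/implyP => /h ->.
Qed.

Definition below j m := count (fun u => lex4 u m) (monos 4 j).

Lemma lex_rank_count m : lex_rank m = count (fun u => lex4 m u) (monos 4 (mdeg m)).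
Proof.
rewrite /lex_rank cardsE cardE -size_filter /monos filter_map size_map -filter_predI.
rewrite [X in size X = _]/enum_mem -enumT.
congr size; apply: eq_filter => u /=; rewrite unfold_in.
by case: eqP => [E|_]; rewrite ?andbF //= lex_gt_lex4 // andbC.
Qed.

Lemma below_rank j m : mdeg m = j -> (below j m + lex_rank m).+1 = size (monos 4 j).
Proof.
move=> mj; rewrite lex_rank_count mj.
rewrite -(count_predC (fun u => lex4 u m)) -/(below j m) -addnS; congr addn.
rewrite (@count_or j (predC (fun u => lex4 u m)) (pred1 m) (fun u => lex4 m u)).
- by rewrite count_uniq_mem ?monos_uniq // mem_monos mj eqxx.
- move=> u uj /=; have [->|nu] := eqVneq u m; first by rewrite lex4_irr.
  by rewrite (@lex4_total m u) ?mj // eq_sym.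
by move=> u _ /=; have [->|] := eqVneq u m; rewrite ?lex4_irr.
Qed.

Lemma below_le j m (P : pred 'X_{1..4}) : mdeg m = j -> P m ->
  (forall u, mdeg u = j -> lex4 u m -> P u) -> (below j m < count P (monos 4 j))%N.
Proof.
move=> mj Pm h; rewrite /below -size_filter -size_filter.
apply: (@leq_trans (size (m :: filter (fun u => lex4 u m) (monos 4 j)))) => //.
apply: uniq_leq_size.
  by rewrite /= mem_filter lex4_irr filter_uniq ?monos_uniq.
move=> u; rewrite inE !mem_filter !mem_monos => /orP[/eqP ->|/andP[h1 /eqP h2]].
  by rewrite Pm mj eqxx.
by rewrite h // h2 eqxx.
Qed.

Lemma below_ge j m (P : pred 'X_{1..4}) :
  (forall u, mdeg u = j -> P u -> lex4 u m) -> (count P (monos 4 j) <= below j m)%N.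
Proof.
move=> h; rewrite /below -!size_filter; apply: uniq_leq_size.
  by rewrite filter_uniq ?monos_uniq.
by move=> u; rewrite !mem_filter !mem_monos => /andP[h1 /eqP h2]; rewrite h // h2 eqxx.
Qed.

(** [below j] numbers the monomials of degree j by 0, 1, 2, ... in increasing order, as sorting them
    shows. *)
Lemma count_below j N : (N <= size (monos 4 j))%N ->
  count (fun m => below j m < N)%N (monos 4 j) = N.
Proof.
move=> le; pose s := sort <=%O (monos 4 j).
have ps : perm_eq s (monos 4 j) by rewrite perm_sort.
have us : uniq s by rewrite sort_uniq monos_uniq.
have ss : sorted <%O s by rewrite lt_sorted_uniq_le us sort_le_sorted.
have degs i : (i < size s)%N -> mdeg (nth 0%MM s i) = j.
  by move=> lt; apply/eqP; rewrite -mem_monos -(perm_mem ps) mem_nth.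
have bE i : (i < size s)%N -> below j (nth 0%MM s i) = i.
  move=> lt; rewrite -[RHS](count_lt_nth 0%MM ss lt) /below -(permP ps).
  apply: eq_in_count => u us' /=; rewrite ltm_lex4 //.
  by rewrite degs //; apply/eqP; rewrite -mem_monos -(perm_mem ps).
have Ns : (N <= size s)%N by rewrite (perm_size ps).
rewrite -(permP ps) -[s](mkseq_nth 0%MM) count_map.
rewrite (@eq_in_count _ _ (fun i => i < N)%N) => [|i]; last first.
  by rewrite mem_iota add0n /= => /bE ->.
rewrite -[size s](subnKC Ns) iotaD count_cat add0n.
have -> : count (fun i => i < N)%N (iota 0 N) = N.
  rewrite -[RHS](size_iota 0 N); apply/eqP; rewrite -all_count; apply/allP => i.
  by rewrite mem_iota add0n.
suff -> : count (fun i => i < N)%N (iota N (size s - N)) = 0%N by rewrite addn0.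
apply/eqP; rewrite -leqn0 leqNgt -has_count; apply/hasPn => i.
by rewrite mem_iota -leqNgt => /andP[].
Qed.

(** The fourth generator of I is led by x t^a, not by its other term, so the exponent of z in I does
    not enter the Hilbert function. *)
Definition curve_std : pred 'X_{1..4} :=
  fun m => plane_std d m || [&& m i0 == 1, m i1 == 0 & m i3 < a]%N.

Definition hcurve j := count curve_std (monos 4 j).

Lemma hcurveE j : hcurve j = (\sum_(i < d) (j.+1 - i) + minn a j)%N.
Proof.
rewrite /hcurve -count_plane.
rewrite (@count_or j _ (plane_std d) (fun m => [&& m i0 == 1, m i1 == 0 & m i3 < a]%N)).
- by rewrite count_xyt addn0 subSS subn0.
- by [].
- by move=> m _; rewrite /plane_std; lia.
Qed.

Lemma hcurve_plane j : hcurve j = (count (plane_std d) (monos 4 j) + minn a j)%N.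
Proof. by rewrite hcurveE count_plane. Qed.

Lemma count_sat j : count (sat_std d a) (monos 4 j) =
  (count (plane_std d) (monos 4 j) + minn a (j.+1 - d))%N.
Proof.
rewrite (@count_or j _ (plane_std d) (fun m => [&& m i0 == 0, m i1 == d & m i2 < a]%N)).
- by rewrite count_xyz add0n.
- by move=> m _; rewrite /sat_std /plane_std; lia.
- by move=> m _; rewrite /plane_std; lia.
Qed.

(** From degree j to j + 1 each slot y^i with i < d and i <= j + 1 gains one monomial, and the slot
    x gains one as long as j < a. *)
Lemma hcurveS j : hcurve j.+1 = (hcurve j + minn d j.+2 + (j < a))%N.
Proof.
rewrite !hcurveE.
have -> : (\sum_(i < d) (j.+2 - i) = \sum_(i < d) (j.+1 - i) + minn d j.+2)%N.
  elim: (d) => [|k IH]; first by rewrite !big_ord0 min0n.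
  rewrite !big_ord_recr /= IH; set x := (\sum_(i < k) _)%N.
  clearbody x; lia.
set x := (\sum_(i < d) _)%N; clearbody x; lia.
Qed.

Definition lexQ : pred 'X_{1..4} :=
  fun m => (lex_rank m < count (predC curve_std) (monos 4 (mdeg m)))%N.

(** Counting from below: the monomials outside I^lex are the [hcurve j] smallest ones, since every
    monomial other than [m] counts either in [below] or in [lex_rank]. *)
Lemma lexQE j m : mdeg m = j -> lexQ m = (hcurve j <= below j m)%N.
Proof.
move=> mj; have := below_rank mj; have := count_predC curve_std (monos 4 j).
by rewrite /lexQ mj -/(hcurve j); lia.
Qed.

Lemma count_lexQ j : count (predC lexQ) (monos 4 j) = hcurve j.
Proof.
rewrite -[RHS](@count_below j); last by rewrite /hcurve count_size.
by apply: eq_in_count => m; rewrite mem_monos => /eqP mj; rewrite /= (lexQE mj) ltnNge.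
Qed.

Hypotheses (d1 : (0 < d)%N) (da : (d <= a.+1)%N).

(** In each degree the standard monomials of the saturation form a segment of smallest monomials,
    with at most [hcurve j] elements. *)
Lemma sat_lexQ m : sat_std d a m -> ~~ lexQ m.
Proof.
move=> sm; rewrite (lexQE (erefl (mdeg m))) -ltnNge.
have : (below (mdeg m) m < count (sat_std d a) (monos 4 (mdeg m)))%N.
  apply: below_le => // u E; rewrite /sat_std /lex4 in sm *; lia.
by rewrite count_sat hcurve_plane; lia.
Qed.

(** A monomial violating one of the bounds lies, with all smaller ones, in a segment of at most
    [hcurve j] elements. The bounds are those that put the new monomials without t below t m in
    [below_mul_t]. *)
Lemma lexQ_bounds j m : mdeg m = j -> lexQ m ->
  [/\ (m i0 == 0%N) ==> (d <= m i1)%N,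
      (j < a)%N && (m i0 == 0%N) ==> (d < m i1)%N
    & (j < a)%N && (j.+1 < d)%N ==> ((1 < m i0)%N || (0 < m i1)%N)].
Proof.
move=> mj; rewrite (lexQE mj) => le; split; apply/implyP => h; apply: contraT => nh.
- have := @below_le j m (plane_std d) mj; rewrite hcurve_plane in le.
  have -> : plane_std d m by rewrite /plane_std; lia.
  have H u : mdeg u = j -> lex4 u m -> plane_std d u by rewrite /plane_std /lex4; lia.
  by move=> /(_ isT H); lia.
- have := @below_le j m (fun u => plane_std d u || [&& u i0 == 0, u i1 == d & u i2 < (m i2).+1]%N) mj.
  rewrite (@count_or j _ (plane_std d) (fun u => [&& u i0 == 0, u i1 == d & u i2 < (m i2).+1]%N)) //; last first.
    by move=> u _; rewrite /plane_std; lia.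
  rewrite count_xyz hcurve_plane in le *.
  have -> : plane_std d m || [&& m i0 == 0, m i1 == d & m i2 < (m i2).+1]%N by rewrite /plane_std; lia.
  have H u : mdeg u = j -> lex4 u m ->
      plane_std d u || [&& u i0 == 0, u i1 == d & u i2 < (m i2).+1]%N.
    by rewrite /plane_std /lex4; lia.
  by move=> /(_ isT H); lia.
have := @below_le j m (fun u => plane_std d u || [&& u i0 == 1, u i1 == 0 & u i2 < (m i2).+1]%N) mj.
rewrite (@count_or j _ (plane_std d) (fun u => [&& u i0 == 1, u i1 == 0 & u i2 < (m i2).+1]%N)) //; last first.
  by move=> u _; rewrite /plane_std; lia.
rewrite count_xyz hcurve_plane in le *.
have -> : plane_std d m || [&& m i0 == 1, m i1 == 0 & m i2 < (m i2).+1]%N.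
  by move: mj; rewrite /plane_std mdeg4; lia.
have H u : mdeg u = j -> lex4 u m ->
    plane_std d u || [&& u i0 == 1, u i1 == 0 & u i2 < (m i2).+1]%N.
  by rewrite /plane_std /lex4 mdeg4; lia.
by move=> /(_ isT H); lia.
Qed.

Lemma upclosed_var n (Q : pred 'X_{1..n}) :
  (forall (m : 'X_{1..n}) i, Q m -> Q (m + U_(i))%MM) -> upclosed Q.
Proof.
move=> h m k; elim: {k}(mdeg k) {-2}k (erefl (mdeg k)) m => [|j IH] k kj m Qm.
  by move/eqP: kj; rewrite mdeg_eq0 => /eqP ->; rewrite addm0.
have [i ki] : exists i, k i != 0%N.
  apply/existsP; apply: contra_eqT kj; rewrite negb_exists => /forallP hk.
  by rewrite mdegE big1 // => i _; apply/eqP; have := hk i; rewrite negbK.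
have E : k = ((k - U_(i)) + U_(i))%MM by rewrite submK // lep1mP.
have kj' : mdeg (k - U_(i))%MM = j.
  by apply/eqP; rewrite -eqSS -kj {2}E mdegD mdeg1 addn1.
by rewrite E addmA; apply: h; apply: IH.
Qed.

(* Multiplication by t embeds the monomials below m into those below t m; the
   latter also contain one monomial without t in each smaller slot x^i y^j. *)
Lemma below_mul_t j m : mdeg m = j -> lexQ m ->
  (below j m + minn d j.+2 + (j < a) <= below j.+1 (m + U_(i3))%MM)%N.
Proof.
move=> mj Qm; have [b1 b2 b3] := lexQ_bounds mj Qm.
pose s1 := map (fun u => (u + U_(i3))%MM) (filter (fun u => lex4 u m) (monos 4 j)).
pose s2 := map (fun i => mono4 0 i (j.+1 - i) 0) (iota 0 (minn d j.+2)).
(* The additional monomial for j < a sits in the slot after those of [s2]: this is y^d if degree j +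
   1 allows it, and otherwise all slots y^i are used up and x z^j comes next. *)
pose ex := if (d <= j.+1)%N then mono4 0 d (j.+1 - d) 0 else mono4 1 0 j 0.
pose s3 := nseq (j < a)%N ex.
have -> : (below j m + minn d j.+2 + (j < a) = size (s1 ++ s2 ++ s3))%N.
  by rewrite !size_cat !size_map size_filter size_iota size_nseq addnA.
rewrite /below -size_filter; apply: uniq_leq_size.
  have U3 (u : 'X_{1..4}) : (u + U_(i3))%MM i3 = (u i3).+1 by rewrite mnmDE mnm1E addn1.
  have t2 u : u \in s2 ++ s3 -> u i3 = 0%N.
    rewrite mem_cat => /orP[/mapP [i _ ->]|]; first by have [] := mono4E 0 i (j.+1 - i) 0.
    rewrite mem_nseq => /andP[_ /eqP ->]; rewrite /ex.
    by case: ifP => _; [have [] := mono4E 0 d (j.+1 - d) 0 | have [] := mono4E 1 0 j 0].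
  rewrite cat_uniq; apply/and3P; split.
  - by rewrite map_inj_uniq ?filter_uniq ?monos_uniq //; apply: addIm.
  - apply/hasPn => u /t2 u0; apply/mapP => -[v _ E]; by rewrite E U3 in u0.
  rewrite cat_uniq; apply/and3P; split.
  - rewrite map_inj_in_uniq ?iota_uniq // => i i' _ _ E.
    have [_ <- _ _] := mono4E 0 i (j.+1 - i) 0; rewrite E.
    by have [_ -> _ _] := mono4E 0 i' (j.+1 - i') 0.
  - apply/hasPn => u; rewrite mem_nseq => /andP[_ /eqP ->]; apply/mapP => -[i].
    rewrite mem_iota add0n /= /ex => hi; case: ifP => hd E.
      have [_ E1 _ _] := mono4E 0 d (j.+1 - d) 0; have [_ E1' _ _] := mono4E 0 i (j.+1 - i) 0.
      by move: E1; rewrite E E1'; lia.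
    have [E1 _ _ _] := mono4E 1 0 j 0; have [E1' _ _ _] := mono4E 0 i (j.+1 - i) 0.
    by move: E1; rewrite E E1'.
  by rewrite /s3; case: (j < a)%N.
have [U0 U1 U2 U3] : [/\ U_(i3)%MM i0 = 0, U_(i3)%MM i1 = 0, U_(i3)%MM i2 = 0 & U_(i3)%MM i3 = 1]%N.
  by rewrite !mnm1E.
move=> u; rewrite mem_filter mem_monos !mem_cat => /or3P[/mapP [v]|/mapP [i]|].
- rewrite mem_filter mem_monos => /andP[vm /eqP vj] ->.
  rewrite mdegD vj mdeg1 addn1 eqxx andbT; move: vm.
  by rewrite /lex4 !mnmDE U0 U1 U2 !addn0.
- rewrite mem_iota add0n /= => hi ->; have [E0 E1 E2 E3] := mono4E 0 i (j.+1 - i) 0.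
  by rewrite /lex4 mdeg4 !mnmDE E0 E1 E2 E3 U0 U1 U2; lia.
rewrite mem_nseq => /andP[ja /eqP ->]; rewrite /ex; case: ifP => hd.
  have [E0 E1 E2 E3] := mono4E 0 d (j.+1 - d) 0.
  by rewrite /lex4 mdeg4 !mnmDE E0 E1 E2 E3 U0 U1 U2; lia.
have [E0 E1 E2 E3] := mono4E 1 0 j 0.
have : (m i1 <= j)%N by rewrite -mj mdeg4; lia.
by rewrite /lex4 mdeg4 !mnmDE E0 E1 E2 E3 U0 U1 U2; lia.
Qed.

(** Among the X_i m the smallest is t m, and the growth of [below] from m to t m is at least that of
    [hcurve]. *)
Lemma lexQ_upclosed : upclosed lexQ.
Proof.
apply: upclosed_var => m i Qm; set j := mdeg m.
have mj (k : 'I_4) : mdeg (m + U_(k))%MM = j.+1 by rewrite mdegD mdeg1 addn1.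
rewrite (lexQE (mj i)) hcurveS.
have le := below_mul_t (erefl j) Qm.
have hm : (hcurve j <= below j m)%N by rewrite -lexQE.
apply: leq_trans (_ : below j.+1 (m + U_(i3))%MM <= _)%N; first by lia.
apply: below_ge => u uj; move: i; apply: ord4P; rewrite /lex4 !mnmDE !mnm1E /=; lia.
Qed.

End LexCombinatorics.

(** * The quotient of the saturation by I^lex, and hdeg S/I^lex *)

Section LexHdeg.
Variables (K : fieldType) (d a : nat).
Hypotheses (d2 : (1 < d)%N) (da : (d <= a.+1)%N).
Let d1 : (0 < d)%N := ltnW d2.
Local Notation lexQ := (lexQ d a).

Definition socle_mono : pred 'X_{1..4} := fun m => ~~ lexQ m && ~~ sat_std d a m.

Lemma count_socle j :
  (count socle_mono (monos 4 j) + minn a (j - d.-1) = minn a j)%N.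
Proof.
have := count_lexQ d a j; rewrite hcurve_plane.
rewrite (@count_or j _ (sat_std d a) socle_mono).
- by rewrite count_sat; lia.
- move=> m _; rewrite /socle_mono /=; case: (boolP (sat_std d a m)) => [/(sat_lexQ d1 da) ->|_] //.
  by rewrite andbT.
by move=> m _; rewrite /socle_mono; case: (sat_std d a m); rewrite ?andbF.
Qed.

(** Raising [e] by one delays the sequence by one place, so only its last term drops out of the
    sum. *)
Lemma sum_minn T e : (\sum_(j < T) minn a (j - e) =
  \sum_(j < T) minn a (j - e.+1) + minn a (T - e.+1))%N.
Proof.
elim: T => [|T IH]; first by rewrite !big_ord0 sub0n minn0.
rewrite !big_ord_recr /= IH; set x := (\sum_(j < T) _)%N; clearbody x; lia.
Qed.

Definition mono_list (P : pred 'X_{1..4}) T := flatten (mkseq (fun j => filter P (monos 4 j)) T).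

Lemma mono_listP P T : [/\ forall m, m \in mono_list P T = P m && (mdeg m < T)%N,
  uniq (mono_list P T) & size (mono_list P T) = (\sum_(j < T) count P (monos 4 j))%N].
Proof.
elim: T => [|T [hm hu hs]]; first by split=> [m||]; rewrite ?big_ord0 ?andbF.
have -> : mono_list P T.+1 = mono_list P T ++ filter P (monos 4 T).
  by rewrite /mono_list mkseqS flatten_rcons.
split.
- by move=> m; rewrite mem_cat hm mem_filter mem_monos -andb_orr ltnS (leq_eqVlt (mdeg m)) orbC.
- rewrite cat_uniq hu filter_uniq ?monos_uniq // andbT; apply/hasPn => m.
  by rewrite mem_filter mem_monos => /andP[_ /eqP mT]; rewrite hm mT ltnn andbF.
by rewrite size_cat hs size_filter big_ord_recr.
Qed.

Lemma hdeg_lexQ : is_hdeg (quot_mod (@monid K 4 lexQ)) (d + a * d)%N.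
Proof.
(* By [count_socle] the monomials of [socle_mono] have degree below a + d - 1; with this [T] each of
   the d - 1 terms split off by [sum_minn] equals [a]. *)
pose T := (a + d)%N; pose s0 := mono_list socle_mono T.
have [ms0 us0 ss0] := mono_listP socle_mono T.
pose s := sort (fun m m' : 'X_{1..4} => mdeg m <= mdeg m')%N s0.
have us : uniq s by rewrite sort_uniq.
have ss : sorted (fun m m' : 'X_{1..4} => mdeg m <= mdeg m')%N s.
  by apply: sort_sorted => x y; apply: leq_total.
have uQ := lexQ_upclosed d1 da.
have adjE : adjoin lexQ s = predC (sat_std d a).
  apply: functional_extensionality => m; rewrite /adjoin mem_sort ms0 /socle_mono /=.
  have [sm|nm] /= := boolP (sat_std d a m); first by rewrite (negbTE (sat_lexQ d1 da sm)) andbF.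
  rewrite andbT; case: (boolP (lexQ m)) => //= Qm; apply: contraT; rewrite -leqNgt => le.
  have := count_socle (mdeg m); suff : (0 < count socle_mono (monos 4 (mdeg m)))%N by lia.
  rewrite -has_count; apply/hasP; exists m; first by rewrite mem_monos.
  by rewrite /socle_mono Qm nm.
have sz : size s = (a * d.-1)%N.
  rewrite size_sort ss0.
  have E e : (e <= d.-1)%N -> (\sum_(j < T) minn a (j - 0) = \sum_(j < T) minn a (j - e) + a * e)%N.
    elim: e => [|e IH] le; first by rewrite muln0 addn0.
    rewrite IH ?(ltnW le) // sum_minn -addnA; congr addn; rewrite mulnS; congr addn.
    by apply/minn_idPl; rewrite /T; lia.
  have := E _ (leqnn _); have -> : (\sum_(j < T) minn a (j - 0) =
     \sum_(j < T) count socle_mono (monos 4 j) + \sum_(j < T) minn a (j - d.-1))%N.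
    by rewrite -big_split; apply: eq_bigr => j _; rewrite subn0 /= count_socle.
  by rewrite addnC => /addnI.
have L : lex_like K a lexQ (a * d.-1).
  rewrite -sz -[size s]add0n; apply: lex_like_adjoin => //.
  - by move=> m; rewrite mem_sort ms0 => /andP[/andP[]].
  - by rewrite adjE; exact: sat_upclosed.
  - by rewrite adjE; exact: lex_like_sat.
have -> : (d + a * d = d + (a * d.-1 + a))%N by rewrite -mulnSr prednK.
(* In degree [T] the saturation and I have equally many standard monomials, and those of the
   saturation are all smaller than x^T and y^T. *)
have powN (i : 'I_4) : ((i == i0) || (i == i1)) -> lexQ (U_(i) *+ T)%MM.
  move=> hi; have degT : mdeg (U_(i) *+ T)%MM = T by rewrite mdegMn mdeg1 mul1n.
  rewrite (lexQE _ _ degT); apply: leq_trans (_ : count (sat_std d a) (monos 4 T) <= _)%N.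
    by rewrite count_sat hcurve_plane /T; lia.
  apply: below_ge => u uT; rewrite /sat_std /lex4 !mulmnE !mnm1E.
  by case/orP: hi => /eqP -> /=; rewrite /T; lia.
apply: (@hdeg_lex_like K d a lexQ _ T a) => //; try lia.
- by rewrite muln_gt0; lia.
- move=> m Qm; apply: contraLR Qm; rewrite negb_or !negbK => /andP[/eqP h0 /eqP h1].
  by apply: (sat_lexQ d1 da); rewrite /sat_std h0 h1 d1.
- exact: powN.
- exact: powN.
move=> j aj; rewrite count_lexQ hcurveE; congr addn; exact/minn_idPl.
Qed.

Lemma lex_ideal_lexQ (J : {mpoly K[4]} -> Prop) :
  (forall j, hilbert_fun (ideal_mod J) j%:Z (count (predC (curve_std d a)) (monos 4 j))) ->
  lex_ideal J = @monid K 4 lexQ.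
Proof.
move=> hJ; apply: functional_extensionality => p; apply: propositional_extensionality.
split=> h m /h; last by move=> Qm; exists (count (predC (curve_std d a)) (monos 4 (mdeg m))).
case=> k hk; rewrite /lexQ.
by rewrite (hilbert_fun_inj (M := ideal_mod J) (@submod0 K 4 1) hk (hJ _)).
Qed.

End LexHdeg.

(** * The curve *)

Section CurveIdeal.
Variables (K : fieldType) (c b a : nat).
Hypothesis bca : (b + c = a)%N.
Local Notation S := {mpoly K[4]}.
Local Notation d := c.+2.
Local Notation x := ('X_i0 : S).
Local Notation y := ('X_i1 : S).
Local Notation z := ('X_i2 : S).
Local Notation t := ('X_i3 : S).
Local Notation J := (curve_ideal K d a).

Lemma kill_var_dvd (i : 'I_4) (p : S) : kill_vars [set i] p = 0 <-> exists q, p = 'X_i * q.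
Proof.
split=> [/kill_vars_eq0 h|[q ->]]; last first.
  by rewrite kill_varsM kill_varsX ifF ?mul0r //; apply/negbTE/forall_inPn; exists i; rewrite ?inE // mnm1E eqxx.
have [q hq] := mpoly_divX U_(i) p; exists q; apply/eqP; rewrite -subr_eq0; apply/eqP.
apply/mpolyP => m; rewrite hq mcoeff0 lep1mP.
case: ifP => // mi; apply/eqP; apply: contraFT mi; rewrite -mcoeff_msupp => /h [j].
by rewrite inE => /eqP ->.
Qed.

Lemma kill_var_other (i j : 'I_4) k : i != j -> kill_vars [set i] ('X_j ^+ k : S) = 'X_j ^+ k.
Proof.
move=> ij; rewrite mpolyXn kill_varsX ifT //; apply/forall_inP => l; rewrite inE => /eqP ->.
by rewrite mulmnE mnm1E [j == i]eq_sym (negbTE ij).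
Qed.

Lemma kill_var_split (i : 'I_4) (p : S) : exists q, p = kill_vars [set i] p + 'X_i * q.
Proof.
have [|q hq] := (kill_var_dvd i (p - kill_vars [set i] p)).1.
  by rewrite -[- _]mulN1r kill_varsD kill_varsM kill_vars_idem /kill_vars rmorphN1 mulN1r subrr.
by exists q; rewrite -hq addrC subrK.
Qed.

Lemma varX_neq0 (i : 'I_4) k : ('X_i ^+ k : S) != 0.
Proof. by rewrite mpolyXn -msupp_eq0 msuppX. Qed.

Lemma var_neq0 (i : 'I_4) : ('X_i : S) != 0.
Proof. by rewrite -msupp_eq0 msuppX. Qed.

(** X_i is prime and does not divide the power of X_j, so it divides [q]; cancelling it gives the
    Koszul syzygy. *)
Lemma var_coprime (i j : 'I_4) k (p q : S) : i != j -> 'X_i * p = 'X_j ^+ k * q ->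
  exists e, p = 'X_j ^+ k * e /\ q = 'X_i * e.
Proof.
move=> ij E; have /kill_var_dvd [e he] : kill_vars [set i] q = 0.
  have : kill_vars [set i] ('X_j ^+ k * q) = 0 by apply/kill_var_dvd; exists p.
  rewrite kill_varsM kill_var_other // => /eqP; rewrite mulf_eq0.
  by rewrite (negbTE (varX_neq0 j k)) => /eqP.
exists e; split=> //; apply: (mulfI (var_neq0 i)).
by rewrite E he mulrCA.
Qed.

Definition curve_gens : 'M[S]_(4, 1) :=
  \matrix_(i, j) nth 0 [:: x ^+ 2; x * y; y ^+ d; y ^+ c.+1 * z ^+ b + x * t ^+ a] i.

(** The rows come from the S-pairs (1,2), (2,4), (1,4), (2,3) of the generators with leading terms
    x^2, xy, y^d, x t^a. *)
Definition curve_syz : 'M[S]_4 := \matrix_(i, j) nth 0 (nth [::]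
  [:: [:: y; - x; 0; 0];
      [:: 0; t ^+ a; z ^+ b; - y];
      [:: t ^+ a; y ^+ c * z ^+ b; 0; - x];
      [:: 0; y ^+ c.+1; - x; 0]] i) j.

Definition curve_syz2 : 'M[S]_(1, 4) :=
  \matrix_(i, j) nth 0 [:: t ^+ a; x; - y; z ^+ b] j.

Definition curve_rk i : nat := match i with 0 => 1 | 1 => 4 | 2 => 4 | 3 => 1 | _ => 0 end.

Definition curve_shift i (k : 'I_(curve_rk i)) : int :=
  match i with
  | 0 => 0
  | 1 => (nth 0 [:: 2; 2; d; a.+1] k)%N%:Z
  | 2 => (nth 0 [:: 3; a.+2; a.+2; c.+3] k)%N%:Z
  | _ => a.+3%:Z
  end.

Definition curve_diff i : 'M[S]_(curve_rk i.+1, curve_rk i) :=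
  match i with
  | 0 => curve_gens
  | 1 => curve_syz
  | 2 => curve_syz2
  | _ => 0
  end.

Definition curve_res := @ResolutionData K 4 1 curve_rk curve_shift curve_diff 1%:M.

Lemma curve_idealE p : J p <-> exists w : 'rV[S]_4, p = (w *m curve_gens) 0 0.
Proof.
have hb : (a + 2 - d = b)%N by lia.
rewrite /curve_ideal /ideal_gen /= hb.
split=> [[u ->]|[w ->]].
  exists (\row_i u i); rewrite mxE; apply: eq_bigr => i _; by rewrite !mxE.
exists (fun i => w 0 i); rewrite mxE; apply: eq_bigr => i _; by rewrite !mxE.
Qed.

Lemma curve_ideal_ideal : is_ideal J.
Proof.
split; first by apply/curve_idealE; exists 0; rewrite mul0mx mxE.
move=> u p q /curve_idealE [v ->] /curve_idealE [w ->]; apply/curve_idealE.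
by exists (u *: v + w); rewrite mulmxDl -scalemxAl !mxE.
Qed.

Lemma rowv4 (R : nzRingType) (v w : 'rV[R]_4) : v 0 i0 = w 0 i0 -> v 0 i1 = w 0 i1 ->
  v 0 i2 = w 0 i2 -> v 0 i3 = w 0 i3 -> v = w.
Proof. by move=> *; apply/rowP; apply: ord4P. Qed.

Definition row4 (p q r s : S) : 'rV[S]_4 := \row_i nth 0 [:: p; q; r; s] i.

Lemma mul_gens (v : 'rV[S]_4) : (v *m curve_gens) 0 0 = v 0 i0 * x ^+ 2 + v 0 i1 * (x * y)
  + v 0 i2 * y ^+ d + v 0 i3 * (y ^+ c.+1 * z ^+ b + x * t ^+ a).
Proof. by rewrite mxE big_ord4 !mxE. Qed.

Lemma mul_syz (v : 'rV[S]_4) : v *m curve_syz = row4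
  (v 0 i0 * y + v 0 i2 * t ^+ a)
  (- (v 0 i0 * x) + v 0 i1 * t ^+ a + v 0 i2 * (y ^+ c * z ^+ b) + v 0 i3 * y ^+ c.+1)
  (v 0 i1 * z ^+ b - v 0 i3 * x)
  (- (v 0 i1 * y) - v 0 i2 * x).
Proof.
apply: rowv4; rewrite !mxE big_ord4 !mxE /=; ring.
Qed.

Lemma mul_syz2 (v : 'rV[S]_1) : v *m curve_syz2 = row4
  (v 0 0 * t ^+ a) (v 0 0 * x) (- (v 0 0 * y)) (v 0 0 * z ^+ b).
Proof. by apply: rowv4; rewrite !mxE big_ord1 !mxE /= ?mulrN. Qed.

Lemma row4E p q r s : [/\ row4 p q r s 0 i0 = p, row4 p q r s 0 i1 = q,
  row4 p q r s 0 i2 = r & row4 p q r s 0 i3 = s].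
Proof. by split; rewrite mxE. Qed.

Lemma row4_inj p q r s p' q' r' s' : row4 p q r s = row4 p' q' r' s' ->
  [/\ p = p', q = q', r = r' & s = s'].
Proof.
move=> E; have h i := congr1 (fun w : 'rV_4 => w 0 i) E.
by split; [have := h i0|have := h i1|have := h i2|have := h i3]; rewrite !mxE.
Qed.

Lemma row4_0 : row4 0 0 0 0 = 0.
Proof. by apply: rowv4; rewrite !mxE. Qed.

Lemma curve_homog i :
  homog_mx (curve_shift (i := i.+1)) (curve_shift (i := i)) (curve_diff i).
Proof.
have hX (j : 'I_4) k : homog_poly k%:Z ('X_j ^+ k : S).
  by rewrite mpolyXn; apply: homog_polyX; rewrite mdegMn mdeg1 mul1n.
have hv (j : 'I_4) : homog_poly 1%:Z ('X_j : S) by apply: homog_polyX; rewrite mdeg1.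
have cast e e' (p : S) : homog_poly e p -> e = e' -> homog_poly e' p by move=> h <-.
case: i => [|[|[|i]]]; last by case.
- move=> i j; rewrite mxE; move: i; apply: ord4P => /=.
  + by apply: (cast _ _ _ (hX _ _)); rewrite subr0.
  + by apply: (cast _ _ _ (homog_polyM (hv _) (hv _))).
  + by apply: (cast _ _ _ (hX _ _)); rewrite subr0.
  apply: homog_polyD.
    by apply: (cast _ _ _ (homog_polyM (hX _ _) (hX _ _))); lia.
  by apply: (cast _ _ _ (homog_polyM (hv _) (hX _ _))); lia.
- move=> i j; rewrite mxE; move: i j; apply: ord4P; apply: ord4P => /=;
  try exact: homog_poly0; try apply: homog_polyN;
  first [ by apply: (cast _ _ _ (hv _)); lia | by apply: (cast _ _ _ (hX _ _)); lia
     | by apply: (cast _ _ _ (homog_polyM (hX _ _) (hX _ _))); lia].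
move=> i j; rewrite mxE; move: j; apply: ord4P => /=; try apply: homog_polyN.
all: by [ apply: (cast _ _ _ (hv _)); lia | apply: (cast _ _ _ (hX _ _)); lia].
Qed.

Lemma curve_exact1 (v : 'rV[S]_4) :
  (v *m curve_gens) 0 0 = 0 <-> exists w, v = w *m curve_syz.
Proof.
split=> [|[w ->]]; last first.
  by rewrite mul_gens mul_syz !mxE /= !exprS; ring.
rewrite mul_gens; set c1 := v 0 i0; set c2 := v 0 i1; set c3 := v 0 i2; set c4 := v 0 i3 => E.
(* Modulo x the relation becomes y^(c+1) (y c3 + z^b c4) = 0; cancelling the power of y leaves a
   syzygy of y and z^b. *)
pose k := @kill_vars K 4 [set i0].
have k0 : k x = 0 by apply/kill_var_dvd; exists 1; rewrite mulr1.
have ky j : k (y ^+ j) = y ^+ j by apply: kill_var_other.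
have kz j : k (z ^+ j) = z ^+ j by apply: kill_var_other.
have E0 : y * k c3 = z ^+ b * - k c4.
  have kD p q : k (p + q) = k p + k q by exact: kill_varsD.
  have kM p q : k (p * q) = k p * k q by exact: kill_varsM.
  have ky1 : k y = y := ky 1%N.
  have := congr1 k E; rewrite !exprS expr0 !(kD, kM) k0.
  rewrite !ky1 !ky kz [k 0]kill_vars0.
  move=> E'; apply: (mulfI (varX_neq0 i1 c.+1)).
  apply/eqP; rewrite -subr_eq0; apply/eqP; rewrite -[RHS]E'.
  rewrite !exprS; ring.
have [e [E3 E4]] := var_coprime (isT : i1 != i2) E0.
have [h H3] := kill_var_split i0 c3; have [g H4] := kill_var_split i0 c4.
have H3' : c3 = z ^+ b * e + x * h by rewrite {1}H3 -/k E3.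
have H4' : c4 = - (y * e) + x * g by rewrite {1}H4 -/k -E4 opprK.
(* Once c3 and c4 are written modulo x, the whole relation is divisible by x; the quotient is a
   syzygy of x and y. *)
have E1 : x * (c1 + g * t ^+ a) =
    y ^+ 1 * - (c2 - e * t ^+ a + g * (y ^+ c * z ^+ b) + h * y ^+ c.+1).
  apply: (mulfI (var_neq0 i0)); apply/eqP; rewrite -subr_eq0; apply/eqP.
  by rewrite -[RHS]E H3' H4' !exprS; ring.
have [l [F1 F2]] := var_coprime (isT : i0 != i1) E1.
exists (row4 l e (- g) (- h)); rewrite mul_syz.
apply: rowv4; rewrite !mxE /= -/c1 -/c2 -/c3 -/c4.
- by rewrite -(addrK (g * t ^+ a) c1) F1 expr1; ring.
- have -> : c2 = - (x * l) + e * t ^+ a - g * (y ^+ c * z ^+ b) - h * y ^+ c.+1.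
    by rewrite -F2; ring.
  ring.
- by rewrite H3'; ring.
- by rewrite H4'; ring.
Qed.

Lemma curve_exact2 (v : 'rV[S]_4) : v *m curve_syz = 0 <-> exists w, v = w *m curve_syz2.
Proof.
split=> [|[w ->]]; last first.
  by rewrite mul_syz mul_syz2 -row4_0 !mxE /=; congr row4; rewrite ?exprS; ring.
rewrite mul_syz -row4_0 => /row4_inj [h1 _ h3 h4].
(* The last column is a syzygy of x and y and fixes entries 1 and 2; the first and third columns
   then give entries 0 and 3 after cancelling y and x. *)
have E : x * v 0 i2 = y ^+ 1 * - v 0 i1.
  by apply/eqP; rewrite -subr_eq0 expr1 -oppr_eq0 -[X in _ == X]h4; apply/eqP; ring.
have [e [E2 E1]] := var_coprime (isT : i0 != i1) E.
have H1 : v 0 i1 = x * - e by rewrite mulrN -E1 opprK.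
rewrite expr1 in E2.
exists (const_mx (- e)); rewrite mul_syz2 mxE; apply: rowv4; rewrite [RHS]mxE /=.
- apply: (mulfI (var_neq0 i1)); apply/eqP; rewrite -subr_eq0; apply/eqP.
  by rewrite -[RHS]h1 E2; ring.
- by rewrite H1 mulrC.
- by rewrite E2; ring.
- apply: (mulfI (var_neq0 i0)); apply/eqP; rewrite eq_sym -subr_eq0; apply/eqP.
  by rewrite -[RHS]h3 H1; ring.
Qed.

Lemma curve_resolution : is_free_resolution (M := quot_mod J) curve_res.
Proof.
split; first split=> [i j|i].
- by rewrite !ord1 mxE; apply: homog_polyC.
- exact: curve_homog.
split=> [//|u _|v|].
- by exists u; rewrite /= mulmx1 subrr mxE; case: curve_ideal_ideal.
- rewrite /= mulmx1; apply: (iff_trans (curve_idealE _)); split=> -[w E]; exists w.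
    by apply/rowP => k; rewrite ord1.
  by rewrite E.
case=> [|[|[|i]]] v /=.
- apply: (iff_trans _ (curve_exact1 v)); split=> [->|E]; first by rewrite mxE.
  by apply/rowP => k; rewrite ord1 E mxE.
- exact: curve_exact2.
- split=> [|[w ->]]; last by rewrite mulmx0 mul0mx.
  rewrite mul_syz2 -row4_0 => /row4_inj [_ /eqP]; rewrite mulf_eq0 (negbTE (var_neq0 i0)) orbF.
  move=> /eqP h _ _; exists 0; rewrite mul0mx; by apply/rowP => k; rewrite ord1 h mxE.
by split=> [_|_]; [exists 0; rewrite [v]thinmx0 mul0mx | rewrite [v]thinmx0 mul0mx].
Qed.

End CurveIdeal.

(** * Groebner basis, Ext modules and hdeg of the curve *)

Section CurveHdeg.
Variables (K : fieldType) (c b a : nat).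
Hypothesis bca : (b + c = a)%N.
Local Notation S := {mpoly K[4]}.
Local Notation d := c.+2.
Local Notation x := ('X_i0 : S).
Local Notation y := ('X_i1 : S).
Local Notation z := ('X_i2 : S).
Local Notation t := ('X_i3 : S).
Local Notation J := (curve_ideal K d a).
Local Notation M := (quot_mod J).
Local Notation F := (curve_res K c b a).

Let iJ : is_ideal J := curve_ideal_ideal K bca.

Lemma curve_ideal_hcomp e p : J p -> J (hcomp e p).
Proof.
move=> /(curve_idealE bca) [w ->]; apply/(curve_idealE bca).
exists (vcomp (@curve_shift c a 1) e w).
rewrite -(vcomp_mul e w (@curve_homog K c b a bca 0)).
by rewrite [RHS]mxE subr0.
Qed.

Lemma curve_gens_mem : [/\ J (x ^+ 2), J (x * y), J (y ^+ d)
  & J (y ^+ c.+1 * z ^+ b + x * t ^+ a)].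
Proof.
by split; apply/(curve_idealE bca);
  [exists (row4 1 0 0 0) | exists (row4 0 1 0 0) | exists (row4 0 0 1 0) | exists (row4 0 0 0 1)];
  rewrite mul_gens !mxE /=;
  rewrite !mul0r !mul1r ?addr0 ?add0r.
Qed.

Lemma mcoeffMX_if (p : S) m k : (p * 'X_[m])@_k = if (m <= k)%MM then p@_(k - m) else 0.
Proof.
case: ifP => [mk|mk]; first by rewrite -{1}(submK mk) addmC mcoeffMX.
apply: memN_msupp_eq0; rewrite (perm_mem (msuppMX p m)).
by apply/mapP => -[k' _ E]; rewrite E lem_addr in mk.
Qed.

Lemma mono4s n0 n1 n2 n3 : (mono4 n0 n1 n2 n3 i0 = n0) * (mono4 n0 n1 n2 n3 i1 = n1) *
  (mono4 n0 n1 n2 n3 i2 = n2) * (mono4 n0 n1 n2 n3 i3 = n3).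
Proof. by have [-> -> -> ->] := mono4E n0 n1 n2 n3. Qed.

Lemma mono4X n0 n1 n2 n3 : 'X_[mono4 n0 n1 n2 n3] = x ^+ n0 * y ^+ n1 * z ^+ n2 * t ^+ n3.
Proof.
rewrite !mpolyXn -!mpolyXD; congr ('X_[_]).
by apply: mnm4P; rewrite !mnmDE !mulmnE !mnm1E mono4s /=; lia.
Qed.

(** A nonstandard monomial with x = 1, y = 0 (exponents) is a multiple of x t^a, which is congruent
    to - y^(d-1) z^b; the added monomial is standard, so the basis is reduced. Other nonstandard
    monomials belong to I themselves. *)
Definition curve_nf (m : 'X_{1..4}) : S :=
  'X_[m] + (if (m i0 == 1)%N && (m i1 == 0)%N
            then 'X_[mono4 0 c.+1 (m i2 + b) (m i3 - a)] else 0).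

(* On elements of the ideal the coefficient of a standard monomial m is that of
   the monomial which reduces to - m, if there is one. *)
Lemma curve_ideal_coeff p m : J p -> curve_std d a m ->
  p@_m = if [&& m i0 == 0, m i1 == c.+1 & b <= m i2]%N
         then p@_(mono4 1 0 (m i2 - b) (m i3 + a)) else 0.
Proof.
move=> /(curve_idealE bca) [w ->] sm; rewrite mul_gens.
set m' := mono4 _ _ _ _.
have [h0 h1 h2 h3] : [/\ m' i0 = 1, m' i1 = 0, m' i2 = m i2 - b & m' i3 = m i3 + a]%N.
  exact: mono4E.
have E1 : x ^+ 2 = 'X_[mono4 2 0 0 0] by rewrite mono4X !expr0 !mulr1.
have E2 : x * y = 'X_[mono4 1 1 0 0] by rewrite mono4X !expr0 !mulr1 !expr1.
have E3 : y ^+ d = 'X_[mono4 0 d 0 0] by rewrite mono4X !expr0 !mulr1 mul1r.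
have E4 : y ^+ c.+1 * z ^+ b = 'X_[mono4 0 c.+1 b 0] by rewrite mono4X !expr0 !mulr1 mul1r.
have E5 : x * t ^+ a = 'X_[mono4 1 0 0 a] by rewrite mono4X !expr0 !mulr1 expr1.
rewrite E1 E2 E3 E4 E5 mulrDr !mcoeffD !mcoeffMX_if !lem4 !mono4s.
move: sm; rewrite /curve_std /plane_std.
have [/and3P[/eqP k0 /eqP k1 k2]|nk] := boolP [&& m i0 == 0, m i1 == c.+1 & b <= m i2]%N => sm.
  rewrite k0 k1 k2 /= !ltnn /= !add0r ?addr0 leq_addl ltnSn /=.
  congr (_@_ _); apply: mnm4P; rewrite !mnmBE ?h0 ?h1 ?h2 ?h3 !mono4s; lia.
by do 5! [rewrite ifF; last by lia]; rewrite !addr0.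
Qed.

Lemma curve_std_free p : J p -> (forall m, ~~ curve_std d a m -> p@_m = 0) -> p = 0.
Proof.
move=> Jp h; apply/mpolyP => m; rewrite mcoeff0.
have [sm|/h //] := boolP (curve_std d a m).
rewrite (curve_ideal_coeff Jp sm); case: ifP => // _; apply: h.
have [h0 h1 h2 h3] := mono4E 1 0 (m i2 - b) (m i3 + a).
by rewrite /curve_std /plane_std h0 h1 h3; lia.
Qed.

Lemma monomial_mem (p : S) (m k : 'X_{1..4}) : J 'X_[k] -> (k <= m)%MM -> J 'X_[m].
Proof. by move=> Jk km; rewrite -(submK km) mpolyXD; apply: idealM. Qed.

Lemma curve_nf_mem m : ~~ curve_std d a m -> J (curve_nf m).
Proof.
have [Jx Jxy Jy Jf] := curve_gens_mem.
have E1 : x ^+ 2 = 'X_[mono4 2 0 0 0] by rewrite mono4X !expr0 !mulr1.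
have E2 : x * y = 'X_[mono4 1 1 0 0] by rewrite mono4X !expr0 !mulr1 !expr1.
have E3 : y ^+ d = 'X_[mono4 0 d 0 0] by rewrite mono4X !expr0 !mulr1 mul1r.
rewrite E1 in Jx; rewrite E2 in Jxy; rewrite E3 in Jy.
rewrite /curve_std /plane_std /curve_nf => nm; case: ifP => [/andP[/eqP m0 /eqP m1]|hm].
  have ta : (a <= m i3)%N by lia.
  have -> : m = (mono4 0 0 (m i2) (m i3 - a) + mono4 1 0 0 a)%MM.
    by apply: mnm4P; rewrite !mnmDE !mono4s; lia.
  have [_ _ e2 e3] := mono4E 0 0 (m i2) (m i3 - a).
  have [_ _ f2 f3] := mono4E 1 0 0 a.
  rewrite !mnmDE e2 e3 f2 f3 addn0 addnK.
  have -> : mono4 0 c.+1 (m i2 + b) (m i3 - a) = (mono4 0 0 (m i2) (m i3 - a) + mono4 0 c.+1 b 0)%MM.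
    by apply: mnm4P; rewrite !mnmDE !mono4s; lia.
  rewrite !mpolyXD -mulrDr; apply: idealM => //.
  by rewrite [_ + _]addrC !mono4X !expr0 !mulr1 !mul1r expr1.
rewrite addr0; have [x2|x1] := leqP 2 (m i0).
  by apply: (monomial_mem 0 Jx); rewrite lem4 !mono4s; lia.
have [yd|yd] := leqP d (m i1).
  by apply: (monomial_mem 0 Jy); rewrite lem4 !mono4s; lia.
by apply: (monomial_mem 0 Jxy); rewrite lem4 !mono4s; lia.
Qed.

Lemma curve_nf_homog m : ~~ curve_std d a m -> homog_poly (mdeg m) (curve_nf m).
Proof.
move=> nm; apply: homog_polyD; first exact: homog_polyX.
case: ifP => [/andP[/eqP m0 /eqP m1]|_]; last exact: homog_poly0.
apply: homog_polyX; move: nm; rewrite /curve_std /plane_std !mdeg4 !mono4s m0 m1.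
by move=> nm; congr Posz; lia.
Qed.

Lemma curve_nf_coeff m m' : ~~ curve_std d a m -> ~~ curve_std d a m' ->
  (curve_nf m)@_m' = (m == m')%:R.
Proof.
move=> _ nm'; rewrite mcoeffD mcoeffX; case: ifP => _; last by rewrite mcoeff0 addr0.
rewrite mcoeffX; case: (mono4 _ _ _ _ =P m') => [E|_]; last by rewrite addr0.
by move: nm'; rewrite -E /curve_std /plane_std !mono4s; lia.
Qed.

Lemma hilbert_curve_ideal j :
  hilbert_fun (ideal_mod J) j%:Z (count (predC (curve_std d a)) (monos 4 j)).
Proof.
by apply: (hilbert_ideal_std iJ curve_std_free curve_nf_mem curve_nf_homog curve_nf_coeff).
Qed.

Lemma hilbert_curve_quot j : hilbert_fun M j%:Z (hcurve d a j).
Proof.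
by apply: (hilbert_quot_std iJ curve_std_free curve_nf_mem curve_nf_homog curve_nf_coeff).
Qed.

Lemma is_gmod_curve : is_gmod M.
Proof. by apply: is_gmod_quot => // e p; apply: curve_ideal_hcomp. Qed.

Lemma curve_homogeneous : homogeneous_ideal J.
Proof. by split=> // p Jp i; apply: (@curve_ideal_hcomp (Posz i)). Qed.

Lemma mod_dim_curve : mod_dim M 2.
Proof.
have [Jx _ Jy _] := curve_gens_mem.
apply: mod_dim_quot => //; apply: (@ring_dim_plane K _ d) => //; last first.
  have -> : x ^+ d = x ^+ c * x ^+ 2 by rewrite -exprD addn2.
  exact: idealM.
move=> p Jp m pm; have /kill_vars_eq0 /(_ m pm) [k] : kill_vars [set i0; i1] p = 0.
  have k0 : kill_vars [set i0; i1] x = 0.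
    rewrite kill_varsX ifF //; apply/negbTE/forall_inPn; exists i0; first by rewrite !inE.
    by rewrite mnm1E eqxx.
  have k1 : kill_vars [set i0; i1] y = 0.
    rewrite kill_varsX ifF //; apply/negbTE/forall_inPn; exists i1; first by rewrite !inE.
    by rewrite mnm1E eqxx.
  have := Jp => /(curve_idealE bca) [w ->]; rewrite mul_gens.
  rewrite !(kill_varsD, kill_varsM, kill_varsXn) k0 k1.
  by rewrite !exprS !(mul0r, mulr0, addr0).
by rewrite !inE => /orP[] /eqP -> ->; rewrite ?orbT.
Qed.

Definition curve_exp k := nth 0%N [:: 1; 1; b; a]%N k.

Lemma curve_ext3 : cyclic_gmod (E := ext_mod F 3) (monid (powQ curve_exp 4))
  (4%:Z - a.+3%:Z) (const_mx 1).
Proof.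
split=> /=.
- by rewrite trmx0 mulmx0.
- by move=> k; rewrite mxE subrr; apply: homog_polyC.
- move=> v _; exists (v 0 0), 0; rewrite mul0mx; apply/rowP => k.
  by rewrite ord1 !mxE mulr1 subrr.
have memE p : (exists w : 'rV[S]_4, p *: (const_mx 1 : 'rV[S]_1) = w *m (curve_syz2 K b a)^T) <->
    exists w : 'rV[S]_4, p = w 0 i0 * t ^+ a + w 0 i1 * x - w 0 i2 * y + w 0 i3 * z ^+ b.
  have E (w : 'rV[S]_4) : (w *m (curve_syz2 K b a)^T) 0 0 =
      w 0 i0 * t ^+ a + w 0 i1 * x - w 0 i2 * y + w 0 i3 * z ^+ b.
    by rewrite mxE big_ord4 !mxE /= mulrN.
  split=> -[w h]; exists w; first by rewrite -E -h !mxE mulr1.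
  by apply/rowP => k; rewrite ord1 E -h !mxE mulr1.
have iQ := @monid_ideal K 4 _ (@powQ_upclosed 4 curve_exp 4).
move=> p; apply: (iff_trans (memE p)); split=> [[w ->]|/monidP hp].
  have mem (i : 'I_4) (q : S) : monid (powQ curve_exp 4) (q * 'X_i ^+ curve_exp i).
    apply: (idealM _ iQ); rewrite mpolyXn; apply/monidX; apply/existsP; exists i.
    by rewrite ltn_ord mulmnE mnm1E eqxx mul1n /=.
  apply: (idealD iQ); last exact: (mem i2).
  apply: (idealB iQ); last exact: (mem i1).
  by apply: (idealD iQ); [exact: (mem i3) | exact: (mem i0)].
(* Divide successively by x, y, z^b, t^a: a term of the last remainder is divisible by none of them,
   so there is none. The order and the sign of the quotients follow [curve_syz2]. *)
have [q0 h0] := mpoly_divX U_(i0) p.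
have [q1 h1] := mpoly_divX U_(i1) (p - x * q0).
have [q2 h2] := mpoly_divX (U_(i2) *+ b) (p - x * q0 - y * q1).
have [q3 h3] := mpoly_divX (U_(i3) *+ a) (p - x * q0 - y * q1 - 'X_[U_(i2) *+ b] * q2).
exists (row4 q3 q0 (- q1) q2); case: (row4E q3 q0 (- q1) q2) => -> -> -> ->.
have : p - x * q0 - y * q1 - 'X_[U_(i2) *+ b] * q2 - 'X_[U_(i3) *+ a] * q3 = 0.
  apply/mpolyP => m; rewrite h3 mcoeff0; case: ifP => // n3.
  rewrite h2; case: ifP => // n2; rewrite h1; case: ifP => // n1.
  rewrite h0; case: ifP => // n0; apply/eqP; apply: contraT => /hp.
  by move: n0 n1 n2 n3; rewrite powQ4 !lep1mP !lem_pow /curve_exp /=; lia.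
rewrite -!mpolyXn => E; apply/eqP; rewrite -subr_eq0 -[X in _ == X]E; apply/eqP; ring.
Qed.

Lemma hdeg_curve_ext3 : (0 < b)%N -> (0 < a)%N -> is_hdeg (ext_mod F 3) (a * b)%N.
Proof.
move=> b0 a0; pose s := [seq mono4 0 0 k l | k <- iota 0 b, l <- iota 0 a].
have sz : size s = (a * b)%N by rewrite size_allpairs !size_iota mulnC.
have cF := free_resolution_complex (curve_resolution K bca).
rewrite -sz; apply: (@hdeg_cyclic_monomial K 4 (ext_mod F 3) (powQ curve_exp 4) (4%:Z - a.+3%:Z) (const_mx 1)).
- exact: ext_num_submod.
- exact: ext_den_submod.
- exact: powQ_upclosed.
- exact: curve_ext3.
- exact: is_gmod_ext.
- apply: allpairs_uniq; rewrite ?iota_uniq // => -[k l] [k' l'] _ _ /= E.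
  have := congr1 (fun m : 'X_{1..4} => m i2) E; have := congr1 (fun m : 'X_{1..4} => m i3) E.
  by rewrite !mono4s => -> ->.
- move=> m; rewrite powQ4 /curve_exp /=; apply/allpairsP/idP => [[[k l] /= []]|h].
    rewrite !mem_iota /= => hk hl ->; rewrite !mono4s; lia.
  exists (m i2, m i3); rewrite /= !mem_iota; split; try lia.
  by apply: mnm4P; rewrite !mono4s; lia.
- by rewrite sz muln_gt0 a0.
Qed.

Lemma hdeg_curve : (0 < b)%N -> (0 < a)%N -> is_hdeg M (d + a * b)%N.
Proof.
move=> b0 a0; have rF := curve_resolution K bca.
apply: (@hdeg_dim2 K 4 M d 0 (a * b) F is_gmod_curve mod_dim_curve _ rF).
- apply: (is_deg_dim2 (a := a) (j0 := a) mod_dim_curve) => j aj.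
  by have := hilbert_curve_quot j; rewrite hcurveE (minn_idPl aj).
(* The resolution has length 3: its term of index 4 has rank 0. *)
- apply: HdegZero; first exact: is_gmod_ext (free_resolution_complex rF) _.
  by move=> v _; exists 0; rewrite mul0mx [v]thinmx0.
exact: hdeg_curve_ext3.
Qed.

End CurveHdeg.

(** The genus is replaced by the inequality it implies, [d <= a.+1], which makes the exponent a - d
    + 2 positive. *)
Lemma hdeg_curve_and_lex (K : fieldType) (d a : nat) : (1 < d)%N -> (d <= a.+1)%N ->
  is_hdeg (quot_mod (curve_ideal K d a)) (d + a * (a + 2 - d))%N /\
  is_hdeg (quot_mod (lex_ideal (curve_ideal K d a))) (d + a * d)%N.
Proof.
case: d => [|[|c]] // d1 da; have bca : (a - c + c = a)%N by lia.
have -> : (a + 2 - c.+2 = a - c)%N by lia.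
split; first by apply: (hdeg_curve K bca); lia.
rewrite (lex_ideal_lexQ (d := c.+2) (a := a)); last exact: hilbert_curve_ideal bca.
exact: hdeg_lexQ.
Qed.

Theorem mainTheorem7 (K : fieldType) (hK : infinite_field K) :
  (forall (d a : nat) (g : int),
     (3 <= d)%N -> g < 'C(d - 2, 2)%:Z -> a%:Z = 'C(d - 1, 2)%:Z - g ->
     is_hdeg (quot_mod (curve_ideal K d a)) (d + a * (a + 2 - d))%N /\
     is_hdeg (quot_mod (lex_ideal (curve_ideal K d a))) (d + a * d)%N)
  /\ (is_hdeg (quot_mod (curve_ideal K 3 2)) 5 /\
      is_hdeg (quot_mod (lex_ideal (curve_ideal K 3 2))) 9)
  /\ (is_hdeg (quot_mod (curve_ideal K 3 5)) 23 /\
      is_hdeg (quot_mod (lex_ideal (curve_ideal K 3 5))) 18)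
  /\ ~ (forall J : {mpoly K[4]} -> Prop,
          homogeneous_ideal J -> mod_dim (quot_mod J) 2 ->
          forall h h' : nat, is_hdeg (quot_mod J) h ->
            is_hdeg (quot_mod (lex_ideal J)) h' -> (h <= h')%N)
  /\ ~ (forall J : {mpoly K[4]} -> Prop,
          homogeneous_ideal J -> mod_dim (quot_mod J) 2 ->
          forall h h' : nat, is_hdeg (quot_mod J) h ->
            is_hdeg (quot_mod (lex_ideal J)) h' -> (h >= h')%N).
Proof.
have [h5 h9] := @hdeg_curve_and_lex K 3 2 isT isT.
have [h23 h18] := @hdeg_curve_and_lex K 3 5 isT isT.
split=> [d a g d3 hg ha|].
  apply: hdeg_curve_and_lex; first by lia.
  case: d d3 hg ha => [|[|d]] // _ hg ha.
  (* Here [d] stands for the original d - 2, and Pascal's rule gives binom(d+1,2) - binom(d,2) = d,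
     hence a > d. *)
  have := binS d 1; rewrite bin1; move: hg ha.
  by rewrite subn1 subn2 /= => hg ha E; lia.
split=> //; split=> //; split=> H.
  (* For d = 3, a = 5 one has c = d - 2 = 1 and b = a - d + 2 = 4; the assumed relation would give
     23 <= 18. *)
  have := H _ (curve_homogeneous K (erefl : (4 + 1 = 5)%N))
    (mod_dim_curve K (erefl : (4 + 1 = 5)%N)) _ _ h23 h18; by [].
have := H _ (curve_homogeneous K (erefl : (1 + 1 = 2)%N))
  (mod_dim_curve K (erefl : (1 + 1 = 2)%N)) _ _ h5 h9; by [].
Qed.
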